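(* Suppose $Z(t)$, $t\ge 0$, is a stochastic process with regenerative increments over the renewal times $T_n$ such that $\mu:=\mathbb{E}[T_1]$, $a:=\mathbb{E}[Z(T_1)]/\mu$, and $\sigma^2:=\operatorname{Var}[Z(T_1)-aT_1]$ are finite. In addition, let $M_1:=\sup_{0\le t\le T_1}|Z(t)|$ and assume $M_1<\infty$ almost surely. Then $$\frac{Z(t)-at}{\sqrt t}\ \longrightarrow\ N(0,\sigma^2/\mu)\quad\text{in distribution as } t\to\infty .$$
   Context: Renewal times: $T_0:=0$ and $T_n:=\sum_{i=1}^n\xi_i$ for $n\ge 1$, where $(\xi_i)_{i\ge1}$ are i.i.d. strictly positive random variables (so $0<T_1<T_2<\cdots$ and $\xi_n=T_n-T_{n-1}$). $Z=(Z(t))_{t\ge0}$ is a real-valued stochastic process with continuous time parameter $t\in[0,\infty)$ and càdlàg (right-continuous with left limits) paths. The process $Z(t)$ has regenerative increments over the times $T_n$ if $Z(0)=0$ and the increments $$\zeta_n:=\bigl(\xi_n,\ \{Z(t+T_{n-1})-Z(T_{n-1}):0\le t\le\xi_n\}\bigr),\qquad n\ge1,$$ are i.i.d. Here the second component, defined on the random interval $[0,\xi_n]$, is regarded as a process on $[0,\infty)$ stopped at $\xi_n$, i.e. equal to $Z(\xi_n+T_{n-1})-Z(T_{n-1})$ for all $t\ge\xi_n$, so it is a random càdlàg function on $[0,\infty)$. The case $\sigma^2=0$ is included, with $N(0,0)$ denoting the distribution of the constant $0$. *)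

(* Defs.v *)
From HB Require Import structures.
From mathcomp Require Import all_boot all_order all_algebra.
From mathcomp Require Import finmap.
From mathcomp Require Import all_classical all_reals all_analysis.

Set Implicit Arguments.
Unset Strict Implicit.
Unset Printing Implicit Defensive.

Import Order.TTheory GRing.Theory Num.Theory.
Import numFieldNormedType.Exports.

Local Open Scope classical_set_scope.
Local Open Scope ring_scope.

Section iid.
Context d (T : measurableType d) (R : realType) (P : probability T R).
Context d' (E : measurableType d').

Definition mutually_independent (X : nat -> T -> E) : Prop :=
  forall (J : {fset nat}) (B : nat -> set E), (forall n, measurable (B n)) ->
    P (\bigcap_(n in [set` J]) (X n @^-1` B n)) =
    (\prod_(n <- J) P (X n @^-1` B n))%E.

Definition identically_distributed (X : nat -> T -> E) : Prop :=
  forall (m n : nat) (B : set E), measurable B ->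
    P (X m @^-1` B) = P (X n @^-1` B).

Definition iid (X : nat -> T -> E) : Prop :=
  [/\ forall n, measurable_fun setT (X n),
      mutually_independent X & identically_distributed X].

End iid.

(* Functions on [0, +oo[ with the sigma-algebra generated by the evaluation
   maps. Its trace on the set D of cadlag functions is the usual sigma-algebra
   of D (the Borel one for the Skorokhod topology), so for random elements with
   values in D the notions of measurability, law and independence are the same
   here as in D. *)
Definition path_cylinders (R : realType) : set (set ({nonneg R} -> R)) :=
  [set A | exists (t : {nonneg R}) (B : set R),
    measurable B /\ A = [set f | B (f t)]].

Definition path_space (R : realType) := g_sigma_algebraType (@path_cylinders R).

Section regenerative.
Context d (T : measurableType d) (R : realType) (P : probability T R).

(* The process is indexed by R; only its values at times t >= 0 matter. *)
Definition cadlag (f : R -> R) : Prop :=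
  forall t : R, 0 <= t ->
    f x @[x --> t^'+] --> f t /\ (0 < t -> cvg (f x @[x --> t^'-])).

Definition cadlag_process (Z : R -> T -> R) : Prop :=
  (forall t : R, 0 <= t -> measurable_fun setT (Z t)) /\
  (forall w, cadlag (fun t => Z t w)).

(* Indexed from 0: xi n is the gap between the n-th and (n+1)-st renewal times. *)
Definition renewal_time (xi : nat -> T -> R) (n : nat) (w : T) : R :=
  \sum_(i < n) xi i w.

Definition renewal_increments (xi : nat -> T -> R) : Prop :=
  iid P xi /\ (forall n w, 0 < xi n w).

Definition increment (xi : nat -> T -> R) (Z : R -> T -> R) (n : nat) (w : T) :
    (R * path_space R)%type :=
  (xi n w,
   fun t : {nonneg R} =>
     Z (Num.min t%:num (xi n w) + renewal_time xi n w) w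
     - Z (renewal_time xi n w) w).

Definition regenerative_increments (xi : nat -> T -> R) (Z : R -> T -> R) :
    Prop :=
  (forall w, Z 0 w = 0) /\ iid P (increment xi Z).

End regenerative.

(* The normal law with mean m and variance v >= 0. The library's [normal_prob]
   takes the standard deviation, and is not the degenerate law when it is 0. *)
Definition normal_law (R : realType) (m v : R) :
    probability (measurableTypeR R) R :=
  if v == 0
  then (@dirac _ (measurableTypeR R) m R : probability (measurableTypeR R) R)
  else (normal_prob m (Num.sqrt v) : probability (measurableTypeR R) R).

Definition cvg_in_distribution d (T : measurableType d) (R : realType)
    (P : probability T R) (X : R -> T -> R)
    (nu : probability (measurableTypeR R) R) : Prop :=
  forall f : R -> R, continuous f -> (exists M : R, forall x, `|f x| <= M) ->
    'E_P[f \o X t]%E @[t --> +oo] --> (\int[nu]_x (f x)%:E)%E.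

(* Main.v *)
(* With [W_i = Z(T_i) - Z(T_(i-1)) - a xi_i], centered and i.i.d. with variance sigma^2,
   [Z(t) - a t] differs from the partial sum of the [W_i] up to the cycle straddling [t] by at
   most the oscillation within that cycle. Three estimates reduce the theorem to the central
   limit theorem for a deterministic number of summands.
   - By the weak law, the number of renewals before [t] lies between (1 - delta) t / mu and
     (1 + delta) t / mu with high probability.
   - Between these bounds the partial sum moves by [sum_k 1(T_k <= t) W_(k+1)], a sum of
     orthogonal terms because the weights are predictable; its second moment is at most
     sigma^2 times the number of terms.
   - A window of width eta contains at most 2 renewals on average, where eta is such that
     [P(xi_1 > eta) >= 1/2]; hence, uniformly in [t], the law of the straddling cycle is
     dominated by 2 (xi_1 / eta + 1) times the law of a typical cycle, and since [M_1] is
     almost surely finite this cycle has oscillation at most [r] outside a small probability.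
   The central limit theorem itself is proved by Lindeberg's replacement argument for smooth
   test functions. These are uniformly dense in the bounded Lipschitz functions, from which
   bounded continuous ones are recovered by inf-convolution. *)
Require Import Defs.
From HB Require Import structures.
From mathcomp Require Import all_boot all_order all_algebra.
From mathcomp Require Import finmap.
From mathcomp Require Import all_classical all_reals all_analysis.
From mathcomp Require Import measurable_realfun ring lra.

Set Implicit Arguments.
Unset Strict Implicit.
Unset Printing Implicit Defensive.

Import Order.TTheory GRing.Theory Num.Theory.
Import numFieldNormedType.Exports.

Local Open Scope classical_set_scope.
Local Open Scope ring_scope.

Section probability_integrals.
Context d (T : measurableType d) (R : realType) (P : probability T R).

(** Only a mean is assumed of [T_1], only a variance of [Z(T_1) - a T_1], and [M_1] has no moment at
    all, so the cycle straddling t is not controlled by a maximal bound over about t / mu cycles.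
    One level [r] good for all t is enough; it exists because the dominating density grows linearly
    in the cycle length, hence is integrable when mu is finite. No limit law of the straddling cycle
    is used, so lattice gap laws need no separate case. The straddling cycle is itself counted in
    the partial sum: whether summand k occurs is then the event T_k <= t, decided by the first k
    cycles, and this makes the weights predictable. The normal summands of the replacement argument
    never exist as random variables: test functions are averaged against their laws, and convolution
    of normal laws merges the averages. All limit estimates concern an abstract i.i.d. sequence [X]
    with a length [tau], a centered total [phi] and a boolean [bad]. Paths enter only at the end;
    their sigma-algebra knows evaluations at fixed times alone, so [phi] and [bad] are read off
    countably many evaluations. *)

Lemma bounded_integrable (f : T -> R) (M : R) :
  measurable_fun setT f -> (forall x, `|f x| <= M) ->
  P.-integrable setT (EFin \o f).
Proof.
move=> mf fM; apply: measurable_bounded_integrable => //.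
  by rewrite (le_lt_trans (probability_le1 P measurableT))// ltry.
exists M; split; first exact: num_real.
by move=> N MN x _ /=; exact: le_trans (fM x) (ltW MN).
Qed.

Lemma Rintegral_prob_cst (c : R) : \int[P]_x c = c.
Proof. by rewrite Rintegral_cst// [X in fine X]probability_setT mulr1. Qed.

Lemma bounded_Rintegral (f : T -> R) (M : R) :
  measurable_fun setT f -> (forall x, `|f x| <= M) ->
  `|\int[P]_x f x| <= M.
Proof.
move=> mf fM; have fi := bounded_integrable mf fM.
rewrite (le_trans (le_normr_Rintegral _ fi))// -[leRHS]Rintegral_prob_cst.
apply: le_Rintegral => //.
  by apply: (bounded_integrable (M := M)) => [|x]; [exact: measurableT_comp|rewrite normr_id].
by apply: (bounded_integrable (M := `|M|)).
Qed.

Lemma EFin_Rintegral (f : T -> R) : P.-integrable setT (EFin \o f) ->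
  (\int[P]_x f x)%:E = (\int[P]_x (f x)%:E)%E.
Proof. by move=> fi; rewrite /Rintegral fineK//; exact: integrable_fin_num. Qed.

End probability_integrals.
Arguments EFin_Rintegral {d T R} P {f}.

Section real_integrable.
Context d (T : measurableType d) (R : realType).
Variable mu : {measure set T -> \bar R}.

Lemma integrableZ_EFin (k : R) (f : T -> R) : mu.-integrable setT (EFin \o f) ->
  mu.-integrable setT (EFin \o (fun x => k * f x)).
Proof. exact: integrableZl. Qed.

Lemma integrableD_EFin (f g : T -> R) : mu.-integrable setT (EFin \o f) ->
  mu.-integrable setT (EFin \o g) -> mu.-integrable setT (EFin \o (fun x => f x + g x)).
Proof. by move=> fi gi; have := integrableD measurableT fi gi. Qed.

Lemma integrableB_EFin (f g : T -> R) : mu.-integrable setT (EFin \o f) ->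
  mu.-integrable setT (EFin \o g) -> mu.-integrable setT (EFin \o (fun x => f x - g x)).
Proof. by move=> fi gi; have := integrableB measurableT fi gi. Qed.

Lemma le_integrable_EFin (f g : T -> R) : measurable_fun setT f ->
  (forall x, `|f x| <= g x) -> mu.-integrable setT (EFin \o g) ->
  mu.-integrable setT (EFin \o f).
Proof.
move=> mf fg; apply: le_integrable => //; first exact/measurable_EFinP.
by move=> x _; rewrite /= lee_fin (le_trans (fg x)) ?ler_norm.
Qed.

End real_integrable.

(** * Moments and convolution of normal laws *)

Section gauss.
Context {R : realType}.
Local Notation mu := (@lebesgue_measure R).
Local Open Scope ereal_scope.

(** Uniqueness of densities identifies the Radon-Nikodym derivative with [normal_pdf] up to a null
    set; boundedness of [f] supplies the integrability that the change of variables demands. *)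
Lemma bounded_integral_normal_prob (m s M : R) (f : R -> R) :
  measurable_fun setT f -> (forall x, `|f x| <= M)%R ->
  \int[normal_prob m s]_x (f x)%:E = \int[mu]_x (f x * normal_pdf m s x)%:E.
Proof.
move=> mf fM.
rewrite -(Radon_Nikodym_change_of_variables (@normal_prob_dominates R m s))//=; last first.
  exact: (bounded_integrable (normal_prob m s) mf fM).
apply: ae_eq_integral => //.
- apply: emeasurable_funM => //; first exact/measurable_EFinP.
  apply: (measurable_int mu) => /=.
  by apply: Radon_Nikodym_integrable; exact: normal_prob_dominates.
- apply/measurable_EFinP; apply: measurable_funM => //.
  exact: measurable_normal_pdf.
under [X in ae_eq _ _ _ X]eq_fun do rewrite EFinM.
apply: ae_eqe_mul2l => /=.
rewrite Radon_NikodymE//=; first exact: normal_prob_dominates.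
move=> h0; case: cid => /= h [h1 h2 h3].
apply: integral_ae_eq => //=.
- by apply/measurable_EFinP; exact: measurable_normal_pdf.
- by move=> E _ mE; rewrite -h3.
Qed.

(** Truncation at height [n] and monotone convergence remove the bound: at each point [g n x] equals
    [f x] for large [n]. *)
Lemma ge0_integral_normal_prob (m s : R) (f : R -> R) :
  measurable_fun setT f -> (forall x, 0 <= f x)%R ->
  \int[normal_prob m s]_x (f x)%:E = \int[mu]_x (f x * normal_pdf m s x)%:E.
Proof.
move=> mf f0; pose g (n : nat) x := Num.min (f x) n%:R.
have mg n : measurable_fun setT (g n) by exact: measurable_minr.
have g0 n x : (0 <= g n x)%R by rewrite /g le_min f0 ler0n.
have ndg x n k : (n <= k)%N -> (g n x <= g k x)%R.
  move=> nk; rewrite /g le_min ge_min lexx/= ge_min (_ : (n%:R <= k%:R)%R) ?orbT//.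
  by rewrite ler_nat.
have g_f x : \forall n \near \oo, g n x = f x.
  near=> n; rewrite /g; apply/min_idPl.
  by near: n; exact: nbhs_infty_ger.
transitivity (\int[normal_prob m s]_x limn (fun n => (g n x)%:E)).
  apply: eq_integral => x _; apply/esym/cvg_lim => //.
  by apply: cvg_near_cst; near do apply/eqP; apply: filterS (g_f x) => n ->.
rewrite monotone_convergence//; last first.
- by move=> x _ n k nk; rewrite lee_fin ndg.
- by move=> n x _; rewrite lee_fin.
- by move=> n; apply/measurable_EFinP; exact: mg.
transitivity (limn (fun n => \int[mu]_x (g n x * normal_pdf m s x)%:E)).
  congr (limn _); apply/funext => n.
  apply: (@bounded_integral_normal_prob m s n%:R) => // x.
  by rewrite ger0_norm// /g ge_min lexx orbT.
rewrite -monotone_convergence//; last first.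
- by move=> x _ n k nk; rewrite lee_fin ler_wpM2r ?normal_pdf_ge0 ?ndg.
- by move=> n x _; rewrite lee_fin mulr_ge0 ?normal_pdf_ge0.
- move=> n; apply/measurable_EFinP; apply: measurable_funM; first exact: mg.
  exact: measurable_normal_pdf.
apply: eq_integral => x _; apply/cvg_lim => //.
by apply: cvg_near_cst; apply: filterS (g_f x) => n ->.
Unshelve. all: by end_near. Qed.

Lemma normal_prob_mgf (s t : R) : s != 0%R ->
  \int[normal_prob 0 s]_x (expR (t * x))%:E = (expR (t ^+ 2 * s ^+ 2 / 2))%:E.
Proof.
move=> s0; rewrite ge0_integral_normal_prob; [|by apply: measurableT_comp => //; exact: measurable_funM|by move=> x; exact: expR_ge0].
under eq_integral.
  move=> x _.
  (* Completing the square: the exponential tilts the centered density into the one with mean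
     [t * s ^+ 2]. *)
  rewrite (_ : _ * _ = expR (t ^+ 2 * s ^+ 2 / 2) * normal_pdf (t * s ^+ 2) s x)%R; last first.
    rewrite /normal_pdf (negbTE s0) mulrCA [RHS]mulrCA /normal_fun -!expRD.
    by congr (_ * expR _)%R; field.
  rewrite EFinM; over.
rewrite ge0_integralZl//=; last 2 first.
- by apply/measurable_EFinP; exact: measurable_normal_pdf.
- by move=> x _; rewrite lee_fin normal_pdf_ge0.
by rewrite integral_normal_pdf mule1.
Qed.

Lemma integral_normal_prob_translation (s x : R) (f : R -> R) : s != 0%R ->
  continuous f -> (forall x, 0 <= f x)%R ->
  \int[normal_prob 0 s]_y (f (x + y))%:E = \int[mu]_u (f u * normal_pdf x s u)%:E.
Proof.
move=> s0 cf f0.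
have Dx : derive1 (fun y : R => x + y)%R = cst 1%R.
  by apply/funext => y; rewrite derive1E deriveD// derive_cst derive_id add0r.
rewrite (@ge0_integral_normal_prob 0 s (fun y => f (x + y)%R)); last 2 first.
- by apply: measurableT_comp; [exact: continuous_measurable_fun|exact: measurable_funD].
- by move=> y; exact: f0.
rewrite (@increasing_ge0_integration_by_substitutionT R (fun y => x + y)%R
  (fun u => f u * normal_pdf x s u)%R).
- apply: eq_integral => y _; rewrite Dx /= mulr1; congr (_ * _)%:E.
  by rewrite /normal_pdf (negbTE s0) /normal_fun; congr (_ * expR _)%R; field.
- by move=> a b ab; rewrite ltrD2l.
- by rewrite Dx => ?; exact: cvg_cst.
- by rewrite Dx; exact: is_cvg_cst.
- by rewrite Dx; exact: is_cvg_cst.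
- by [].
- exact: cvg_addrl_Ny.
- exact: cvg_addrl.
- by move=> u; apply: continuousM; [exact: cf|exact: continuous_normal_pdf].
- by move=> u; rewrite mulr_ge0// normal_pdf_ge0.
Qed.

(** The joint density of a normal variable and its sum [u] with an independent one, factored as the
    density of the sum times the conditional density of the first summand given the sum; the latter
    is again normal. *)
Lemma normal_pdf_convolution (s1 s2 u y : R) : (0 < s1)%R -> (0 < s2)%R ->
  let s := Num.sqrt (s1 ^+ 2 + s2 ^+ 2) in
  (normal_pdf y s2 u * normal_pdf 0 s1 y =
   normal_pdf 0 s u * normal_pdf (u * (s1 ^+ 2 / s ^+ 2)) (s1 * s2 / s) y)%R.
Proof.
move=> s10 s20 s.
have q0 : (0 < s1 ^+ 2 + s2 ^+ 2)%R by rewrite addr_gt0// exprn_gt0.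
have s0 : (0 < s)%R by rewrite sqrtr_gt0.
have s2E : (s ^+ 2 = s1 ^+ 2 + s2 ^+ 2)%R by rewrite sqr_sqrtr// ltW.
have r0 : (0 < s1 * s2 / s)%R by rewrite divr_gt0// mulr_gt0.
have peakE (x : R) : (0 < x)%R -> normal_peak x = ((x * Num.sqrt (pi *+ 2))^-1)%R.
  move=> x0; rewrite /normal_peak -mulrnAr sqrtrM ?sqr_ge0//.
  by rewrite sqrtr_sqr ger0_norm// ltW.
rewrite /normal_pdf !gt_eqF// !peakE//.
rewrite mulrACA [RHS]mulrACA /normal_fun -!expRD; congr (_ * expR _)%R.
  rewrite -!invfM; congr (_^-1)%R.
  by rewrite mulrACA [RHS]mulrACA; congr (_ * _)%R; field; rewrite gt_eqF.
rewrite expr_div_n s2E; field.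
by rewrite !gt_eqF// /s.
Qed.

Let measurable_pdf2 (s : R) : s != 0%R ->
  measurable_fun setT (fun z : R * R => normal_pdf z.1 s z.2).
Proof.
move=> s0; rewrite /normal_pdf (negbTE s0) /normal_fun.
apply: measurable_funM => //; apply: measurableT_comp => //.
apply: measurable_funM => //; apply: measurableT_comp => //.
by apply: measurable_funX; apply: measurable_funB.
Qed.

Lemma ge0_normal_prob_convolution (s1 s2 M : R) (f : R -> R) :
  (0 < s1)%R -> (0 < s2)%R -> continuous f -> (forall x, 0 <= f x <= M)%R ->
  \int[normal_prob 0 s1]_y \int[normal_prob 0 s2]_z (f (y + z))%:E =
  \int[normal_prob 0 (Num.sqrt (s1 ^+ 2 + s2 ^+ 2))]_u (f u)%:E.
Proof.
move=> s10 s20 cf fM.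
have f0 x : (0 <= f x)%R by have /andP[] := fM x.
have mf : measurable_fun setT f by exact: continuous_measurable_fun.
have fi y : (normal_prob y s2).-integrable setT (EFin \o f).
  apply: (@bounded_integrable _ _ R (normal_prob y s2) f M mf) => x.
  by rewrite ger0_norm//; have /andP[] := fM x.
have q0 : (0 < s1 ^+ 2 + s2 ^+ 2)%R by rewrite addr_gt0// exprn_gt0.
pose k (z : R * R) := (f z.2 * normal_pdf z.1 s2 z.2)%:E.
pose h (z : R * R) := k z * (normal_pdf 0 s1 z.1)%:E.
have mk : measurable_fun setT k.
  apply/measurable_EFinP; apply: measurable_funM; first exact: measurableT_comp.
  by apply: measurable_pdf2; rewrite gt_eqF.
have mp1 : measurable_fun setT (fun z : R * R => (normal_pdf 0 s1 z.1)%:E).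
  apply/measurable_EFinP; apply: measurableT_comp => //.
  exact: measurable_normal_pdf.
have mh : measurable_fun setT h by exact: emeasurable_funM.
have k0 z : 0 <= k z by rewrite lee_fin mulr_ge0// normal_pdf_ge0.
have h0 z : 0 <= h z by rewrite mule_ge0// lee_fin normal_pdf_ge0.
pose F y := (\int[normal_prob y s2]_u f u)%R.
have FE y : (F y)%:E = \int[mu]_u k (y, u).
  have H : \int[normal_prob y s2]_u (f u)%:E = \int[mu]_u k (y, u) by rewrite ge0_integral_normal_prob.
  rewrite -H; exact: (EFin_Rintegral (normal_prob y s2) (fi y)).
have mF : measurable_fun setT F.
  apply/measurable_EFinP.
  rewrite (_ : EFin \o F = fubini_F mu k); last exact/funext.
  exact: (@measurable_fun_fubini_tonelli_F _ _ _ _ _ mu k mk k0).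
transitivity (\int[mu]_y \int[mu]_u h (y, u)).
  transitivity (\int[normal_prob 0 s1]_y (F y)%:E).
    by apply: eq_integral => y _; rewrite integral_normal_prob_translation// gt_eqF.
  rewrite ge0_integral_normal_prob//; last by move=> y; exact: Rintegral_ge0.
  apply: eq_integral => y _; rewrite EFinM FE -ge0_integralZr//.
  - exact: (measurableT_comp mk).
  - by rewrite lee_fin normal_pdf_ge0.
(* With the order exchanged and the density factored, only the integral in [y] of a conditional
   density remains, which is 1. *)
rewrite (@fubini_tonelli _ _ _ _ _ mu mu h mh h0).
rewrite ge0_integral_normal_prob//; apply: eq_integral => u _.
transitivity (\int[mu]_y ((f u * normal_pdf 0 (Num.sqrt (s1 ^+ 2 + s2 ^+ 2)) u)%:E *
   (normal_pdf (u * (s1 ^+ 2 / Num.sqrt (s1 ^+ 2 + s2 ^+ 2) ^+ 2))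
     (s1 * s2 / Num.sqrt (s1 ^+ 2 + s2 ^+ 2)) y)%:E)).
  apply: eq_integral => y _; rewrite /h /k -!EFinM /=.
  congr (_%:E); rewrite -[LHS]mulrA -[RHS]mulrA; congr (_ * _)%R.
  exact: normal_pdf_convolution.
rewrite ge0_integralZl//=.
- by rewrite integral_normal_pdf mule1.
- by apply/measurable_EFinP; exact: measurable_normal_pdf.
- by move=> y _; rewrite lee_fin normal_pdf_ge0.
- by rewrite lee_fin mulr_ge0// normal_pdf_ge0.
Qed.

Local Close Scope ereal_scope.

Lemma MVT_norm_le (f df : R -> R) (a b c : R) :
  (forall x : R, is_derive x (1 : R) f (df x)) ->
  (forall x : R, Num.min a b <= x <= Num.max a b -> `|df x| <= c) ->
  `|f b - f a| <= c * `|b - a|.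
Proof.
move=> fdf dfc.
have cf : continuous f.
  move=> x; apply: differentiable_continuous.
  by apply/derivable1_diffP; have [] := fdf x.
wlog ab : a b dfc / a <= b.
  move=> H; have [/H->//|/ltW/H ba] := leP a b.
  rewrite distrC (distrC b); apply: ba => x.
  by rewrite minC maxC; exact: dfc.
have [e + ->] := MVT_segment ab (fun x _ => fdf x) (continuous_subspaceT cf).
rewrite in_itv/= => /andP[ae eb].
rewrite normrM ler_wpM2r// dfc//.
by rewrite (min_idPl ab) (max_idPr ab) ae eb.
Qed.

Let sub0_between (x t : R) : Num.min 0 x <= t <= Num.max 0 x -> `|t| <= `|x|.
Proof.
have [x0|x0] := leP 0 x => /andP[t1 t2]; first by rewrite !ger0_norm.
by rewrite (ltr0_norm x0) ler0_norm// lerN2.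
Qed.

Let le_expR_norm (x t : R) : `|t| <= `|x| -> expR t <= expR `|x|.
Proof. by move=> tx; rewrite ler_expR (le_trans (ler_norm t)). Qed.

Lemma expR_taylor0 (x : R) : `|expR x - 1| <= `|x| * expR `|x|.
Proof.
rewrite -expR0 mulrC -[in leRHS](subr0 x).
apply: (MVT_norm_le (df := expR)) => t.
by move=> /sub0_between tx; rewrite subr0 ger0_norm ?expR_ge0// le_expR_norm.
Qed.

(** The derivative of a Taylor remainder is the remainder of the order before, so the mean value
    inequality raises the order by one. Factorials are given up, as only the orders matter. *)
Lemma expR_taylor1 (x : R) : `|expR x - 1 - x| <= `|x| ^+ 2 * expR `|x|.
Proof.
pose f (t : R) := expR t - t.
have -> : expR x - 1 - x = f x - f 0 by rewrite /f expR0; ring.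
rewrite expr2 -mulrA mulrC -[X in _ * `|X|](subr0 x).
apply: (MVT_norm_le (df := fun t => expR t - 1)) => t.
move=> /sub0_between tx; rewrite (le_trans (expR_taylor0 t))//.
by rewrite ler_pM// ?expR_ge0// ler_expR.
Qed.

Lemma expR_taylor2 (x : R) :
  `|expR x - 1 - x - x ^+ 2 / 2| <= `|x| ^+ 3 * expR `|x|.
Proof.
pose f (t : R) := expR t - t - t ^+ 2 / 2.
have -> : expR x - 1 - x - x ^+ 2 / 2 = f x - f 0 by rewrite /f expR0; ring.
rewrite exprS -mulrA mulrC -[X in _ * `|X|](subr0 x).
apply: (MVT_norm_le (df := fun t => expR t - 1 - t)) => t.
  rewrite /f; apply: is_derive_eq.
  by rewrite /GRing.scale /=; field.
move=> /sub0_between tx; rewrite (le_trans (expR_taylor1 t))//.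
by rewrite ler_pM// ?exprn_ge0// ?expR_ge0// ?ler_expR// ler_pXn2r.
Qed.

Lemma eq0_linear_bound (a C : R) :
  (forall t, 0 < t -> t <= 1 -> `|a| <= C * t) -> a = 0.
Proof.
move=> aC; apply/eqP; rewrite -normr_le0 leNgt; apply/negP => a0.
have C0 : 0 < C by have := aC 1 ltr01 (lexx _); rewrite mulr1; exact: lt_le_trans.
have t0 : 0 < Num.min 1 (`|a| / (2 * C)) by rewrite lt_min ltr01 divr_gt0// mulr_gt0.
have := aC _ t0; rewrite ge_min lexx/= => /(_ isT); apply/negP; rewrite -ltNge.
apply: (@le_lt_trans _ _ (C * (`|a| / (2 * C)))).
  by rewrite ler_pM2l// ge_min lexx orbT.
rewrite [ltLHS](_ : _ = `|a| / 2); last by field; rewrite gt_eqF.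
by rewrite ltr_pdivrMr// ltr_pMr// ltr1n.
Qed.

Lemma exprn_fact_le_expR (n : nat) (u : R) : 0 <= u -> u ^+ n <= n`!%:R * expR u.
Proof.
case: n => [|n] u0; first by rewrite expr0 mul1r -expR0 ler_expR.
rewrite mulrC -ler_pdivrMr ?ltr0n ?fact_gt0//.
by rewrite (le_trans _ (expR_ge1Dxn n u0))// lerDr.
Qed.

Lemma expR_norm_le (u : R) : expR `|u| <= expR u + expR (- u).
Proof.
by have [u0|u0] := leP 0 u; [rewrite ger0_norm//|rewrite ltr0_norm//];
  rewrite ?lerDl ?lerDr expR_ge0.
Qed.

Section normal_moments.
Variable s : R.
Hypothesis s0 : 0 < s.
Local Notation N := (normal_prob 0 s).

Let mgf (t : R) : \int[N]_x expR (t * x) = expR (t ^+ 2 * s ^+ 2 / 2).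
Proof. by rewrite /Rintegral normal_prob_mgf// gt_eqF. Qed.

Let mmgf (t : R) : measurable_fun setT (fun x : R => expR (t * x)).
Proof. by apply: measurableT_comp => //; exact: measurable_funM. Qed.

Let imgf (t : R) : N.-integrable setT (EFin \o (fun x => expR (t * x))).
Proof.
apply/integrableP; split; first by apply/measurable_EFinP; exact: mmgf.
under eq_integral do rewrite /= ger0_norm ?expR_ge0//.
by rewrite /= normal_prob_mgf ?ltry// gt_eqF.
Qed.

Let icosh (t : R) : N.-integrable setT (EFin \o (fun x => expR (t * x) + expR (- t * x))).
Proof. by have := integrableD measurableT (imgf t) (imgf (- t)). Qed.

(** The exponential of t|x| is at most the sum of those of tx and -tx, whose integrals are known. *)
Let dominated (f : R -> R) (C t : R) : measurable_fun setT f ->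
  (forall x, `|f x| <= C * expR (t * `|x|)) -> 0 <= t -> N.-integrable setT (EFin \o f).
Proof.
move=> mf fC t0.
have C0 : 0 <= C.
  by have := fC 0; rewrite normr0 mulr0 expR0 mulr1; exact: le_trans.
apply: (le_integrable _ _ _ (integrableZl measurableT C (icosh t))) => //.
  exact/measurable_EFinP.
move=> x _; rewrite /= lee_fin (le_trans (fC x))// normrM ger0_norm// ler_wpM2l//.
rewrite (le_trans _ (ler_norm _))//.
by have := expR_norm_le (t * x); rewrite mulNr normrM ger0_norm.
Qed.

Let pow_le (n : nat) (x : R) : `|x ^+ n| <= n`!%:R * expR (1 * `|x|).
Proof. by rewrite mul1r normrX exprn_fact_le_expR. Qed.

Lemma normal_prob_integrableX (n : nat) :
  N.-integrable setT (EFin \o (fun x => x ^+ n)).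
Proof. by apply: dominated (pow_le n) _ => //; exact: measurable_funX. Qed.

(** With u = x / s, the cube of |u| is at most 3! times the exponential of |u|, hence at most 6
    times the exponentials of u and -u together. Each of these two has mean [expR (2^-1)], which
    gives the factor 12. *)
Lemma normal_prob_norm3_le :
  \int[N]_x `|x| ^+ 3 <= 12 * expR (2^-1) * s ^+ 3.
Proof.
have i3 : N.-integrable setT (EFin \o (fun x => `|x| ^+ 3)).
  apply: (@dominated _ 3`!%:R 1) => // [|x].
  - by apply: measurable_funX; exact: normr_measurable.
  - by rewrite normrX normr_id -normrX; exact: pow_le.
have ic : N.-integrable setT
    (EFin \o (fun x => (6 * s ^+ 3) * (expR (s^-1 * x) + expR (- s^-1 * x)))).
  exact: (integrableZl measurableT _ (icosh s^-1)).
apply: (@le_trans _ _ (\int[N]_x ((6 * s ^+ 3) * (expR (s^-1 * x) + expR (- s^-1 * x))))).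
  apply: le_Rintegral => //= x _.
  have := exprn_fact_le_expR 3 (normr_ge0 (s^-1 * x)).
  rewrite (_ : 3`!%:R = 6)// => h.
  apply: (@le_trans _ _ (s ^+ 3 * `|s^-1 * x| ^+ 3)).
    rewrite normrM (ger0_norm (x := s^-1)) ?invr_ge0 ?(ltW s0)// exprMn mulrA -exprMn.
    by rewrite divff ?gt_eqF// expr1n mul1r.
  rewrite [leRHS](_ : _ = s ^+ 3 * (6 * (expR (s^-1 * x) + expR (- s^-1 * x)))); last by ring.
  rewrite ler_pM2l ?exprn_gt0// (le_trans h)// ler_pM2l//.
  by rewrite mulNr expR_norm_le.
rewrite (RintegralZl _ measurableT (icosh s^-1)).
rewrite (RintegralD measurableT (imgf s^-1) (imgf (- s^-1))).
rewrite !mgf sqrrN -exprMn mulVf ?gt_eqF// expr1n mul1r.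
by rewrite le_eqVlt; apply/orP; left; apply/eqP; ring.
Qed.

(** The moment generating function is expanded twice to second order in [t]: under the integral,
    where the moments appear, and in its closed form. The difference is of third order. *)
Let moment_expansion : exists C : R, forall t, `|t| <= 1 ->
  `|t * (\int[N]_x x) + t ^+ 2 * ((\int[N]_x x ^+ 2) - s ^+ 2) / 2| <= C * `|t| ^+ 3.
Proof.
(* [A] comes from |tx|^3 exp|tx|, where |x|^3 is at most 6 exp|x| and |t| at most 1; [B] comes from
   the first-order remainder of the closed form at t^2 s^2 / 2, of order t^4. *)
pose A := 6 * \int[N]_x (expR (2 * x) + expR (- 2 * x)).
pose B := (s ^+ 2 / 2) ^+ 2 * expR (s ^+ 2 / 2).
exists (A + B) => t t1.
have m1 := normal_prob_integrableX 1.
have m2 := normal_prob_integrableX 2.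
have i1 : N.-integrable setT (EFin \o (fun x => t * x)) by exact: (integrableZ_EFin t m1).
have i2 : N.-integrable setT (EFin \o (fun x => t ^+ 2 / 2 * x ^+ 2)).
  exact: (integrableZ_EFin _ m2).
have i0 : N.-integrable setT (EFin \o (fun=> 1 : R)).
  by apply: (bounded_integrable _ (M := 1)) => // x; rewrite normr1.
have ia := integrableB_EFin (imgf t) i0.
have ib := integrableB_EFin ia i1.
have ic := integrableB_EFin ib i2.
have E : \int[N]_x (expR (t * x) - 1 - t * x - t ^+ 2 / 2 * x ^+ 2) =
   expR (t ^+ 2 * s ^+ 2 / 2) - 1 - t * (\int[N]_x x) - t ^+ 2 / 2 * (\int[N]_x x ^+ 2).
  rewrite (RintegralB measurableT ib i2) (RintegralB measurableT ia i1).
  rewrite (RintegralB measurableT (imgf t) i0) mgf Rintegral_prob_cst.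
  by rewrite (RintegralZl _ measurableT m1) (RintegralZl _ measurableT m2).
have le1 : `|\int[N]_x (expR (t * x) - 1 - t * x - t ^+ 2 / 2 * x ^+ 2)| <= A * `|t| ^+ 3.
  rewrite (le_trans (le_normr_Rintegral measurableT ic))// /A.
  have i3 : N.-integrable setT
      (EFin \o (fun x => (6 * `|t| ^+ 3) * (expR (2 * x) + expR (- 2 * x)))).
    exact: (integrableZ_EFin _ (icosh 2)).
  rewrite [leRHS](_ : _ = \int[N]_x ((6 * `|t| ^+ 3) * (expR (2 * x) + expR (- 2 * x)))); last first.
    by rewrite (RintegralZl _ measurableT (icosh 2)); ring.
  apply: le_Rintegral => //; first exact: integrable_norm ic.
  move=> x _ /=.
  rewrite (_ : t ^+ 2 / 2 * x ^+ 2 = (t * x) ^+ 2 / 2); last by field.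
  apply: (le_trans (expR_taylor2 (t * x))).
  rewrite [leRHS](_ : _ = `|t| ^+ 3 * (6 * (expR (2 * x) + expR (- (2 * x))))); last first.
    by rewrite mulNr; ring.
  rewrite normrM exprMn -[leLHS]mulrA ler_wpM2l ?exprn_ge0//.
  apply: (@le_trans _ _ (6 * expR `|2 * x|)); last by rewrite ler_wpM2l// expR_norm_le.
  rewrite [X in 6 * expR X](_ : _ = `|x| + `|x|); last first.
    by rewrite normrM ger0_norm//; ring.
  rewrite expRD mulrA ler_pM ?mulr_ge0 ?exprn_ge0 ?expR_ge0//.
    exact: exprn_fact_le_expR.
  by rewrite ler_expR ler_piMl.
have le2 : `|expR (t ^+ 2 * s ^+ 2 / 2) - 1 - t ^+ 2 * s ^+ 2 / 2| <= B * `|t| ^+ 3.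
  have h := expR_taylor1 (t ^+ 2 * s ^+ 2 / 2).
  have w0 : 0 <= t ^+ 2 * s ^+ 2 / 2 by rewrite divr_ge0// mulr_ge0 ?sqr_ge0.
  have t21 : t ^+ 2 <= 1 by rewrite -real_normK ?num_real// exprn_ile1.
  rewrite (le_trans h)// ger0_norm// /B.
  rewrite [leLHS](_ : _ = (s ^+ 2 / 2) ^+ 2 *
      (expR (t ^+ 2 * s ^+ 2 / 2) * `|t| ^+ 4)); last first.
    have -> : `|t| ^+ 4 = (t ^+ 2) ^+ 2 by rewrite -[4%N]/(2 * 2)%N exprM real_normK ?num_real.
    by ring.
  rewrite -[leRHS]mulrA ler_wpM2l ?sqr_ge0// ler_pM ?expR_ge0 ?exprn_ge0//.
    by rewrite ler_expR ler_wpM2r// ler_piMl ?sqr_ge0.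
  by rewrite exprSr ler_piMr ?exprn_ge0.
rewrite [X in `|X|](_ : _ = (expR (t ^+ 2 * s ^+ 2 / 2) - 1 - t ^+ 2 * s ^+ 2 / 2) -
   \int[N]_x (expR (t * x) - 1 - t * x - t ^+ 2 / 2 * x ^+ 2)); last first.
  by rewrite E; field.
by rewrite mulrDl [leRHS]addrC (le_trans (ler_normB _ _))// lerD.
Qed.

Lemma normal_prob_moments12 :
  \int[N]_x x = 0 /\ \int[N]_x x ^+ 2 = s ^+ 2.
Proof.
have [C HC] := moment_expansion.
set m1 := \int[N]_x x in HC *; set m2 := \int[N]_x x ^+ 2 in HC *.
(* Inserting [t] and [- t] separates the odd part, which carries the mean, from the even part, which
   carries the second moment; dividing by the power of [t] leaves bounds that vanish with [t]. *)
have bound t : 0 < t -> t <= 1 -> `|m1| <= C * t /\ `|m2 - s ^+ 2| <= 2 * C * t.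
  move=> t0 t1.
  have nt : `|t| = t by rewrite ger0_norm// ltW.
  have := HC t; rewrite nt => /(_ t1) h1.
  have := HC (- t); rewrite normrN nt => /(_ t1) h2.
  have C0 : 0 <= C.
    by have := le_trans (normr_ge0 _) h1; rewrite pmulr_lge0// exprn_gt0.
  have D1 : `|m1| * t <= C * t ^+ 3.
    rewrite -[X in _ * X]nt -normrM [X in `|X|](_ : _ =
      ((t * m1 + t ^+ 2 * (m2 - s ^+ 2) / 2) -
       (- t * m1 + (- t) ^+ 2 * (m2 - s ^+ 2) / 2)) / 2); last by field.
    rewrite normrM (ger0_norm (x := 2^-1))// ler_pdivrMr// (le_trans (ler_normB _ _))//.
    by rewrite mulr_natr mulr2n lerD.
  have D2 : `|m2 - s ^+ 2| * t ^+ 2 <= 2 * C * t ^+ 3.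
    rewrite -[X in _ * X ^+ _]nt -normrX -normrM [X in `|X|](_ : _ =
      ((t * m1 + t ^+ 2 * (m2 - s ^+ 2) / 2) +
       (- t * m1 + (- t) ^+ 2 * (m2 - s ^+ 2) / 2))); last by field.
    rewrite (le_trans (ler_normD _ _))//.
    by rewrite [leRHS](_ : _ = C * t ^+ 3 + C * t ^+ 3); [exact: lerD|ring].
  split.
    rewrite -(ler_pM2r t0) (le_trans D1)// exprS mulrA expr2 mulrA.
    by rewrite ler_piMr// !mulr_ge0// ltW.
  rewrite -(@ler_pM2r _ (t ^+ 2)) ?exprn_gt0// (le_trans D2)//.
  by rewrite -[leRHS]mulrA -exprS.
split; first by apply: (@eq0_linear_bound _ C) => t t0 t1; have [] := bound t t0 t1.
apply/eqP; rewrite -subr_eq0; apply/eqP.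
by apply: (@eq0_linear_bound _ (2 * C)) => t t0 t1; have [] := bound t t0 t1.
Qed.

End normal_moments.

End gauss.

Section gauss_law.
Context {R : realType}.

Definition dirac_prob (m : R) : probability (measurableTypeR R) R :=
  @dirac _ (measurableTypeR R) m R.

Lemma Rintegral_dirac_prob (m : R) (f : R -> R) : measurable_fun setT f ->
  \int[dirac_prob m]_x f x = f m.
Proof.
move=> mf; rewrite /Rintegral /dirac_prob integral_dirac//; last exact/measurable_EFinP.
by rewrite diracT mul1e.
Qed.

Lemma normal_law0 (m : R) : normal_law m 0 = dirac_prob m.
Proof. by rewrite /normal_law eqxx. Qed.

Lemma normal_law_neq0 (m v : R) : v != 0 ->
  normal_law m v = (normal_prob m (Num.sqrt v) : probability (measurableTypeR R) R).
Proof. by rewrite /normal_law => /negbTE ->. Qed.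

Section average.
Variables (nu : probability (measurableTypeR R) R) (f : R -> R) (M : R).
Hypotheses (mf : measurable_fun setT f) (fM : forall x, `|f x| <= M).

Let mfx (x : R) : measurable_fun setT (fun y => f (x + y)).
Proof. by apply: measurableT_comp => //; exact: measurable_funD. Qed.

Lemma average_integrable (x : R) : nu.-integrable setT (EFin \o (fun y => f (x + y))).
Proof. exact: (bounded_integrable nu (mfx x) (fun y => fM (x + y))). Qed.

Lemma average_bounded (x : R) : `|\int[nu]_y f (x + y)| <= M.
Proof. exact: (bounded_Rintegral nu (mfx x) (fun y => fM (x + y))). Qed.

Let shiftE (x : R) : \int[nu]_y (f (x + y) + M) = \int[nu]_y f (x + y) + M.
Proof.
rewrite RintegralD ?Rintegral_prob_cst//; first exact: average_integrable.
exact: (bounded_integrable _ (M := `|M|)).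
Qed.

(** Adding [M] makes the integrand nonnegative, so that measurability of sections in the sense of
    Tonelli applies; the constant is subtracted afterwards. *)
Lemma measurable_average : measurable_fun setT (fun x : R => \int[nu]_y f (x + y)).
Proof.
pose h (z : R * R) := (f (z.1 + z.2) + M)%:E.
have mh : measurable_fun setT h.
  apply/measurable_EFinP; apply: measurable_funD => //.
  by apply: measurableT_comp => //; exact: measurable_funD.
have h0 z : (0 <= h z)%E.
  by rewrite lee_fin -lerBlDr sub0r; have := fM (z.1 + z.2); rewrite ler_norml => /andP[].
have mF := @measurable_fun_fubini_tonelli_F _ _ _ _ _ nu h mh h0.
rewrite (_ : (fun x => _) = (fun x => fine (fubini_F nu h x) - M)).
  by apply: measurable_funB => //; apply: measurableT_comp => //.
by apply/funext => x; rewrite -[in LHS](addrK M (\int[nu]_y _)) -shiftE.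
Qed.

End average.

Lemma convolution_bounded (nu1 nu2 nu3 : probability (measurableTypeR R) R)
    (M : R) (f : R -> R) :
  (forall g : R -> R, continuous g -> (forall x, 0 <= g x <= M + M) ->
    (\int[nu1]_y \int[nu2]_z (g (y + z))%:E = \int[nu3]_u (g u)%:E)%E) ->
  continuous f -> (forall x, `|f x| <= M) ->
  \int[nu1]_y (\int[nu2]_z f (y + z)) = \int[nu3]_u f u.
Proof.
move=> H cf fM.
have mf : measurable_fun setT f by exact: continuous_measurable_fun.
have mA := measurable_average nu2 mf fM.
have g02 x : 0 <= f x + M <= M + M.
  rewrite lerD2r; have := fM x; rewrite ler_norml => /andP[].
  by rewrite -subr_ge0 opprK => -> ->.
have cg : continuous (fun x => f x + M).
  by move=> x; apply: continuousD; [exact: cf|exact: cst_continuous].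
have iM (nu : probability (measurableTypeR R) R) : nu.-integrable setT (EFin \o (fun=> M)).
  exact: (bounded_integrable _ (M := `|M|)).
have gE (nu : probability (measurableTypeR R) R) (h : R -> R) :
    measurable_fun setT h -> (forall x, `|h x| <= M) ->
    (\int[nu]_x (h x + M)%:E)%E = (\int[nu]_x h x + M)%:E.
  move=> mh hM; have ih := bounded_integrable nu mh hM.
  rewrite -(EFin_Rintegral nu (integrableD_EFin ih (iM nu))).
  by rewrite (RintegralD measurableT ih (iM nu)) Rintegral_prob_cst.
apply: (addIr M); apply: EFin_inj.
rewrite -(gE nu3 f mf fM) -(H _ cg g02).
rewrite -(gE nu1 (fun y => \int[nu2]_z f (y + z)) mA (average_bounded nu2 mf fM)).
apply: eq_integral => y _.
rewrite -(gE nu2 (fun z => f (y + z)))//.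
by apply: measurableT_comp => //; exact: measurable_funD.
Qed.

(** Zero variances are split off on both sides and handled by Dirac masses, since the density
    computation needs positive deviations. *)
Lemma normal_law_convolution (v w M : R) (f : R -> R) : 0 <= v -> 0 <= w ->
  continuous f -> (forall x, `|f x| <= M) ->
  \int[normal_law 0 v]_y (\int[normal_law 0 w]_z f (y + z)) =
  \int[normal_law 0 (v + w)]_u f u.
Proof.
move=> v0 w0 cf fM.
have mf : measurable_fun setT f by exact: continuous_measurable_fun.
move: v0; rewrite le_eqVlt => /predU1P[<-|v0].
  rewrite add0r normal_law0 Rintegral_dirac_prob; last exact: measurable_average.
  by apply: eq_Rintegral => u _; rewrite add0r.
move: w0; rewrite le_eqVlt => /predU1P[<-|w0].
  rewrite addr0 normal_law0; apply: eq_Rintegral => y _.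
  rewrite Rintegral_dirac_prob ?addr0//.
  by apply: measurableT_comp => //; exact: measurable_funD.
have vw0 : 0 < v + w by exact: addr_gt0.
rewrite (normal_law_neq0 0 (lt0r_neq0 v0)) (normal_law_neq0 0 (lt0r_neq0 w0)).
rewrite (normal_law_neq0 0 (lt0r_neq0 vw0)).
apply: convolution_bounded cf fM => g cg gM.
have sv0 : 0 < Num.sqrt v by rewrite sqrtr_gt0.
have sw0 : 0 < Num.sqrt w by rewrite sqrtr_gt0.
have := ge0_normal_prob_convolution sv0 sw0 cg gM.
by rewrite (sqr_sqrtr (ltW v0)) (sqr_sqrtr (ltW w0)).
Qed.

Lemma normal_law_moments (v : R) : 0 <= v ->
  [/\ (normal_law 0 v).-integrable setT (EFin \o (fun x : R => x)),
      (normal_law 0 v).-integrable setT (EFin \o (fun x : R => x ^+ 2)),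
      (normal_law 0 v).-integrable setT (EFin \o (fun x : R => `|x| ^+ 3)) &
   [/\ \int[normal_law 0 v]_x x = 0, \int[normal_law 0 v]_x x ^+ 2 = v &
      \int[normal_law 0 v]_x `|x| ^+ 3 <= 12 * expR (2^-1) * (v * Num.sqrt v)]].
Proof.
have m3 : measurable_fun setT (fun x : R => `|x| ^+ 3).
  by apply: measurable_funX; exact: normr_measurable.
have m2 : measurable_fun setT (fun x : R => x ^+ 2) by exact: measurable_funX.
have m1 : measurable_fun setT (fun x : R => x) by [].
rewrite le_eqVlt => /predU1P[<-|v0].
  rewrite normal_law0.
  have I (f : R -> R) : measurable_fun setT f ->
      (dirac_prob 0).-integrable setT (EFin \o f).
    move=> mf; apply/integrableP; split; first exact/measurable_EFinP.
    rewrite /dirac_prob integral_dirac//.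
      by rewrite diracT mul1e ltry.
    by apply: measurableT_comp => //; exact/measurable_EFinP.
  split; [exact: I|exact: I|exact: I|].
  by rewrite !Rintegral_dirac_prob// normr0 !expr0n/= mul0r mulr0.
rewrite (normal_law_neq0 0 (lt0r_neq0 v0)).
have s0 : 0 < Num.sqrt v by rewrite sqrtr_gt0.
have [e1 e2] := normal_prob_moments12 s0.
split.
- exact: (normal_prob_integrableX s0 1).
- exact: (normal_prob_integrableX s0 2).
- have i3 : (normal_prob 0 (Num.sqrt v)).-integrable setT (EFin \o (fun x => `|x ^+ 3|)).
    exact: (integrable_norm (normal_prob_integrableX s0 3)).
  have h3 (x : R) : `| `|x| ^+ 3 | <= `|x ^+ 3| by rewrite !normrX normr_id.
  exact: (@le_integrable_EFin _ _ _ (normal_prob 0 (Num.sqrt v)) _ _ m3 h3 i3).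
split; first exact: e1.
  by apply: etrans e2 _; rewrite sqr_sqrtr// ltW.
apply: le_trans (normal_prob_norm3_le s0) _.
by rewrite ler_wpM2l ?mulr_ge0 ?expR_ge0// exprSr sqr_sqrtr ?(ltW v0).
Qed.

End gauss_law.

(** * Smooth test functions *)

Section primitive.
Context {R : realType}.
Local Notation mu := (@lebesgue_measure R).
Variable f : R -> R.
Hypothesis cf : continuous f.

Let fi (a b : R) : mu.-integrable `[a, b] (EFin \o f).
Proof.
apply: continuous_compact_integrable; first exact: segment_compact.
exact: continuous_subspaceT.
Qed.

Let I (a x : R) : R := \int[mu]_(t in `[a, x]) f t - \int[mu]_(t in `[a, 0]) f t.

(** Moving the base point changes both integrals in [I] by the same amount, as long as it stays to
    the left of [x] and of 0. *)
Let I_base (a b x : R) : a <= b -> b <= x -> b <= 0 -> I a x = I b x.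
Proof.
move=> ab bx b0.
have H y : b <= y -> \int[mu]_(t in `[a, y]) f t - \int[mu]_(t in `[a, b]) f t =
    \int[mu]_(t in `[b, y]) f t.
  move=> by'; rewrite (Rintegral_itvB (fi a y)) ?bnd_simp//.
  by rewrite Rintegral_itv_obnd_cbnd//; apply: integrableS (fi b y) => //; exact: subset_itv_oc_cc.
by rewrite /I -(H x bx) -(H 0 b0); ring.
Qed.

(** The oriented integral of [f] from 0 to [x]. Integrals over sets carry no orientation, so the
    base point is taken to the left of both 0 and [x]. *)
Definition primitive (x : R) : R := I (- (`|x| + 1)) x.

Lemma is_derive_primitive (x : R) : is_derive x (1 : R) primitive (f x).
Proof.
(* One fixed base point that lies to the left of the base points used by [primitive] at all [y]
   within distance 1 of [x]. *)
pose a : R := - (`|x| + 2).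
have ax : a < x by rewrite /a ltrNl (le_lt_trans (ler_norm _))// normrN ltrDl.
have xu : x < x + 1 by rewrite ltrDl.
have [dF F'] := @continuous_FTC1_closed R f a x (x + 1) xu (fi _ _) ax (@cf x).
have dI : is_derive x (1 : R) (I a) (f x).
  rewrite -[f x]subr0; apply: is_deriveB.
  by rewrite -F' derive1E; exact: (derivableP dF).
apply: near_eq_is_derive dI; near=> y.
have yx : `|y| <= `|x| + 1.
  rewrite -[y](subrK x) addrC (le_trans (ler_normD _ _))// lerD2l distrC.
  by apply/ltW; near: y; apply: (@cvgr_dist_lt _ _ _ (nbhs x) _ id x) => //.
apply: I_base.
- by rewrite lerN2 -[2](natrD _ 1 1) addrA lerD2r.
- by rewrite lerNl (le_trans _ (ler_wpDr _ (lexx _)))// -normrN ler_norm.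
- by rewrite oppr_le0 addr_ge0.
Unshelve. all: by end_near. Qed.

End primitive.

Section smooth_test.
Context {R : realType}.
Local Notation prob := (probability (measurableTypeR R) R).

(* A modulus-free substitute for [C^2] with bounded Lipschitz second
   derivative: [g1] and [g2] play the roles of [g'] and [g'']. *)
Definition smooth_test (K : R) (g g1 g2 : R -> R) : Prop :=
  [/\ [/\ measurable_fun setT g, measurable_fun setT g1 & measurable_fun setT g2],
      forall x, [/\ `|g x| <= K, `|g1 x| <= K & `|g2 x| <= K] &
      forall x y, `|g (x + y) - g x - g1 x * y - g2 x * (y ^+ 2 / 2)| <=
                  K * Num.min (y ^+ 2) (`|y| ^+ 3)].

(** Plays the role of adding to [x] an independent summand of law [nu], without a random variable
    that has this law. *)
Definition average (nu : prob) (g : R -> R) (x : R) : R := \int[nu]_y g (x + y).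

(** The remainder bound is uniform in the base point, hence survives averaging over translations
    with the same [K]. *)
Lemma smooth_test_average (nu : prob) (K : R) (g g1 g2 : R -> R) :
  smooth_test K g g1 g2 ->
  smooth_test K (average nu g) (average nu g1) (average nu g2).
Proof.
move=> [[mg mg1 mg2] gK gT].
have gK0 x : `|g x| <= K by have [] := gK x.
have gK1 x : `|g1 x| <= K by have [] := gK x.
have gK2 x : `|g2 x| <= K by have [] := gK x.
split.
- by split; exact: measurable_average.
- by move=> x; split; exact: average_bounded.
move=> x y; rewrite /average.
have i0 := average_integrable nu mg gK0.
have i1 := average_integrable nu mg1 gK1.
have i2 := average_integrable nu mg2 gK2.
have iT := integrableB_EFin (integrableB_EFin (integrableB_EFin (i0 (x + y)) (i0 x))
  (integrableZ_EFin y (i1 x))) (integrableZ_EFin (y ^+ 2 / 2) (i2 x)).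
rewrite [X in `|X|](_ : _ = \int[nu]_z (g (x + y + z) - g (x + z) - y * g1 (x + z) -
    y ^+ 2 / 2 * g2 (x + z))); last first.
  rewrite (RintegralB measurableT (integrableB_EFin (integrableB_EFin (i0 (x + y)) (i0 x))
    (integrableZ_EFin y (i1 x))) (integrableZ_EFin (y ^+ 2 / 2) (i2 x))).
  rewrite (RintegralB measurableT (integrableB_EFin (i0 (x + y)) (i0 x))
    (integrableZ_EFin y (i1 x))).
  rewrite (RintegralB measurableT (i0 (x + y)) (i0 x)).
  rewrite (RintegralZl _ measurableT (i1 x)) (RintegralZl _ measurableT (i2 x)).
  by rewrite (mulrC y) (mulrC (y ^+ 2 / 2)).
apply: bounded_Rintegral; first by apply/measurable_EFinP; exact: (measurable_int nu iT).
move=> z; rewrite [X in `|X|](_ : _ =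
  g (x + z + y) - g (x + z) - g1 (x + z) * y - g2 (x + z) * (y ^+ 2 / 2)); first exact: gT.
by rewrite (addrAC x); ring.
Qed.

Section approximation.
Variables (f : R -> R) (M L : R).
Hypotheses (fM : forall x, `|f x| <= M) (fL : forall x y, `|f x - f y| <= L * `|x - y|).

Lemma lipschitz_continuous_real : continuous f.
Proof.
move=> x; apply/cvgrPdist_lt => e e0.
have L0 : 0 <= L by have := le_trans (normr_ge0 _) (fL 1 0); rewrite subr0 normr1 mulr1.
near=> y; rewrite (le_lt_trans (fL x y))//.
apply: (@le_lt_trans _ _ ((L + 1) * `|x - y|)); first by rewrite ler_wpM2r// lerDl.
rewrite -ltr_pdivlMl ?ltr_wpDl//.
near: y; apply: (@cvgr_dist_lt _ _ _ (nbhs x) _ id x) => //.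
by rewrite mulr_gt0// invr_gt0 ltr_wpDl.
Unshelve. all: by end_near. Qed.

Let cf := lipschitz_continuous_real.

Let M0 : 0 <= M. Proof. exact: le_trans (normr_ge0 _) (fM 0). Qed.
Let L0 : 0 <= L.
Proof. by have := le_trans (normr_ge0 _) (fL 1 0); rewrite subr0 normr1 mulr1. Qed.

Let F1 := primitive f.
Let dF1 (x : R) : is_derive x (1 : R) F1 (f x). Proof. exact: is_derive_primitive. Qed.
Let cF1 : continuous F1.
Proof.
move=> x; apply: differentiable_continuous; apply/derivable1_diffP.
by have [] := dF1 x.
Qed.
Let F2 := primitive F1.
Let dF2 (x : R) : is_derive x (1 : R) F2 (F1 x). Proof. exact: is_derive_primitive. Qed.
Let cF2 : continuous F2.
Proof.
move=> x; apply: differentiable_continuous; apply/derivable1_diffP.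
by have [] := dF2 x.
Qed.

Let between (x y u : R) : Num.min x (x + y) <= u <= Num.max x (x + y) -> `|u - x| <= `|y|.
Proof.
have [y0|y0] := leP 0 y.
  rewrite min_l ?max_r ?lerDl// => /andP[xu uxy].
  by rewrite ger0_norm ?subr_ge0// (ger0_norm y0) lerBlDl.
rewrite min_r ?max_l ?gerDl ?(ltW y0)// => /andP[xu ux].
by rewrite ler0_norm ?subr_le0// (ltr0_norm y0) lerN2 lerBrDl.
Qed.

Let F1_lip (x y : R) : `|F1 (x + y) - F1 x| <= M * `|y|.
Proof. by rewrite -{2}(addKr x y) [- x + _]addrC; apply: (MVT_norm_le dF1). Qed.

(** The first bound uses the Lipschitz constant of [f], the second only its sup norm. One more
    integration turns them into the cubic and the quadratic side of the minimum in [smooth_test];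
    [C] adds their constants so that it serves both. *)
Let F1_taylor (x y : R) :
  `|F1 (x + y) - F1 x - f x * y| <= L * `|y| ^+ 2 /\
  `|F1 (x + y) - F1 x - f x * y| <= 2 * M * `|y|.
Proof.
pose r u := F1 u - f x * u.
have dr (u : R) : is_derive u (1 : R) r (f u - f x).
  have dF1u := dF1 u; apply: is_derive_eq.
  by rewrite /GRing.scale/=; ring.
have rE : F1 (x + y) - F1 x - f x * y = r (x + y) - r x by rewrite /r; ring.
have yE : `|y| = `|x + y - x| by rewrite addrAC subrr add0r.
rewrite rE; split.
  rewrite expr2 mulrA [X in _ * X]yE; apply: (MVT_norm_le dr) => u /between ux.
  by rewrite (le_trans (fL _ _))// ler_wpM2l.
rewrite [X in _ * X]yE; apply: (MVT_norm_le dr) => u _.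
by rewrite (le_trans (ler_normB _ _))// mulr_natl mulr2n lerD.
Qed.

Let C := L + 2 * M.
Let C0 : 0 <= C. Proof. by rewrite addr_ge0// mulr_ge0. Qed.

Let F2_taylor (x y : R) :
  `|F2 (x + y) - F2 x - F1 x * y - f x * (y ^+ 2 / 2)| <=
  C * Num.min (y ^+ 2) (`|y| ^+ 3).
Proof.
pose r u := F2 u - F1 x * u - f x * ((u - x) ^+ 2 / 2).
have dr (u : R) : is_derive u (1 : R) r (F1 (x + (u - x)) - F1 x - f x * (u - x)).
  rewrite [x + _]addrC subrK /r.
  have dF2u := dF2 u; apply: is_derive_eq.
  by rewrite /GRing.scale/=; field.
have rE : F2 (x + y) - F2 x - F1 x * y - f x * (y ^+ 2 / 2) = r (x + y) - r x.
  by rewrite /r; field.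
have yE : `|y| = `|x + y - x| by rewrite addrAC subrr add0r.
rewrite rE; have H3 : `|r (x + y) - r x| <= L * `|y| ^+ 3.
  rewrite exprSr mulrA [X in _ * X]yE; apply: (MVT_norm_le dr) => u /between ux.
  have [h _] := F1_taylor x (u - x); rewrite (le_trans h)// ler_wpM2l//.
  by rewrite ler_pXn2r.
have H2 : `|r (x + y) - r x| <= 2 * M * y ^+ 2.
  rewrite -real_normK ?num_real// expr2 mulrA [X in _ * X]yE.
  apply: (MVT_norm_le dr) => u /between ux.
  have [_ h] := F1_taylor x (u - x); rewrite (le_trans h)// ler_wpM2l//.
  by rewrite mulr_ge0.
rewrite /C mulrDl; have [_|_] := leP (y ^+ 2) (`|y| ^+ 3).
  by rewrite (le_trans H2)// lerDr mulr_ge0 ?sqr_ge0.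
by rewrite (le_trans H3)// lerDl !mulr_ge0// exprn_ge0.
Qed.

(* The second difference quotient of the second primitive [F2] of [f] approximates [f]
   uniformly, and its Taylor remainders are controlled by those of [F2]. *)
Let D (h : R) (g : R -> R) (x : R) := (g (x + 2 * h) - 2 * g (x + h) + g x) / h ^+ 2.

Let D_continuous (h : R) (g : R -> R) : continuous g -> continuous (D h g).
Proof.
move=> cg x.
have cs (c : R) : {for x, continuous (fun y => g (y + c))}.
  apply: (@continuous_comp _ _ _ (fun y => y + c) g); last exact: cg.
  by apply: cvgD; [exact: cvg_id|exact: cvg_cst].
apply: cvgM; last exact: cvg_cst.
apply: cvgD; last exact: cg.
by apply: cvgB; [exact: cs|apply: cvgM; [exact: cvg_cst|exact: cs]].
Qed.

Lemma smooth_test_dense (e : R) : 0 < e -> exists K g g1 g2,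
  [/\ smooth_test K g g1 g2, continuous g & forall x, `|f x - g x| <= e].
Proof.
(* In the difference quotient the two remainders add up to 2 C h^3 + C (2h)^3 = 10 C h^3; after
   division by h^2 this is 10 C h, at most [e]. *)
move=> e0; pose h := e / (10 * C + 1).
have h0 : 0 < h by rewrite divr_gt0// ltr_wpDl// mulr_ge0.
have hh0 : 0 < h ^+ 2 by rewrite exprn_gt0.
(* The sum of the bounds for the approximating function, its two derivatives and its Taylor
   remainder, so that one constant dominates each. *)
pose K := M + e + 2 * M / h + 4 * M / h ^+ 2 + 4 * C / h ^+ 2.
have near x : `|f x - D h F2 x| <= e.
  pose e1 := F2 (x + 2 * h) - F2 x - F1 x * (2 * h) - f x * ((2 * h) ^+ 2 / 2).
  pose e2 := F2 (x + h) - F2 x - F1 x * h - f x * (h ^+ 2 / 2).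
  have -> : f x - D h F2 x = (2 * e2 - e1) / h ^+ 2.
    by rewrite /D /e1 /e2; field; rewrite gt_eqF.
  have E1 : `|e1| <= C * (2 * h) ^+ 3.
    have := F2_taylor x (2 * h); rewrite -/e1 => /le_trans; apply.
    by rewrite ler_wpM2l// ge_min (ger0_norm (x := 2 * h)) ?lexx ?orbT// mulr_ge0// ltW.
  have E2 : `|e2| <= C * h ^+ 3.
    have := F2_taylor x h; rewrite -/e2 => /le_trans; apply.
    by rewrite ler_wpM2l// ge_min (ger0_norm (x := h)) ?lexx ?orbT// ltW.
  rewrite normrM (ger0_norm (x := _^-1)) ?invr_ge0 ?(ltW hh0)// ler_pdivrMr//.
  apply: (@le_trans _ _ (10 * C * h ^+ 3)).
    rewrite (le_trans (ler_normB _ _))// normrM (ger0_norm (x := 2))//.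
    have -> : 10 * C * h ^+ 3 = 2 * (C * h ^+ 3) + C * (2 * h) ^+ 3 by ring.
    by rewrite lerD// ler_wpM2l.
  rewrite exprSr mulrCA mulrC ler_pM2r//.
  have -> : e = h * (10 * C + 1) by rewrite /h divfK// gt_eqF// ltr_wpDl// mulr_ge0.
  by rewrite mulrC ler_pM2l// lerDl.
have Db (c : R) (g : R -> R) : 0 <= c -> (forall x, `|g x| <= c) -> forall x, `|D h g x| <= 4 * c / h ^+ 2.
  move=> c0 gc x; rewrite /D normrM (ger0_norm (x := _^-1)) ?invr_ge0 ?(ltW hh0)//.
  rewrite ler_pM2r ?invr_gt0// (le_trans (ler_normD _ _))//.
  have -> : 4 * c = c + 2 * c + c by ring.
  rewrite lerD// (le_trans (ler_normB _ _))// lerD// normrM (ger0_norm (x := 2))//.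
  by rewrite ler_wpM2l.
have K1 : 0 <= 2 * M / h by rewrite !mulr_ge0// invr_ge0 ltW.
have K2 : 0 <= 4 * M / h ^+ 2 by rewrite !mulr_ge0// invr_ge0 ltW.
have K3 : 0 <= 4 * C / h ^+ 2 by rewrite !mulr_ge0// invr_ge0 ltW.
have [M_K F1_K f_K t_K] : [/\ M + e <= K, 2 * M / h <= K, 4 * M / h ^+ 2 <= K & 4 * C / h ^+ 2 <= K].
  move: K1 K2 K3 M0 (ltW e0); rewrite /K.
  by move: (2 * M / h) (4 * M / h ^+ 2) (4 * C / h ^+ 2) => a b c; split; lra.
exists K, (D h F2), (D h F1), (D h f); split; last 2 first.
- exact: D_continuous.
- exact: near.
split.
- by split; apply: continuous_measurable_fun; exact: D_continuous.
- move=> x; split.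
  + rewrite -[D h F2 x](subrK (f x)) addrC (le_trans (ler_normD _ _))//.
    by rewrite (le_trans _ M_K)// lerD// distrC.
  + apply: (le_trans _ F1_K).
    have -> : D h F1 x = ((F1 (x + h + h) - F1 (x + h)) - (F1 (x + h) - F1 x)) / h ^+ 2.
      by rewrite /D; congr (_ / _); rewrite (_ : x + 2 * h = x + h + h); ring.
    rewrite normrM (ger0_norm (x := _^-1)) ?invr_ge0 ?(ltW hh0)//.
    rewrite ler_pdivrMr// (_ : 2 * M / h * h ^+ 2 = M * h + M * h); last first.
      by field; rewrite gt_eqF.
    have F1h y : `|F1 (y + h) - F1 y| <= M * h.
      by have := F1_lip y h; rewrite (ger0_norm (ltW h0)).
    by rewrite (le_trans (ler_normB _ _))// lerD.
  + by rewrite (le_trans (Db M f M0 fM x)).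
move=> x y; pose m := Num.min (y ^+ 2) (`|y| ^+ 3).
have m0 : 0 <= m by rewrite le_min sqr_ge0 exprn_ge0.
(* [D h] is linear and commutes with translations, so the remainder of the quotient is the quotient
   of the remainder. *)
pose t z := F2 (z + y) - F2 z - F1 z * y - f z * (y ^+ 2 / 2).
have -> : D h F2 (x + y) - D h F2 x - D h F1 x * y - D h f x * (y ^+ 2 / 2) = D h t x.
  by rewrite /D /t (addrAC x y) (addrAC x y); field; rewrite gt_eqF.
rewrite (le_trans (Db (C * m) t _ _ x))//.
- by rewrite mulr_ge0.
- by move=> z; exact: F2_taylor.
by rewrite mulrA mulrAC ler_wpM2r.
Qed.

End approximation.

End smooth_test.

(** * Independence of the past *)

Section independent_pair.
Context d (T : measurableType d) (R : realType) (P : probability T R).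
Context d1 d2 (E1 : measurableType d1) (E2 : measurableType d2).
Variables (X : T -> E1) (Y : T -> E2).
Hypotheses (mX : measurable_fun setT X) (mY : measurable_fun setT Y).
Hypothesis XY : forall A B, measurable A -> measurable B ->
  P (X @^-1` A `&` Y @^-1` B) = (P (X @^-1` A) * P (Y @^-1` B))%E.

Let XY_ w := (X w, Y w).
Let mXY : measurable_fun setT XY_. Proof. exact: measurable_fun_pair. Qed.

#[local] HB.instance Definition _ := isMeasurableFun.Build _ _ _ _ X mX.
#[local] HB.instance Definition _ := isMeasurableFun.Build _ _ _ _ Y mY.
#[local] HB.instance Definition _ := isMeasurableFun.Build _ _ _ _ XY_ mXY.

Let mu1 : probability E1 R := distribution P X.
Let mu2 : probability E2 R := distribution P Y.
Let mu12 : probability (E1 * E2)%type R := distribution P XY_.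

Let joint_law A : measurable A -> (mu1 \x mu2)%E A = mu12 A.
Proof.
by apply: product_measure_unique => A1 B1 mA1 mB1; exact: XY.
Qed.

(** By independence the pair has the product law, where Fubini applies. Integrability of every
    section makes the real-valued inner integral agree with the extended one everywhere, not only
    almost everywhere. *)
Lemma independent_fubini (h : E1 * E2 -> R) : measurable_fun setT h ->
  P.-integrable setT (EFin \o (fun w => h (X w, Y w))) ->
  (forall x, P.-integrable setT (EFin \o (fun w => h (x, Y w)))) ->
  \int[P]_w h (X w, Y w) = \int[P]_w \int[P]_w' h (X w, Y w').
Proof.
move=> mh hi hi'.
have mhE : measurable_fun setT (EFin \o h) by exact/measurable_EFinP.
have i12 : mu12.-integrable setT (EFin \o h).
  exact: (integrable_pushforward mXY mhE hi).
have I : (mu1 \x mu2)%E.-integrable setT (EFin \o h).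
  apply/integrableP; split => //.
  rewrite (eq_measure_integral mu12) => [|A mA _]; last exact: joint_law.
  by case/integrableP: i12.
have h1 x : (\int[mu2]_y (h (x, y))%:E = \int[P]_w' (h (x, Y w'))%:E)%E.
  apply: (integral_pushforward mY _ (hi' x)) => //.
  by apply/measurable_EFinP; exact: measurableT_comp.
have F1 : fubini_F mu2 (EFin \o h) = EFin \o (fun x => \int[P]_w' h (x, Y w')).
  by apply/funext => x; rewrite /fubini_F h1 /= EFin_Rintegral.
have mF : measurable_fun setT (fun x => \int[P]_w' h (x, Y w')).
  by apply/measurable_EFinP; rewrite -F1; exact: (measurable_fubini_F I).
have iF : mu1.-integrable setT (EFin \o (fun x => \int[P]_w' h (x, Y w'))).
  by rewrite -F1; exact: (integrable_fubini_F I).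
rewrite /Rintegral; congr fine.
transitivity (\int[mu12]_z (h z)%:E)%E.
  by rewrite integral_pushforward.
rewrite -(eq_measure_integral mu12 (fun A mA _ => joint_law mA)).
rewrite -(integral12_prod_meas1 I) F1.
apply: integral_pushforward => //; first exact/measurable_EFinP.
rewrite preimage_setT; apply/integrableP; split.
  by apply/measurable_EFinP; exact: (measurableT_comp mF mX).
case/integrableP: iF => _; apply: le_lt_trans.
rewrite ge0_integral_pushforward//.
by do 2 apply: measurableT_comp => //; exact/measurable_EFinP.
Qed.

End independent_pair.

Section past.
Context d (T : measurableType d) (R : realType) (P : probability T R).
Context d' (E : measurableType d').
Variable X : nat -> T -> E.
Hypotheses (mX : forall n, measurable_fun setT (X n))
  (indepX : mutually_independent P X).

Lemma independent_bigcap (n : nat) (B : nat -> set E) :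
  (forall i, measurable (B i)) ->
  P (\bigcap_(i in `I_n) (X i @^-1` B i)) = (\prod_(0 <= i < n) P (X i @^-1` B i))%E.
Proof.
move=> mB; have := indepX [fset i | i in iota 0 n]%fset mB.
have -> : [set` [fset i | i in iota 0 n]%fset] = `I_n.
  by apply/seteqP; split => i /=; rewrite in_fset/= mem_iota.
move=> ->; apply: perm_big; apply: uniq_perm => //.
- by rewrite iota_uniq.
- by move=> i; rewrite in_fset /index_iota subn0.
Qed.

Definition past (n : nat) : set (set T) :=
  [set A | exists2 B : nat -> set E, (forall i, measurable (B i)) &
    A = \bigcap_(i in `I_n) (X i @^-1` B i)].

(* A function of [X 0, ..., X (n - 1)] is a function on [T] that is measurable when its
   domain is retyped as [past_type n]. *)
Definition past_type (n : nat) := g_sigma_algebraType (past n).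

Lemma past_measurable (n : nat) : past n `<=` measurable.
Proof.
move=> _ [B mB ->]; apply: bigcap_measurableType => i _.
by rewrite -[X in measurable X]setTI; exact: mX.
Qed.

Lemma sub_past (m n : nat) : (m <= n)%N -> past m `<=` past n.
Proof.
move=> mn _ [B mB ->]; exists (fun i => if (i < m)%N then B i else setT).
  by move=> i; case: ifP.
apply/seteqP; split => x /= Bx i /= im; first by case: ifPn => // im'; exact: Bx.
by have := Bx i (leq_trans im mn); rewrite im.
Qed.

(** As functions of [A] both sides are finite measures: [P] restricted to the event on [X n], and
    [P] scaled by its probability. They agree on the generating pi-system [past n], because placing
    [C] at index [n] extends a rectangle of the past to one over [n.+1] coordinates. *)
Lemma past_independent (n : nat) (A : set T) (C : set E) :
  <<s past n >> A -> measurable C ->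
  P (A `&` X n @^-1` C) = (P A * P (X n @^-1` C))%E.
Proof.
move=> pA mC; pose D := X n @^-1` C.
have mD : measurable D by rewrite -[X in measurable X]setTI; exact: mX.
have D0 : 0 <= fine (P D) by rewrite fine_ge0.
have DE : P D = (fine (P D))%:E by rewrite fineK// fin_num_measure.
rewrite -/D DE muleC.
pose m2 : {measure set T -> \bar R} := mscale (NngNum D0) P.
rewrite -[RHS]/(m2 A).
apply: (@g_sigma_algebra_measure_unique _ _ _ (past n) _ (fun=> setT) _ _ (mrestr P mD) m2) => //.
- exact: past_measurable.
- by move=> _; exists (fun=> setT) => //; rewrite bigcapT.
- by apply/seteqP; split => // x _; exists 0%N.
- move=> _ _ [B1 mB1 ->] [B2 mB2 ->]; exists (fun i => B1 i `&` B2 i).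
    by move=> i; exact: measurableI.
  by rewrite -bigcapI.
- move=> _ [B mB ->]; have -> : m2 (\bigcap_(i in `I_n) (X i @^-1` B i)) =
      (P (\bigcap_(i in `I_n) (X i @^-1` B i)) * P D)%E by rewrite DE muleC.
  rewrite -[LHS]/(P (\bigcap_(i in `I_n) (X i @^-1` B i) `&` D)).
  pose B' i := if (i < n)%N then B i else C.
  have mB' i : measurable (B' i) by rewrite /B'; case: ifP.
  have -> : \bigcap_(i in `I_n) (X i @^-1` B i) `&` D =
      \bigcap_(i in `I_n.+1) (X i @^-1` B' i).
    apply/seteqP; split => [x [/= Bx Dx] i /=|x /= Bx].
      rewrite ltnS leq_eqVlt /B' => /predU1P[->|ilt]; first by rewrite ltnn.
      by rewrite ilt; exact: Bx.
    split; last by have := Bx n (ltnSn n); rewrite /= /B' ltnn.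
    by move=> i /= ilt; have := Bx i (ltnW ilt); rewrite /= /B' ilt.
  rewrite !independent_bigcap// big_nat_recr//=; congr (_ * _)%E.
    by apply: eq_big_nat => i /andP[_ ilt]; rewrite /B' ilt.
  by rewrite /B' ltnn.
- move=> _; apply: (@le_lt_trans _ _ 1%E); last exact: ltry.
  by apply: probability_le1; exact: measurableI.
Qed.

Lemma measurable_past_coord (m n : nat) : (m < n)%N ->
  measurable_fun setT (X m : past_type n -> E).
Proof.
move=> mn _ C mC; rewrite setTI; apply: sub_sigma_algebra.
exists (fun i => if i == m then C else setT); first by move=> i; case: ifP.
apply/seteqP; split => x /= Cx; first by move=> i _ /=; case: eqP => // ->.
by have := Cx m mn; rewrite /= eqxx.
Qed.

Lemma measurable_past_sub (m n : nat) d2 (F : measurableType d2) (Y : T -> F) :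
  (m <= n)%N -> measurable_fun setT (Y : past_type m -> F) ->
  measurable_fun setT (Y : past_type n -> F).
Proof.
move=> mn mY _ B mB; have := mY measurableT B mB.
by apply: sub_sigma_algebra2; exact: sub_past.
Qed.

Lemma measurable_past_measurable (n : nat) d2 (F : measurableType d2) (Y : T -> F) :
  measurable_fun setT (Y : past_type n -> F) -> measurable_fun setT Y.
Proof.
move=> mY _ B mB; have := mY measurableT B mB.
apply: smallest_sub; last exact: past_measurable.
exact: sigma_algebra_measurable.
Qed.

End past.

(** * The central limit theorem for smooth test functions *)

Lemma measurable_expectation_shift d (T : measurableType d) (R : realType)
    (P : probability T R) (f : R -> R) (M : R) (V : T -> R) :
  measurable_fun setT f -> (forall x, `|f x| <= M) -> measurable_fun setT V ->
  measurable_fun setT (fun x : R => \int[P]_w f (x + V w)).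
Proof.
move=> mf fM mV.
pose h (z : R * T) := (f (z.1 + V z.2) + M)%:E.
have mh : measurable_fun setT h.
  apply/measurable_EFinP; apply: measurable_funD => //.
  apply: measurableT_comp => //; apply: measurable_funD => //.
  exact: measurableT_comp.
have h0 z : (0 <= h z)%E.
  by rewrite lee_fin -lerBlDr sub0r; have := fM (z.1 + V z.2); rewrite ler_norml => /andP[].
have mF := @measurable_fun_fubini_tonelli_F _ _ _ _ _ P h mh h0.
rewrite (_ : (fun x => _) = (fun x => fine (fubini_F P h x) - M)).
  by apply: measurable_funB => //; apply: measurableT_comp => //.
apply/funext => x; rewrite -[LHS](addrK M); congr (_ - M).
have iM : P.-integrable setT (EFin \o (fun=> M)).
  by apply: (bounded_integrable _ (M := `|M|)).
have iV : P.-integrable setT (EFin \o (fun w => f (x + V w))).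
  apply: (bounded_integrable _ (M := M)) => // w.
  by apply: measurableT_comp => //; exact: measurable_funD.
by rewrite -[X in _ + X](Rintegral_prob_cst P) -(RintegralD measurableT iV iM).
Qed.

Section taylor_expectation.
Context d (T : measurableType d) (R : realType) (Q : probability T R).
Variables (V : T -> R) (K : R) (g g1 g2 : R -> R).
Hypotheses (mV : measurable_fun setT V) (gK : smooth_test K g g1 g2).
Hypotheses (V1 : Q.-integrable setT (EFin \o V))
  (V2 : Q.-integrable setT (EFin \o (fun w => V w ^+ 2))).

(** The error functional of Lindeberg's method. For [V] replaced by [c * V] it is of smaller order
    than c^2 as c tends to 0 under a second moment alone, where a cubic remainder would ask for a
    third moment. *)
Definition truncated_moment : R := \int[Q]_w Num.min (V w ^+ 2) (`|V w| ^+ 3).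

Lemma integrable_truncated_moment :
  Q.-integrable setT (EFin \o (fun w => Num.min (V w ^+ 2) (`|V w| ^+ 3))).
Proof.
apply: le_integrable_EFin V2.
  apply: measurable_minr; first exact: measurable_funX.
  by apply: measurable_funX; exact: measurableT_comp.
move=> w; rewrite ger0_norm; first by rewrite ge_min lexx.
by rewrite le_min sqr_ge0 exprn_ge0.
Qed.

(** Centering kills the first-order term, so the expansion sees [V] only through its variance:
    centered variables of equal variance are interchangeable up to their truncated moments. *)
Lemma expectation_taylor (x : R) : \int[Q]_w V w = 0 ->
  `|\int[Q]_w g (x + V w) - (g x + g2 x * ((\int[Q]_w V w ^+ 2) / 2))| <=
  K * truncated_moment.
Proof.
move=> EV0; have [[mg mg1 mg2] gb gT] := gK.
have ig : Q.-integrable setT (EFin \o (fun w => g (x + V w))).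
  apply: (bounded_integrable _ (M := K)) => [|w]; last by have [] := gb (x + V w).
  by apply: measurableT_comp => //; exact: measurable_funD.
have ic (c : R) : Q.-integrable setT (EFin \o (fun=> c)).
  by apply: (bounded_integrable _ (M := `|c|)).
have i1 := integrableB_EFin ig (ic (g x)).
have i2 := integrableB_EFin i1 (integrableZ_EFin (g1 x) V1).
have i3 := integrableB_EFin i2 (integrableZ_EFin (g2 x / 2) V2).
rewrite [X in `|X|](_ : _ = \int[Q]_w
    (g (x + V w) - g x - g1 x * V w - g2 x / 2 * V w ^+ 2)); last first.
  rewrite (RintegralB measurableT i2 (integrableZ_EFin (g2 x / 2) V2)).
  rewrite (RintegralB measurableT i1 (integrableZ_EFin (g1 x) V1)).
  rewrite (RintegralB measurableT ig (ic (g x))) Rintegral_prob_cst.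
  by rewrite (RintegralZl _ measurableT V1) (RintegralZl _ measurableT V2) EV0; field.
rewrite (le_trans (le_normr_Rintegral measurableT i3))//.
rewrite /truncated_moment -(RintegralZl _ measurableT integrable_truncated_moment).
apply: le_Rintegral => //.
- exact: (integrable_norm i3).
- exact: (integrableZ_EFin K integrable_truncated_moment).
move=> w _ /=; rewrite (_ : g2 x / 2 * V w ^+ 2 = g2 x * (V w ^+ 2 / 2)); first exact: gT.
by field.
Qed.

End taylor_expectation.

Section equal_law.
Context d (T : measurableType d) (R : realType) (P : probability T R).
Context d' (E : measurableType d').
Variables X Y : T -> E.
Hypotheses (mX : measurable_fun setT X) (mY : measurable_fun setT Y).
Hypothesis XY : forall B, measurable B -> P (X @^-1` B) = P (Y @^-1` B).

#[local] HB.instance Definition _ := isMeasurableFun.Build _ _ _ _ X mX.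
#[local] HB.instance Definition _ := isMeasurableFun.Build _ _ _ _ Y mY.

Let law1 : probability E R := distribution P X.
Let law2 : probability E R := distribution P Y.

Let eq_law A : measurable A -> A `<=` setT -> law1 A = law2 A.
Proof. by move=> mA _; exact: XY. Qed.

Lemma equal_law_integrable (h : E -> R) : measurable_fun setT h ->
  P.-integrable setT (EFin \o (h \o Y)) -> P.-integrable setT (EFin \o (h \o X)).
Proof.
move=> mh /integrableP[_ i0]; apply/integrableP.
have mh' : measurable_fun setT (fun x => `|(h x)%:E|%E).
  by apply: measurableT_comp => //; exact/measurable_EFinP.
split; first by do 2 apply: measurableT_comp => //.
move: i0; have <- : (\int[law1]_x `|(h x)%:E| = \int[P]_w `|(EFin \o (h \o X)) w|)%E.
  by rewrite ge0_integral_pushforward.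
have <- : (\int[law2]_x `|(h x)%:E| = \int[P]_w `|(EFin \o (h \o Y)) w|)%E.
  by rewrite ge0_integral_pushforward.
by rewrite (eq_measure_integral law2 eq_law).
Qed.

Lemma equal_law_Rintegral (h : E -> R) : measurable_fun setT h ->
  P.-integrable setT (EFin \o (h \o Y)) ->
  \int[P]_w h (X w) = \int[P]_w h (Y w).
Proof.
move=> mh i0; have i1 := equal_law_integrable mh i0.
rewrite /Rintegral.
have <- : (\int[law1]_x (h x)%:E = \int[P]_w (h (X w))%:E)%E.
  by rewrite integral_pushforward//; exact/measurable_EFinP.
have <- : (\int[law2]_x (h x)%:E = \int[P]_w (h (Y w))%:E)%E.
  by rewrite integral_pushforward//; exact/measurable_EFinP.
by rewrite (eq_measure_integral law2 eq_law).
Qed.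

End equal_law.

(** * Sums of functions of an i.i.d. sequence: orthogonality and replacement *)

Section iid_sums.
Context d (T : measurableType d) (R : realType) (P : probability T R).
Context d' (E : measurableType d').
Variable X : nat -> T -> E.
Hypothesis iidX : iid P X.

Let mX n : measurable_fun setT (X n). Proof. by have [] := iidX. Qed.
Let indepX : mutually_independent P X. Proof. by have [] := iidX. Qed.

Let idX n B : measurable B -> P (X n @^-1` B) = P (X 0 @^-1` B).
Proof. by have [_ _ id] := iidX; exact: id. Qed.

Lemma iid_integrable (h : E -> R) (n : nat) : measurable_fun setT h ->
  P.-integrable setT (EFin \o (h \o X 0)) -> P.-integrable setT (EFin \o (h \o X n)).
Proof. exact: equal_law_integrable (mX n) (mX 0) (@idX n) _. Qed.

Lemma iid_Rintegral (h : E -> R) (n : nat) : measurable_fun setT h ->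
  P.-integrable setT (EFin \o (h \o X 0)) ->
  \int[P]_w h (X n w) = \int[P]_w h (X 0 w).
Proof. exact: equal_law_Rintegral (mX n) (mX 0) (@idX n) _. Qed.

Section real_sums.
Variable phi : E -> R.
Hypothesis mphi : measurable_fun setT phi.
Let W (n : nat) (w : T) : R := phi (X n w).

Lemma past_fubini (n : nat) (Y : T -> R) (h : R * R -> R) :
  measurable_fun setT (Y : past_type X n -> R) -> measurable_fun setT h ->
  P.-integrable setT (EFin \o (fun w => h (Y w, W n w))) ->
  (forall x, P.-integrable setT (EFin \o (fun w => h (x, W n w)))) ->
  \int[P]_w h (Y w, W n w) = \int[P]_w \int[P]_w' h (Y w, W n w').
Proof.
move=> mY mh; apply: independent_fubini => //.
- exact: measurable_past_measurable mY.
- exact: (measurableT_comp mphi).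
move=> A B mA mB; rewrite [W n @^-1` B]comp_preimage.
apply: past_independent => //.
  by have := mY measurableT A mA; rewrite setTI.
by rewrite -[X in measurable X]setTI; exact: mphi.
Qed.

Hypothesis W2 : P.-integrable setT (EFin \o (fun w => W 0 w ^+ 2)).
Hypothesis EW0 : \int[P]_w W 0 w = 0.
Let sigma2 := \int[P]_w W 0 w ^+ 2.

Let mW n : measurable_fun setT (W n). Proof. exact: (measurableT_comp mphi). Qed.

Let W2n n : P.-integrable setT (EFin \o (fun w => W n w ^+ 2)).
Proof. by apply: (@iid_integrable (fun x => phi x ^+ 2)) W2 => //; exact: measurable_funX. Qed.

Let W1n n : P.-integrable setT (EFin \o W n).
Proof.
have i1 : P.-integrable setT (EFin \o (fun=> 1 : R)).
  by apply: (bounded_integrable _ (M := 1)) => // x; rewrite normr1.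
apply: le_integrable_EFin (integrableD_EFin i1 (W2n n)) => // w.
rewrite -real_normK ?num_real//; have := sqr_ge0 (`|W n w| - 1 / 2); lra.
Qed.

Let EWn n : \int[P]_w W n w = 0.
Proof. by rewrite (@iid_Rintegral phi n)// ; exact: (W1n 0). Qed.

Let EW2n n : \int[P]_w W n w ^+ 2 = sigma2.
Proof. by rewrite (@iid_Rintegral (fun x => phi x ^+ 2) n)//; exact: measurable_funX. Qed.

(** With [Y] frozen by independence, what remains is [Y] times the zero mean of [W n]. Integrability
    of the product comes from |YW| <= Y^2 + W^2. *)
Lemma past_orthogonal (n : nat) (Y : T -> R) :
  measurable_fun setT (Y : past_type X n -> R) ->
  P.-integrable setT (EFin \o (fun w => Y w ^+ 2)) ->
  P.-integrable setT (EFin \o (fun w => Y w * W n w)) /\ \int[P]_w (Y w * W n w) = 0.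
Proof.
move=> mY iY; have mY' := measurable_past_measurable mX mY.
have iYW : P.-integrable setT (EFin \o (fun w => Y w * W n w)).
  apply: le_integrable_EFin (integrableD_EFin iY (W2n n)).
    exact: measurable_funM.
  move=> w; rewrite normrM -(real_normK (num_real (Y w))) -(real_normK (num_real (W n w))).
  have := sqr_ge0 (`|Y w| - `|W n w|); have := mulr_ge0 (normr_ge0 (Y w)) (normr_ge0 (W n w)); nra.
split => //.
rewrite (@past_fubini n Y (fun z => z.1 * z.2))//.
- rewrite (@eq_Rintegral _ _ _ P setT (fun=> 0)); first by rewrite Rintegral_prob_cst.
  by move=> w _; rewrite (RintegralZl _ measurableT (W1n n)) EWn mulr0.
- exact: measurable_funM.
- by move=> x; exact: (integrableZ_EFin x (W1n n)).
Qed.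

(** The martingale transform of the partial sums by the weights [H]. *)
Definition weighted_sum (H : nat -> T -> R) (m n : nat) (w : T) : R :=
  \sum_(m <= k < n) H k w * W k w.

(** Appending the summand [k] to the sum [D] produces the cross term 2 D H_k W_k, whose mean
    vanishes since D H_k belongs to the past; the new square costs at most [sigma2] because the
    weights are at most 1. *)
Lemma weighted_sum_second_moment (H : nat -> T -> R) (m n : nat) : (m <= n)%N ->
  (forall k, measurable_fun setT (H k : past_type X k -> R)) ->
  (forall k w, `|H k w| <= 1) ->
  [/\ measurable_fun setT (weighted_sum H m n : past_type X n -> R),
      P.-integrable setT (EFin \o (fun w => weighted_sum H m n w ^+ 2)) &
      \int[P]_w (weighted_sum H m n w ^+ 2) <= (n - m)%:R * sigma2].
Proof.
move=> mn mH H1; rewrite -(subnK mn) addnC; elim: (n - m)%N => [|j [IH1 IH2 IH3]].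
  rewrite addn0 subnn mul0r.
  have -> : weighted_sum H m m = fun=> 0.
    by apply/funext => w; rewrite /weighted_sum big_geq.
  have E0 : (fun _ : T => 0 ^+ 2) = (fun=> 0 : R) by apply/funext => w; rewrite expr0n.
  rewrite E0 Rintegral_prob_cst lexx; split => //.
  by apply: (bounded_integrable _ (M := 0)) => // w; rewrite normr0.
set D := weighted_sum H m (m + j) in IH1 IH2 IH3 *.
set k := (m + j)%N in D IH1 IH2 IH3 *.
have DS w : weighted_sum H m (m + j.+1) w = D w + H k w * W k w.
  by rewrite /weighted_sum addnS big_nat_recr//= leq_addr.
have mD := measurable_past_measurable mX IH1.
have mHk := measurable_past_measurable mX (mH k).
have H21 w : (D w * H k w) ^+ 2 <= D w ^+ 2.
  rewrite exprMn ler_piMr ?sqr_ge0// -real_normK ?num_real//.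
  by rewrite exprn_ile1.
have iDH : P.-integrable setT (EFin \o (fun w => (D w * H k w) ^+ 2)).
  apply: le_integrable_EFin IH2; first by apply: measurable_funX; exact: measurable_funM.
  by move=> w; rewrite ger0_norm ?sqr_ge0.
have mDH : measurable_fun setT ((fun w => D w * H k w) : past_type X k -> R).
  by apply: measurable_funM => //; exact: mH.
have [iDHW EDHW] := past_orthogonal mDH iDH.
have HW2 w : (H k w * W k w) ^+ 2 <= W k w ^+ 2.
  rewrite exprMn ler_piMl ?sqr_ge0// -real_normK ?num_real//.
  by rewrite exprn_ile1.
have iHW : P.-integrable setT (EFin \o (fun w => (H k w * W k w) ^+ 2)).
  apply: le_integrable_EFin (W2n k); first by apply: measurable_funX; exact: measurable_funM.
  by move=> w; rewrite ger0_norm ?sqr_ge0.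
have i2 := integrableD_EFin IH2 (integrableZ_EFin 2 iDHW).
have i3 := integrableD_EFin i2 iHW.
have sqE : (fun w => weighted_sum H m (m + j.+1) w ^+ 2) =
    (fun w => D w ^+ 2 + 2 * (D w * H k w * W k w) + (H k w * W k w) ^+ 2).
  by apply/funext => w; rewrite DS; ring.
have -> : weighted_sum H m (m + j.+1) = (fun w => D w + H k w * W k w).
  by apply/funext => w; exact: DS.
split.
- apply: measurable_funD.
    by apply: measurable_past_sub IH1; rewrite addnS.
  apply: measurable_funM.
    by apply: (measurable_past_sub _ (mH k)); rewrite addnS.
  apply: (measurableT_comp mphi).
  by apply: measurable_past_coord; rewrite addnS.
- by rewrite (_ : (fun w => _ ^+ 2) = (fun w => D w ^+ 2 + 2 * (D w * H k w * W k w) + (H k w * W k w) ^+ 2))//;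
    apply/funext => w; ring.
rewrite (@eq_Rintegral _ _ _ P setT (fun w => D w ^+ 2 + 2 * (D w * H k w * W k w) + (H k w * W k w) ^+ 2)); last first.
  by move=> w _; ring.
rewrite (RintegralD measurableT i2 iHW) (RintegralD measurableT IH2 (integrableZ_EFin 2 iDHW)).
rewrite (RintegralZl _ measurableT iDHW) EDHW mulr0 addr0.
rewrite addKn -[j.+1%:R]natr1 mulrDl mul1r.
rewrite lerD//; first by move: IH3; rewrite /k addKn.
by rewrite -(EW2n k); apply: le_Rintegral.
Qed.

Definition partial_sum (n : nat) (w : T) : R := \sum_(i < n) W i w.

Lemma measurable_partial_sum (n : nat) :
  measurable_fun setT (partial_sum n : past_type X n -> R).
Proof.
apply: measurable_sum => i; apply: (measurableT_comp mphi).
exact: measurable_past_coord.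
Qed.

Section lindeberg.
Variables (c K : R) (g g1 g2 : R -> R).
Hypothesis gK : smooth_test K g g1 g2.
Variables (nu : probability (measurableTypeR R) R)
  (nus : nat -> probability (measurableTypeR R) R).
Hypotheses (nus0 : forall x, average (nus 0) g x = g x)
  (nusS : forall k x, average (nus k.+1) g x = \int[nu]_y average (nus k) g (x + y)).
Hypotheses (nu1 : nu.-integrable setT (EFin \o (fun x : R => x)))
  (nu2 : nu.-integrable setT (EFin \o (fun x : R => x ^+ 2)))
  (Enu1 : \int[nu]_x x = 0) (Enu2 : \int[nu]_x x ^+ 2 = c ^+ 2 * sigma2).

Let B := truncated_moment P (fun w => c * W 0 w) + truncated_moment nu id.

Let u (k : nat) := average (nus k) g.
Let uK (k : nat) : smooth_test K (u k) (average (nus k) g1) (average (nus k) g2).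
Proof. exact: smooth_test_average. Qed.
Let mu k : measurable_fun setT (u k). Proof. by have [[]] := uK k. Qed.

(** A summand [c * W n] and a variable of law [nu] have the same mean and variance, so their
    second-order expansions coincide and only the two truncated moments remain. *)
Let step (k : nat) (x : R) (n : nat) :
  `|\int[P]_w u k (x + c * W n w) - u k.+1 x| <= K * B.
Proof.
have mcW m : measurable_fun setT (fun w => c * W m w) by exact: measurable_funM.
have cW2 m : P.-integrable setT (EFin \o (fun w => (c * W m w) ^+ 2)).
  have -> : (fun w => (c * W m w) ^+ 2) = (fun w => c ^+ 2 * W m w ^+ 2).
    by apply/funext => w; rewrite exprMn.
  exact: (integrableZ_EFin (c ^+ 2) (W2n m)).
have EcW : \int[P]_w (c * W n w) = 0 by rewrite (RintegralZl _ measurableT (W1n n)) EWn mulr0.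
have EcW2 : \int[P]_w (c * W n w) ^+ 2 = c ^+ 2 * sigma2.
  rewrite -(EW2n n) -(RintegralZl _ measurableT (W2n n)).
  by apply: eq_Rintegral => w _; rewrite exprMn.
have h1 := expectation_taylor (mcW n) (uK k) (integrableZ_EFin c (W1n n)) (cW2 n) x EcW.
have h2 := @expectation_taylor _ _ R nu id K _ _ _ (@measurable_id _ _ _) (uK k) nu1 nu2 x Enu1.
have tE : truncated_moment P (fun w => c * W n w) = truncated_moment P (fun w => c * W 0 w).
  apply: (@iid_Rintegral (fun x => Num.min ((c * phi x) ^+ 2) (`|c * phi x| ^+ 3)) n).
    apply: measurable_minr; apply: measurable_funX; last apply: measurableT_comp => //;
      exact: measurable_funM.
  exact: integrable_truncated_moment (mcW 0%N) (cW2 0%N).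
move: h1 h2; rewrite EcW2 Enu2 tE -nusS /B mulrDr => h1 h2.
set b := u k x + _ in h1 h2.
by rewrite -[X in `|X|](subrKA b) (le_trans (ler_normD _ _))// lerD// distrC.
Qed.

Lemma lindeberg (n : nat) :
  `|\int[P]_w g (c * partial_sum n w) - \int[nus n]_y g y| <= n%:R * (K * B).
Proof.
(* In [a k] the last [n - k] summands have been replaced by normal ones. *)
pose a k := \int[P]_w u (n - k)%N (c * partial_sum k w).
have -> : \int[P]_w g (c * partial_sum n w) = a n.
  by rewrite /a subnn; apply: eq_Rintegral => w _; rewrite /u nus0.
have -> : \int[nus n]_y g y = a 0%N.
  rewrite /a subn0 (@eq_Rintegral _ _ _ P setT (fun=> u n 0)); last first.
    by move=> w _; rewrite /partial_sum big_ord0 mulr0.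
  by rewrite Rintegral_prob_cst /u /average; apply: eq_Rintegral => y _; rewrite add0r.
have astep k : (k < n)%N -> `|a k.+1 - a k| <= K * B.
  move=> kn; pose j := (n - k.+1)%N.
  have -> : a k = \int[P]_w u j.+1 (c * partial_sum k w) by rewrite /a /j -subSn// subSS.
  have uM i x : `|u i x| <= K by have [_ h _] := uK i; have [] := h x.
  have mS := measurable_past_measurable mX (@measurable_partial_sum k).
  have mcS : measurable_fun setT (fun w => c * partial_sum k w) by exact: measurable_funM.
  have mcW : measurable_fun setT (fun w => c * W k w) by exact: measurable_funM.
  have mh : measurable_fun setT (fun z : R * R => u j (c * z.1 + c * z.2)).
    by apply: measurableT_comp => //; apply: measurable_funD; exact: measurable_funM.
  (* The expectation over the summand [k] alone, with the earlier ones frozen at [x]; the exchange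
     is then estimated pointwise in [x]. *)
  pose A x := \int[P]_w' u j (x + c * W k w').
  have mA : measurable_fun setT A by exact: measurable_expectation_shift (mu j) (uM j) mcW.
  have bA x : `|A x| <= K.
    apply: bounded_Rintegral; last by move=> w; exact: uM.
    by apply: measurableT_comp => //; exact: measurable_funD.
  have -> : a k.+1 = \int[P]_w A (c * partial_sum k w).
    rewrite /A -(past_fubini (@measurable_partial_sum k) mh).
    - by apply: eq_Rintegral => w _; rewrite /partial_sum big_ord_recr/= mulrDr.
    - apply: (bounded_integrable _ (M := K)) => [|w]; last exact: uM.
      exact: (measurableT_comp mh (measurable_fun_pair mS (mW k))).
    - move=> x; apply: (bounded_integrable _ (M := K)) => [|w]; last exact: uM.
      exact: (measurableT_comp mh (measurable_fun_pair (measurable_cst x) (mW k))).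
  have iA : P.-integrable setT (EFin \o (fun w => A (c * partial_sum k w))).
    by apply: (bounded_integrable _ (M := K)) => //; exact: measurableT_comp.
  have iu : P.-integrable setT (EFin \o (fun w => u j.+1 (c * partial_sum k w))).
    by apply: (bounded_integrable _ (M := K)) => //; exact: measurableT_comp.
  rewrite -(RintegralB measurableT iA iu).
  apply: bounded_Rintegral; first by apply: measurable_funB; exact: measurableT_comp.
  by move=> w; exact: step.
have tele k : (k <= n)%N -> `|a k - a 0%N| <= k%:R * (K * B).
  elim: k => [|k IH] kn; first by rewrite subrr normr0 mul0r.
  rewrite -[X in `|X|](subrKA (a k)) (le_trans (ler_normD _ _))//.
  have -> : k.+1%:R * (K * B) = K * B + k%:R * (K * B) by rewrite -natr1; ring.
  by apply: lerD; [exact: astep|exact: IH (ltnW kn)].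
exact: tele.
Qed.

End lindeberg.

End real_sums.

End iid_sums.

Section dominated.
Context d (T : measurableType d) (R : realType) (P : probability T R).

(** Dominated convergence with limit zero, kept only as the existence of one good index: this is how
    truncation levels are chosen throughout. *)
Lemma dominated_small (f : nat -> T -> R) (g : T -> R) (e : R) :
  (forall n, measurable_fun setT (f n)) -> (forall n w, 0 <= f n w <= g w) ->
  P.-integrable setT (EFin \o g) -> {ae P, forall w, f ^~ w @ \oo --> (0 : R)} -> 0 < e ->
  exists n, \int[P]_w f n w <= e.
Proof.
move=> mf fg ig f0 e0.
have [||||_ _ H] := @dominated_convergence _ _ _ P setT measurableT
  (fun n w => (f n w)%:E) (cst 0%E) (EFin \o g) _ _ _ ig.
- by move=> n; exact/measurable_EFinP.
- exact: measurable_cst.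
- apply: filterS f0 => w fw _; apply: cvg_EFin; [exact: nearW|exact: fw].
- apply: aeW => w n _ /=; have /andP[h1 h2] := fg n w.
  by rewrite lee_fin ger0_norm.
move: H; rewrite integral0 => /fine_cvg/cvgrPdist_le/(_ e e0)[n _ /(_ n (leqnn n))].
rewrite /= sub0r normrN => h; exists n; exact: le_trans (ler_norm _) h.
Qed.

End dominated.

Section normal_perturbation.
Context {R : realType}.

(** The law of variance [w] is that of variance [v] convolved with a centered normal law of variance
    [w - v]; by the Taylor expansion the latter moves [g] by at most K (w - v) / 2 plus a truncated
    moment below w - v. *)
Lemma normal_law_perturbation (v w K : R) (g g1 g2 : R -> R) :
  smooth_test K g g1 g2 -> continuous g -> 0 <= v -> v <= w ->
  `|\int[normal_law 0 w]_y g y - \int[normal_law 0 v]_y g y| <= 2 * K * (w - v).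
Proof.
move=> gK cg v0 vw; have s0 : 0 <= w - v by rewrite subr_ge0.
have [[mg mg1 mg2] gb gT] := gK.
have gbK x : `|g x| <= K by have [] := gb x.
have K0 : 0 <= K by exact: le_trans (normr_ge0 _) (gbK 0).
have C := normal_law_convolution v0 s0 cg gbK.
have [N1 N2 N3 [EN1 EN2 EN3]] := normal_law_moments s0.
have H x : `|\int[normal_law 0 (w - v)]_z g (x + z) - g x| <= 2 * K * (w - v).
  move: (normal_law 0 (w - v)) N1 N2 EN1 EN2 {N3 EN3 C} => nu N1 N2 EN1 EN2.
  have h := @expectation_taylor _ _ R nu id K _ _ _ (@measurable_id _ _ _) gK N1 N2 x EN1.
  rewrite EN2 in h.
  have t : truncated_moment nu id <= w - v.
    rewrite -EN2; apply: le_Rintegral => //.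
    - exact: (@integrable_truncated_moment _ _ R nu id (@measurable_id _ _ _) N2).
    - by move=> y _; rewrite ge_min lexx.
  rewrite -[X in `|X|](subrKA (g x + g2 x * ((w - v) / 2))) (le_trans (ler_normD _ _))//.
  have -> : 2 * K * (w - v) = K * (w - v) + K * (w - v) by ring.
  rewrite lerD ?(le_trans h) ?ler_wpM2l// addrAC subrr add0r normrM.
  have [_ _ g2K] := gb x; rewrite ler_pM// ger0_norm ?divr_ge0//.
  by rewrite ler_pdivrMr// ler_peMr// ler1n.
move: C; rewrite [v + _]addrC subrK => C.
move: (normal_law 0 (w - v)) (normal_law 0 v) (normal_law 0 w) H C {N1 N2 N3 EN1 EN2 EN3}.
move=> nu1 nu2 nu3 H C; rewrite -C.
have mA := measurable_average nu1 mg gbK.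
have iA : nu2.-integrable setT (EFin \o average nu1 g).
  by apply: (bounded_integrable _ (M := K)) => // x; exact: average_bounded.
have ig : nu2.-integrable setT (EFin \o g) by exact: (bounded_integrable _ (M := K)).
rewrite -(RintegralB measurableT iA ig).
by apply: bounded_Rintegral => //; exact: measurable_funB.
Qed.

End normal_perturbation.

Section central_limit.
Context d (T : measurableType d) (R : realType) (P : probability T R).
Context d' (E : measurableType d').
Variable X : nat -> T -> E.
Hypothesis iidX : iid P X.
Variable phi : E -> R.
Hypothesis mphi : measurable_fun setT phi.
Let W (w : T) : R := phi (X 0 w).
Hypothesis W2 : P.-integrable setT (EFin \o (fun w => W w ^+ 2)).
Hypothesis EW0 : \int[P]_w W w = 0.
Let sigma2 := \int[P]_w W w ^+ 2.

Let mW : measurable_fun setT W.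
Proof. by have [mX _ _] := iidX; exact: (measurableT_comp mphi). Qed.

Let sigma20 : 0 <= sigma2.
Proof. by apply: Rintegral_ge0 => w _; exact: sqr_ge0. Qed.

Let mf k : measurable_fun setT (fun w => Num.min (W w ^+ 2) (`|W w| ^+ 3 / k.+1%:R)).
Proof.
apply: measurable_minr; first exact: measurable_funX.
apply: measurable_funM => //.
by apply: measurable_funX; exact: measurableT_comp.
Qed.

Let min_ge0 (c : R) w : 0 <= c -> 0 <= Num.min (W w ^+ 2) (`|W w| ^+ 3 * c).
Proof. by move=> c0; rewrite le_min sqr_ge0 mulr_ge0// exprn_ge0. Qed.

Let truncation_small (e : R) : 0 < e ->
  exists k, \int[P]_w Num.min (W w ^+ 2) (`|W w| ^+ 3 / k.+1%:R) <= e.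
Proof.
apply: (dominated_small mf _ W2).
  by move=> n w; rewrite min_ge0 ?invr_ge0//= ge_min lexx.
apply: aeW => w.
have H : `|W w| ^+ 3 * harmonic n @[n --> \oo] --> (0 : R).
  rewrite -[X in _ --> X](mulr0 (`|W w| ^+ 3)).
  by apply: cvgM; [exact: cvg_cst|exact: cvg_harmonic].
apply: (squeeze_cvgr _ (cvg_cst (0 : R)) H); apply: nearW => n.
by rewrite min_ge0 ?invr_ge0//= ge_min lexx orbT.
Qed.

(** [n] is not tied to t: the normal law carries the matching variance, and [n%:R <= C * t] bounds
    the number of exchanges. Each costs at most 2 K q / t, hence all together 2 K C q, which the
    choice of [q] keeps below [e]. *)
Lemma clt_smooth (K C e : R) (g g1 g2 : R -> R) : smooth_test K g g1 g2 -> continuous g ->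
  0 <= C -> 0 < e -> exists2 t0, 0 < t0 & forall t (n : nat), t0 <= t -> n%:R <= C * t ->
  `|\int[P]_w g ((Num.sqrt t)^-1 * partial_sum X phi n w) -
    \int[normal_law 0 (n%:R * sigma2 / t)]_y g y| <= e.
Proof.
move=> gK cg C0 e0.
have [[mg mg1 mg2] gb gT] := gK.
have gbK x : `|g x| <= K by have [] := gb x.
have K0 : 0 <= K by exact: le_trans (normr_ge0 _) (gbK 0).
pose q := e / (2 * (K * C + 1)).
have KC0 : 0 < K * C + 1 by rewrite ltr_wpDl// mulr_ge0.
have q0 : 0 < q by rewrite divr_gt0// mulr_gt0.
have [k hk] := truncation_small q0.
pose A := 12 * expR (2^-1) * (sigma2 * Num.sqrt sigma2).
have A0 : 0 <= A by rewrite !mulr_ge0// ?expR_ge0// sqrtr_ge0.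
(* Once sqrt t exceeds [k.+1%:R], the truncated moment of [c * W] is at most c^2 q; once it exceeds
   [A / q], so is that of the normal summand, bounded by its third moment c^3 A. *)
pose s0 := k.+1%:R + A / q.
have s00 : 0 < s0 by rewrite ltr_wpDr// divr_ge0// ltW.
exists (s0 ^+ 2); first by rewrite exprn_gt0.
move=> t n t0t nCt; pose c := (Num.sqrt t)^-1.
have t0 : 0 < t by apply: lt_le_trans t0t; rewrite exprn_gt0.
have st : s0 <= Num.sqrt t by rewrite -(ger0_norm (ltW s00)) -sqrtr_sqr ler_wsqrtr.
have c0 : 0 < c by rewrite invr_gt0 sqrtr_gt0.
have c2 : c ^+ 2 = t^-1 by rewrite /c exprVn sqr_sqrtr// ltW.
have v0 : 0 <= c ^+ 2 * sigma2 by rewrite mulr_ge0// sqr_ge0.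
have kv m : 0 <= m%:R * (c ^+ 2 * sigma2) by rewrite mulr_ge0.
have [N1 N2 N3 [EN1 EN2 EN3]] := normal_law_moments v0.
have nus0 x : average (normal_law 0 (0%:R * (c ^+ 2 * sigma2))) g x = g x.
  rewrite mul0r normal_law0 /average Rintegral_dirac_prob; first by rewrite addr0.
  by apply: measurableT_comp => //; exact: measurable_funD.
have nusS m x : average (normal_law 0 (m.+1%:R * (c ^+ 2 * sigma2))) g x =
    \int[normal_law 0 (c ^+ 2 * sigma2)]_y
      average (normal_law 0 (m%:R * (c ^+ 2 * sigma2))) g (x + y).
  have cgx : continuous (fun y => g (x + y)).
    move=> y; apply: (@continuous_comp _ _ _ (fun y => x + y) g); last exact: cg.
    by apply: cvgD; [exact: cvg_cst|exact: cvg_id].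
  have := normal_law_convolution v0 (kv m) cgx (fun y => gbK (x + y)).
  have -> : c ^+ 2 * sigma2 + m%:R * (c ^+ 2 * sigma2) = m.+1%:R * (c ^+ 2 * sigma2).
    by rewrite -natr1; ring.
  move: (normal_law 0 (c ^+ 2 * sigma2)) (normal_law 0 (m%:R * (c ^+ 2 * sigma2)))
    (normal_law 0 (m.+1%:R * (c ^+ 2 * sigma2))) => nu1 nu2 nu3 H.
  rewrite /average -H.
  by apply: eq_Rintegral => y _; apply: eq_Rintegral => z _; rewrite addrA.
have L := lindeberg iidX mphi W2 EW0 gK nus0 nusS N1 N2 EN1 EN2 n.
have -> : n%:R * sigma2 / t = n%:R * (c ^+ 2 * sigma2) by rewrite c2; ring.
apply: (le_trans L) => {L nus0 nusS}.
have tN : truncated_moment (normal_law 0 (c ^+ 2 * sigma2)) id <= c ^+ 2 * q.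
  move: (normal_law 0 (c ^+ 2 * sigma2)) N1 N2 N3 EN1 EN2 EN3 => nu N1 N2 N3 EN1 EN2 EN3.
  apply: (@le_trans _ _ (12 * expR (2^-1) * (c ^+ 2 * sigma2 * Num.sqrt (c ^+ 2 * sigma2)))).
    apply: le_trans EN3; apply: le_Rintegral => //.
    - exact: (@integrable_truncated_moment _ _ R nu id (@measurable_id _ _ _) N2).
    - by move=> y _; rewrite ge_min lexx orbT.
  rewrite sqrtrM ?sqr_ge0// sqrtr_sqr (ger0_norm (ltW c0)).
  have -> : 12 * expR 2^-1 * (c ^+ 2 * sigma2 * (c * Num.sqrt sigma2)) = c ^+ 2 * (c * A).
    by rewrite /A; ring.
  rewrite ler_pM2l ?exprn_gt0// /c mulrC ler_pdivrMr ?sqrtr_gt0//.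
  rewrite mulrC -ler_pdivrMr//; apply: le_trans st.
  by rewrite /s0 lerDr.
have tP : truncated_moment P (fun w => c * W w) <= c ^+ 2 * q.
  have iM : P.-integrable setT (EFin \o (fun w => Num.min (W w ^+ 2) (`|W w| ^+ 3 / k.+1%:R))).
    apply: le_integrable_EFin W2 => // w.
    by rewrite ger0_norm ?min_ge0 ?invr_ge0// ge_min lexx.
  apply: (@le_trans _ _ (c ^+ 2 * \int[P]_w Num.min (W w ^+ 2) (`|W w| ^+ 3 / k.+1%:R))); last first.
    by rewrite ler_pM2l ?exprn_gt0.
  rewrite -(RintegralZl _ measurableT iM); apply: le_Rintegral => //.
  - apply: integrable_truncated_moment; first exact: measurable_funM.
    have -> : (fun w => (c * W w) ^+ 2) = (fun w => c ^+ 2 * W w ^+ 2).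
      by apply/funext => w; rewrite exprMn.
    exact: (integrableZ_EFin (c ^+ 2) W2).
  - exact: (integrableZ_EFin (c ^+ 2) iM).
  move=> w _; rewrite minr_pMr ?sqr_ge0// normrM (ger0_norm (ltW c0)) !exprMn.
  rewrite le_min !ge_min lexx/=; apply/orP; right.
  rewrite exprSr -mulrA ler_pM2l ?exprn_gt0// mulrC ler_wpM2l ?exprn_ge0//.
  rewrite /c lef_pV2 ?posrE ?sqrtr_gt0//; apply: le_trans st.
  by rewrite /s0 lerDl divr_ge0// ltW.
apply: (@le_trans _ _ (n%:R * (K * (c ^+ 2 * q + c ^+ 2 * q)))).
  by rewrite !ler_wpM2l// lerD.
have -> : n%:R * (K * (c ^+ 2 * q + c ^+ 2 * q)) = (n%:R / t) * (2 * K * q).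
  by rewrite c2; ring.
apply: (@le_trans _ _ (C * (2 * K * q))).
  have Kq0 : 0 <= 2 * K * q by rewrite mulr_ge0 ?(ltW q0)// mulr_ge0.
  by rewrite ler_wpM2r// ler_pdivrMr.
have -> : C * (2 * K * q) = e * (K * C / (K * C + 1)).
  by rewrite /q; field; rewrite gt_eqF.
by rewrite ler_piMr ?(ltW e0)// ler_pdivrMr// mul1r lerDl.
Qed.

End central_limit.

(** * Renewal estimates *)

Section measurable_sets.
Context d (T : measurableType d) (R : realType).

Lemma measurable_set_lt (f g : T -> R) : measurable_fun setT f ->
  measurable_fun setT g -> measurable [set w | f w < g w].
Proof.
move=> mf mg; have mgf : measurable_fun setT (fun w => g w - f w) by exact: measurable_funB.
rewrite (_ : [set w | f w < g w] = (fun w => g w - f w) @^-1` `]0, +oo[).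
  by rewrite -[X in measurable X]setTI; exact: mgf.
by apply/seteqP; split => w /=; rewrite in_itv/= andbT subr_gt0.
Qed.

Lemma measurable_set_le (f g : T -> R) : measurable_fun setT f ->
  measurable_fun setT g -> measurable [set w | f w <= g w].
Proof.
move=> mf mg; rewrite (_ : [set w | f w <= g w] = ~` [set w | g w < f w]).
  by apply: measurableC; exact: measurable_set_lt.
by apply/seteqP; split => w /=; rewrite leNgt => /negP.
Qed.

Lemma measurable_ltr_indicator (f g : T -> R) : measurable_fun setT f ->
  measurable_fun setT g -> measurable_fun setT (fun w => (f w < g w)%R%:R : R).
Proof.
move=> mf mg; rewrite (_ : (fun w => _) = \1_[set w | f w < g w]).
  exact/measurable_indic/measurable_set_lt.
by apply/funext => w; rewrite indicE; congr (nat_of_bool _)%:R; apply/idP/idP; rewrite inE.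
Qed.

Lemma measurable_ler_indicator (f g : T -> R) : measurable_fun setT f ->
  measurable_fun setT g -> measurable_fun setT (fun w => (f w <= g w)%R%:R : R).
Proof.
move=> mf mg; rewrite (_ : (fun w => _) = \1_[set w | f w <= g w]).
  exact/measurable_indic/measurable_set_le.
by apply/funext => w; rewrite indicE; congr (nat_of_bool _)%:R; apply/idP/idP; rewrite inE.
Qed.

End measurable_sets.

Section past_product.
Context d (T : measurableType d) (R : realType) (P : probability T R).
Context d' (E : measurableType d').
Variable X : nat -> T -> E.
Hypothesis iidX : iid P X.

Lemma past_product (n : nat) (Y : T -> R) (h : E -> R) (M1 M2 : R) :
  measurable_fun setT (Y : past_type X n -> R) -> measurable_fun setT h ->
  (forall w, `|Y w| <= M1) -> (forall x, `|h x| <= M2) ->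
  \int[P]_w (Y w * h (X n w)) = (\int[P]_w Y w) * \int[P]_w h (X 0 w).
Proof.
move=> mY mh YM hM; have [mX _ _] := iidX.
have mY' := measurable_past_measurable mX mY.
have mhX k : measurable_fun setT (h \o X k) by exact: measurableT_comp.
have ih k : P.-integrable setT (EFin \o (h \o X k)).
  exact: (bounded_integrable P (mhX k) (fun w => hM (X k w))).
have iY : P.-integrable setT (EFin \o Y) by exact: (bounded_integrable _ (M := M1)).
rewrite (@past_fubini _ _ _ _ _ _ X iidX h mh n Y (fun z => z.1 * z.2))//.
- rewrite -(RintegralZr _ measurableT iY); apply: eq_Rintegral => w _ /=.
  by rewrite (RintegralZl _ measurableT (ih n)) (iid_Rintegral iidX n mh (ih 0%N)).
- exact: measurable_funM.
- have mYh : measurable_fun setT (fun w => Y w * h (X n w)).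
    by apply: measurable_funM; last exact: mhX.
  by apply: (bounded_integrable P mYh (M := M1 * M2)) => w; rewrite normrM ler_pM.
- by move=> x; exact: (integrableZ_EFin x (ih n)).
Qed.

End past_product.

Lemma half_of_sum (R : realFieldType) (c x v y q r : R) :
  c < x -> x <= v + y -> y <= q + r -> q < c / 4 -> r <= c / 4 -> c / 2 <= v.
Proof. by move=> ? ? ? ? ?; lra. Qed.

Section finite_sums.
Context d (T : measurableType d) (R : realType) (P : probability T R).

Lemma Rintegral_sum_nat (f : nat -> T -> R) (n : nat) :
  (forall k, P.-integrable setT (EFin \o f k)) ->
  P.-integrable setT (EFin \o (fun w => \sum_(0 <= k < n) f k w)) /\
  \int[P]_w (\sum_(0 <= k < n) f k w) = \sum_(0 <= k < n) \int[P]_w f k w.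
Proof.
move=> fi; elim: n => [|n [IH1 IH2]].
  have -> : (fun w => \sum_(0 <= k < 0) f k w) = fun=> 0.
    by apply/funext => w; rewrite big_geq.
  rewrite Rintegral_prob_cst big_geq//; split => //.
  by apply: (bounded_integrable _ (M := 0)) => // w; rewrite normr0.
have -> : (fun w => \sum_(0 <= k < n.+1) f k w) =
    (fun w => \sum_(0 <= k < n) f k w + f n w).
  by apply/funext => w; rewrite big_nat_recr.
split; first exact: integrableD_EFin IH1 (fi n).
by rewrite (RintegralD measurableT IH1 (fi n)) IH2 big_nat_recr.
Qed.

End finite_sums.

(** * The weak law of large numbers under a first moment *)

Section weak_law.
Context d (T : measurableType d) (R : realType) (P : probability T R).
Context d' (E : measurableType d').
Variable X : nat -> T -> E.
Hypothesis iidX : iid P X.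
Variable tau : E -> R.
Hypothesis mtau : measurable_fun setT tau.
Hypothesis tau0 : forall n w, 0 < tau (X n w).
Hypothesis itau : P.-integrable setT (EFin \o (tau \o X 0)).
Let mu := \int[P]_w tau (X 0 w).

Let mX n : measurable_fun setT (X n). Proof. by have [] := iidX. Qed.

(* On the range of [X] this is [min (tau x) K]; the outer [max] makes it bounded everywhere. *)
Let clip (K : nat) (x : E) : R := Num.min (Num.max (tau x) 0) K%:R.

Let mclip K : measurable_fun setT (clip K).
Proof. by apply: measurable_minr => //; exact: measurable_maxr. Qed.

Let clip_bound K x : 0 <= clip K x <= K%:R.
Proof. by rewrite /clip le_min le_max lexx orbT/= ler0n ge_min lexx orbT. Qed.

Let clipE K n w : clip K (X n w) = Num.min (tau (X n w)) K%:R.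
Proof. by rewrite /clip max_l// ltW. Qed.

Let iclip K n : P.-integrable setT (EFin \o (clip K \o X n)).
Proof.
apply: (bounded_integrable _ (M := K%:R)); first exact: measurableT_comp.
by move=> w /=; have /andP[h1 h2] := clip_bound K (X n w); rewrite ger0_norm.
Qed.

Let iexcess K n : P.-integrable setT (EFin \o (fun w => tau (X n w) - clip K (X n w))).
Proof.
apply: integrableB_EFin; last exact: iclip.
exact: (iid_integrable iidX n mtau itau).
Qed.

Let excess_small (e : R) : 0 < e ->
  exists K, \int[P]_w (tau (X 0 w) - clip K (X 0 w)) <= e.
Proof.
move=> e0; apply: (@dominated_small _ _ _ P (fun K w => tau (X 0 w) - clip K (X 0 w)) (tau \o X 0)) => //.
- by move=> K; apply: measurable_funB; exact: measurableT_comp.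
- move=> K w; rewrite clipE subr_ge0 ge_min lexx/= lerBlDr lerDl le_min ler0n.
  by rewrite ltW.
- apply: aeW => w; apply: cvg_near_cst; near=> K; rewrite clipE min_l ?subrr//.
  by near: K; exact: nbhs_infty_ger.
Unshelve. all: by end_near. Qed.

Let sum_excess K n :
  P.-integrable setT
    (EFin \o (fun w => \sum_(0 <= k < n) (tau (X k w) - clip K (X k w)))) /\
  \int[P]_w (\sum_(0 <= k < n) (tau (X k w) - clip K (X k w))) =
  n%:R * \int[P]_w (tau (X 0 w) - clip K (X 0 w)).
Proof.
have [i1 ->] := Rintegral_sum_nat n (iexcess K); split => //.
rewrite (eq_bigr (fun=> \int[P]_w (tau (X 0 w) - clip K (X 0 w)))) => [|k _].
  by rewrite sumr_const_nat subn0 mulr_natl.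
apply: (@iid_Rintegral _ _ _ _ _ _ X iidX (fun x => tau x - clip K x)).
  exact: measurable_funB.
exact: (iexcess K 0%N).
Qed.

(** Clipping splits the sum: the centered clipped part [V] has second moment of order n and falls
    under Chebyshev's inequality, while the nonnegative excess [Q] has mean n r and falls under
    Markov's. *)
Lemma weak_law (e : R) : 0 < e -> exists n0, forall n, (n0 <= n)%N ->
  \int[P]_w (e * n%:R < `|partial_sum X tau n w - n%:R * mu|)%R%:R <= e.
Proof.
move=> e0.
(* The bound [e / 4] keeps the correction n r of the mean below a quarter of the deviation;
   [e ^+ 2 / 8] makes the Markov term 4 r / e at most e / 2. *)
have e40 : 0 < Num.min (e / 4) (e ^+ 2 / 8) by rewrite lt_min !divr_gt0// exprn_gt0.
have [K] := excess_small e40; set r := \int[P]_w _; rewrite le_min => /andP[r1 r2].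
pose nuK := \int[P]_w clip K (X 0 w).
have muE : mu = nuK + r by rewrite /r (RintegralB measurableT itau (iclip K 0%N)) addrC subrK.
pose phi x := clip K x - nuK.
have mphi : measurable_fun setT phi by exact: measurable_funB.
have phiK x : `|phi x| <= K%:R.
  have nu0 : 0 <= nuK <= K%:R.
    rewrite /nuK Rintegral_ge0 => [/=|w _]; last by have /andP[] := clip_bound K (X 0%N w).
    rewrite -[leRHS](Rintegral_prob_cst P); apply: le_Rintegral => //.
    - exact: (iclip K 0%N).
    - by apply: (bounded_integrable _ (M := K%:R)) => // w; rewrite ger0_norm.
    - by move=> w _; have /andP[] := clip_bound K (X 0%N w).
  have := clip_bound K x; move: nu0 => /andP[n0 nK] /andP[c0 cK].
  by rewrite /phi ler_norml; apply/andP; split; lra.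
have mphiX k : measurable_fun setT (fun w => phi (X k w)) by exact: measurableT_comp.
have i2 : P.-integrable setT (EFin \o (fun w => phi (X 0 w) ^+ 2)).
  apply: (bounded_integrable _ (M := K%:R ^+ 2)); first exact: measurable_funX.
  by move=> w; rewrite normrX ler_pXn2r ?nnegrE.
have E0 : \int[P]_w phi (X 0 w) = 0.
  have ic : P.-integrable setT (EFin \o (fun=> nuK)).
    by apply: (bounded_integrable _ (M := `|nuK|)).
  by rewrite (RintegralB measurableT (iclip K 0%N) ic) Rintegral_prob_cst subrr.
pose s := \int[P]_w phi (X 0 w) ^+ 2.
have s0 : 0 <= s by apply: Rintegral_ge0 => w _; exact: sqr_ge0.
(* From here on the Chebyshev term 4 s / (e^2 n) is at most e / 2. *)
pose n0 := (Num.truncn (8 * s / e ^+ 3)).+1; exists n0 => n n0n.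
have n_gt : 8 * s / e ^+ 3 < n%:R.
  by rewrite (lt_le_trans (truncnS_gt _))// ler_nat.
have np : (0 : R) < n%:R.
  by rewrite ltr0n (leq_trans _ n0n).
pose V := weighted_sum X phi (fun _ _ => 1) 0 n.
have H1 (k : nat) (w : T) : `|1 : R| <= 1 by rewrite normr1.
have [mV iV EV] := @weighted_sum_second_moment _ _ _ _ _ _ X iidX phi mphi i2 E0
  (fun _ _ => 1) 0%N n (leq0n n) (fun k => measurable_cst _) H1.
have [iQ EQ] := sum_excess K n.
set Q := (fun w => \sum_(0 <= k < n) _) in iQ EQ.
have Q0 w : 0 <= Q w.
  apply: sumr_ge0 => k _; rewrite clipE subr_ge0 ge_min lexx//.
have TE w : partial_sum X tau n w - n%:R * mu = V w + Q w - n%:R * r.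
  rewrite /partial_sum -(big_mkord xpredT (fun i => tau (X i w))) /V /weighted_sum /Q -big_split/=.
  have -> : \sum_(0 <= i < n) (1 * phi (X i w) + (tau (X i w) - clip K (X i w))) =
      \sum_(0 <= i < n) (tau (X i w) - nuK).
    by apply: eq_bigr => i _; rewrite /phi; ring.
  by rewrite sumrB sumr_const_nat subn0 -mulr_natl muE; ring.
have c1 : 0 <= 4 / (e ^+ 2 * n%:R ^+ 2) by rewrite divr_ge0// mulr_ge0 ?sqr_ge0.
have c2 : 0 <= 4 / (e * n%:R) by rewrite divr_ge0// mulr_ge0// ltW.
have bound w : (e * n%:R < `|partial_sum X tau n w - n%:R * mu|)%R%:R <=
    4 / (e ^+ 2 * n%:R ^+ 2) * V w ^+ 2 + 4 / (e * n%:R) * Q w.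
  rewrite TE; have [big|_] := ltP (e * n%:R) `|V w + Q w - n%:R * r|; last first.
    by rewrite addr_ge0// mulr_ge0// sqr_ge0.
  rewrite [leLHS](_ : _ = 1)//.
  (* If [Q] is below e n / 4, then with n r at most e n / 4 the part [V] must account for e n / 2;
     each case is paid by its own term of the bound. *)
  have [Qbig|Qsmall] := leP (e * n%:R / 4) (Q w).
    apply: ler_wpDl; first by rewrite mulr_ge0 ?sqr_ge0.
    have h : 4 / (e * n%:R) * (e * n%:R / 4) <= 4 / (e * n%:R) * Q w by rewrite ler_wpM2l.
    by apply: le_trans h; rewrite le_eqVlt; apply/orP; left; apply/eqP; field; rewrite !gt_eqF.
  apply: ler_wpDr; first by rewrite mulr_ge0.
  have Vbig : e * n%:R / 2 <= `|V w|.
    rewrite -addrA in big.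
    have r0 : 0 <= n%:R * r.
      rewrite mulr_ge0// Rintegral_ge0// => v _; rewrite clipE subr_ge0 ge_min lexx//.
    apply: (half_of_sum big (ler_normD (V w) (Q w - n%:R * r)) _ Qsmall _).
      by rewrite (le_trans (ler_normB _ _))// !ger0_norm.
    by rewrite (mulrC e) -mulrA ler_pM2l.
  have : (e * n%:R / 2) ^+ 2 <= V w ^+ 2.
    rewrite -(real_normK (num_real (V w))) ler_pXn2r ?nnegrE//.
    by rewrite divr_ge0// mulr_ge0// ltW.
  move=> /(ler_wpM2l c1) h; apply: le_trans h.
  by rewrite le_eqVlt; apply/orP; left; apply/eqP; field; rewrite !gt_eqF.
have mS : measurable_fun setT (partial_sum X tau n).
  exact: (measurable_past_measurable mX (@measurable_partial_sum _ _ _ _ _ X tau mtau n)).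
have mA : measurable_fun setT
    (fun w => (e * n%:R < `|partial_sum X tau n w - n%:R * mu|)%R%:R : R).
  by apply: measurable_ltr_indicator => //; apply: measurableT_comp => //; exact: measurable_funB.
apply: (@le_trans _ _ (4 / (e ^+ 2 * n%:R ^+ 2) * (n%:R * s) + 4 / (e * n%:R) * (n%:R * r))).
  have iV' := integrableZ_EFin (4 / (e ^+ 2 * n%:R ^+ 2)) iV.
  have iQ' := integrableZ_EFin (4 / (e * n%:R)) iQ.
  apply: (@le_trans _ _ (\int[P]_w (4 / (e ^+ 2 * n%:R ^+ 2) * V w ^+ 2 + 4 / (e * n%:R) * Q w))).
    apply: le_Rintegral => //; last exact: integrableD_EFin iV' iQ'.
    by apply: (bounded_integrable _ mA (M := 1)) => w; rewrite ger0_norm// lern1 leq_b1.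
  rewrite (RintegralD measurableT iV' iQ') (RintegralZl _ measurableT iV) (RintegralZl _ measurableT iQ).
  by rewrite EQ lerD2r ler_wpM2l//; move: EV; rewrite subn0.
have -> : 4 / (e ^+ 2 * n%:R ^+ 2) * (n%:R * s) + 4 / (e * n%:R) * (n%:R * r) =
   4 * s / e ^+ 2 / n%:R + 4 / e * r by field; rewrite !gt_eqF.
have h1 : 4 * s / e ^+ 2 / n%:R <= e / 2.
  rewrite ler_pdivrMr// ler_pdivrMr ?exprn_gt0//.
  move: n_gt; rewrite ltr_pdivrMr ?exprn_gt0//.
  have -> : e / 2 * n%:R * e ^+ 2 = n%:R * e ^+ 3 / 2 by field.
  move=> h; rewrite ler_pdivlMr// (_ : 4 * s * 2 = 8 * s); [exact: ltW|ring].
have h2 : 4 / e * r <= e / 2.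
  apply: (@le_trans _ _ (4 / e * (e ^+ 2 / 8))); first by rewrite ler_wpM2l// divr_ge0// ltW.
  by rewrite le_eqVlt; apply/orP; left; apply/eqP; field; rewrite gt_eqF.
by rewrite [leRHS]splitr lerD.
Qed.

End weak_law.

(** Counts the windows of width [eta] that an interval of length [x] can reach; the source of the
    factor [tau / eta + 1]. *)
Lemma sum_multiples_below (R : realFieldType) (eta x : R) (K : nat) : 0 < eta -> 0 <= x ->
  \sum_(0 <= k < K) (k%:R * eta < x)%R%:R <= x / eta + 1.
Proof.
move=> eta0 x0; elim: K => [|K IH].
  by rewrite big_geq// addr_ge0// divr_ge0// ltW.
rewrite big_nat_recr//=; have [Kx|_] := ltP; last by rewrite addr0.
rewrite lerD//; apply: (@le_trans _ _ K%:R); last by rewrite ler_pdivlMr// ltW.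
rewrite -[leRHS]mulr_natr mul1r -[in leRHS](subn0 K) -sumr_const_nat.
by apply: ler_sum => i _; rewrite lern1 leq_b1.
Qed.

(** * Expected renewals in a window and the straddling cycle *)

Section renewal_measure.
Context d (T : measurableType d) (R : realType) (P : probability T R).
Context d' (E : measurableType d').
Variable X : nat -> T -> E.
Hypothesis iidX : iid P X.
Variable tau : E -> R.
Hypothesis mtau : measurable_fun setT tau.
Hypothesis tau0 : forall n w, 0 < tau (X n w).
Hypothesis itau : P.-integrable setT (EFin \o (tau \o X 0)).

Let S := partial_sum X tau.

Let mX n : measurable_fun setT (X n). Proof. by have [] := iidX. Qed.

Let mtauX n : measurable_fun setT (fun w => tau (X n w)).
Proof. exact: measurableT_comp. Qed.

Let mS n : measurable_fun setT (S n).
Proof. exact: (measurable_past_measurable mX (@measurable_partial_sum _ _ _ _ _ X tau mtau n)). Qed.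

Let S_ge0 n w : 0 <= S n w.
Proof. by apply: sumr_ge0 => i _; exact: ltW. Qed.

Let SS n w : S n.+1 w = S n w + tau (X n w).
Proof. by rewrite /S /partial_sum big_ord_recr. Qed.

Let ind_le1 (b : bool) : `|b%:R : R| <= 1.
Proof. by rewrite ger0_norm// lern1 leq_b1. Qed.

Let int_ind (b : T -> bool) : measurable_fun setT (fun w => (b w)%:R : R) ->
  P.-integrable setT (EFin \o (fun w => (b w)%:R : R)).
Proof. by move=> mb; apply: (bounded_integrable _ mb (M := 1)). Qed.

(** Strict positivity makes P(tau <= 1/k) tend to 0. The level 1/2 is a convenient choice, whose
    inverse is the constant 2 of the renewal bounds. *)
Lemma renewal_gap : exists2 eta, 0 < eta & 2^-1 <= \int[P]_w (eta < tau (X 0 w))%R%:R.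
Proof.
have mle c : measurable_fun setT (fun w => (tau (X 0 w) <= c)%R%:R : R).
  exact: measurable_ler_indicator.
have [|||||n hn] := @dominated_small _ _ _ P
   (fun k w => (tau (X 0 w) <= k.+1%:R^-1)%R%:R) (fun=> 1) 2^-1 _ _ _ _ _; last 1 first.
- exists n.+1%:R^-1 => //.
  have -> : (fun w => (n.+1%:R^-1 < tau (X 0 w))%R%:R : R) =
      (fun w => 1 - (tau (X 0 w) <= n.+1%:R^-1)%R%:R).
    by apply/funext => w; rewrite ltNge; case: (_ <= _); rewrite /= ?subr0 ?subrr.
  rewrite (RintegralB measurableT _ (int_ind (mle _))) ?Rintegral_prob_cst.
    by rewrite lerBrDr -lerBrDl [X in X - _](splitr 1) mul1r addrK.
  by apply: (bounded_integrable _ (M := 1)) => // w; rewrite normr1.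
- by move=> n; exact: mle.
- by move=> n w; rewrite ler0n lern1 leq_b1.
- by apply: (bounded_integrable _ (M := 1)) => // w; rewrite normr1.
- apply: aeW => w; apply: cvg_near_cst.
  have : \forall k \near \oo, k.+1%:R^-1 < tau (X 0%N w).
    exact: (cvgr_lt _ (@cvg_harmonic R) _ (tau0 0 w)).
  by apply: filterS => k; rewrite ltNge => /negbTE ->.
- by rewrite invr_gt0.
Qed.

Section gap.
Variable eta : R.
Hypothesis eta0 : 0 < eta.
Hypothesis gap : 2^-1 <= \int[P]_w (eta < tau (X 0 w))%R%:R.

Let in_window (y z : R) (n : nat) (w : T) : R :=
  (y < S n w)%R%:R * (S n w <= z)%R%:R.

Let mwindow y z n : measurable_fun setT (in_window y z n : past_type X n -> R).
Proof.
have mS' := @measurable_partial_sum _ _ _ _ _ X tau mtau n.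
by apply: measurable_funM;
  [exact: measurable_ltr_indicator|exact: measurable_ler_indicator].
Qed.

Let window_le1 y z n w : `|in_window y z n w| <= 1.
Proof. by rewrite normrM mulr_ile1. Qed.

(** A renewal in the window followed by a gap longer than [eta] is the last one up to [y + eta],
    which happens for at most one index. By independence of the past each visit is such an exit with
    probability at least 1/2, so the expected number of visits is at most 2. *)
Lemma renewal_interval (y : R) (N : nat) :
  \sum_(0 <= n < N) \int[P]_w in_window y (y + eta) n w <= 2.
Proof.
pose p := \int[P]_w (eta < tau (X 0 w))%R%:R; have p2 : 2^-1 <= p by exact: gap.
pose c n := \int[P]_w (S n w <= y + eta)%R%:R.
have mle n : measurable_fun setT (fun w => (S n w <= y + eta)%R%:R : R).
  exact: measurable_ler_indicator.
have mgap : measurable_fun setT (fun x : E => (eta < tau x)%R%:R : R).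
  exact: measurable_ltr_indicator.
have c01 n : 0 <= c n <= 1.
  rewrite /c Rintegral_ge0//=.
  exact: le_trans (ler_norm _) (bounded_Rintegral P (mle n) (fun w => ind_le1 _)).
have step n : \int[P]_w in_window y (y + eta) n w * 2^-1 <= c n - c n.+1.
  apply: (@le_trans _ _ (\int[P]_w in_window y (y + eta) n w * p)).
    by rewrite ler_wpM2l// Rintegral_ge0// => w _; rewrite mulr_ge0.
  rewrite /p -(past_product iidX (@mwindow y (y + eta) n) mgap (@window_le1 y (y + eta) n)
    (M2 := 1))//.
  rewrite /c -(RintegralB measurableT (int_ind (mle n)) (int_ind (mle n.+1))).
  apply: le_Rintegral => //.
  - apply: (bounded_integrable _ (M := 1)) => [|w]; last by rewrite normrM mulr_ile1.
    apply: measurable_funM; last exact: measurableT_comp mgap (mX n).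
    exact: (measurable_past_measurable mX (@mwindow y (y + eta) n)).
  - exact: integrableB_EFin (int_ind (mle n)) (int_ind (mle n.+1)).
  move=> w _; rewrite /in_window SS.
  have [yS|_] := ltP y (S n w); last first.
    rewrite !mul0r subr_ge0; case: (leP (S n w + _)) => // h.
    by rewrite (le_trans _ h)// lerDl ltW.
  have [tn|_] := ltP eta (tau (X n w)); last first.
    rewrite mulr0 subr_ge0; case: (leP (S n w + _)) => // h.
    by rewrite (le_trans _ h)// lerDl ltW.
  by rewrite (lt_geF (ltrD yS tn)) subr0 mulr1 mul1r.
rewrite -[leRHS]mul1r -ler_pdivrMr// mulr_suml.
apply: (@le_trans _ _ (\sum_(0 <= n < N) (c n - c n.+1))); first by apply: ler_sum => n _.
rewrite (eq_bigr (fun n => - (c n.+1 - c n))) => [|n _]; last by rewrite opprB.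
rewrite sumrN telescope_sumr// opprB.
by have /andP[_ h] := c01 0%N; have /andP[h' _] := c01 N; rewrite lerBlDr (le_trans h)// lerDl.
Qed.

(* Renewal bound for the law of the cycle straddling [t]: [t - T_n] is localized in one of
   the windows of width [eta], each of which contains at most two renewals on average. *)
Lemma straddling_cycle (h : E -> R) (t : R) (N : nat) : measurable_fun setT h ->
  (forall x, 0 <= h x <= 1) -> 0 <= t ->
  \sum_(0 <= n < N) \int[P]_w ((S n w <= t)%R%:R * (t < S n.+1 w)%R%:R * h (X n w)) <=
  2 * \int[P]_w ((tau (X 0 w) / eta + 1) * h (X 0 w)).
Proof.
move=> mh h01 t0; pose K := (Num.truncn (t / eta)).+1.
have h0 x : 0 <= h x by have /andP[] := h01 x.
have h1 x : `|h x| <= 1 by have /andP[? ?] := h01 x; rewrite ger0_norm.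
(* Window [k] counted back from [t] is ]t - (k+1) eta, t - k eta]. A cycle that starts there and
   straddles [t] is longer than k eta, which [hk] records. *)
pose win k n w := in_window (t - k.+1%:R * eta) (t - k.+1%:R * eta + eta) n w.
pose hk (k : nat) x : R := (k%:R * eta < tau x)%R%:R * h x.
have hk1 k x : `|hk k x| <= 1 by rewrite normrM mulr_ile1.
have mhk k : measurable_fun setT (hk k).
  by apply: measurable_funM => //; exact: measurable_ltr_indicator.
have mwin k n : measurable_fun setT (win k n).
  exact: (measurable_past_measurable mX (@mwindow _ _ n)).
have ihk k : P.-integrable setT (EFin \o (hk k \o X 0)).
  by apply: (bounded_integrable _ (M := 1)) => [|w]; [exact: measurableT_comp|exact: hk1].
have ib n k : P.-integrable setT (EFin \o (fun w => win k n w * hk k (X n w))).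
  apply: (bounded_integrable _ (M := 1)) => [|w].
    by apply: measurable_funM => //; exact: measurableT_comp.
  by rewrite normrM mulr_ile1//; exact: window_le1.
have step n : \int[P]_w ((S n w <= t)%R%:R * (t < S n.+1 w)%R%:R * h (X n w)) <=
    \sum_(0 <= k < K) \int[P]_w win k n w * \int[P]_w hk k (X 0 w).
  have [i1 E1] := Rintegral_sum_nat K (ib n).
  apply: (@le_trans _ _ (\int[P]_w (\sum_(0 <= k < K) win k n w * hk k (X n w)))).
    apply: le_Rintegral => //.
    - apply: (bounded_integrable _ (M := 1)) => [|w]; last by rewrite !normrM !mulr_ile1// mulr_ge0.
      apply: measurable_funM; last exact: measurableT_comp.
      by apply: measurable_funM; [exact: measurable_ler_indicator|exact: measurable_ltr_indicator].
    move=> w _; rewrite SS.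
    have s0 : 0 <= \sum_(0 <= k < K) win k n w * hk k (X n w).
      by apply: sumr_ge0 => k _; rewrite !mulr_ge0.
    have [St|_] := leP (S n w) t; last by rewrite !mul0r.
    have [tS|_] := ltP t (S n w + _); last by rewrite mulr0 mul0r.
    rewrite !mul1r; pose k := Num.truncn ((t - S n w) / eta).
    have q0 : 0 <= (t - S n w) / eta by rewrite divr_ge0 ?subr_ge0// ltW.
    have /andP[k1 k2] := truncn_itv q0.
    rewrite -/k ler_pdivlMr// in k1; rewrite -/k ltr_pdivrMr// in k2.
    have kK : (k < K)%N.
      rewrite ltnS truncn_ge_nat ?divr_ge0 ?(ltW eta0)// ler_pdivlMr//.
      by rewrite (le_trans k1)// gerBl.
    rewrite big_mkord (bigD1 (Ordinal kK))//= ler_wpDr//.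
      by apply: sumr_ge0 => i _; rewrite !mulr_ge0.
    rewrite /win /in_window /hk.
    have -> : t - k.+1%:R * eta < S n w by rewrite ltrBlDr -ltrBlDl.
    have -> : S n w <= t - k.+1%:R * eta + eta.
      by rewrite -natr1 mulrDl mul1r opprD addrA subrK lerBrDr -lerBrDl.
    have -> : k%:R * eta < tau (X n w) by rewrite (le_lt_trans k1)// ltrBlDl.
    by rewrite !mul1r.
  (* The starting time of the cycle belongs to the past, while its length and [h] depend on the
     cycle alone, so the expectation factors. *)
  rewrite E1; apply: ler_sum => k _; rewrite le_eqVlt; apply/orP; left; apply/eqP.
  exact: (past_product iidX (@mwindow _ _ n) (mhk k) (@window_le1 _ _ n) (hk1 k)).
apply: (@le_trans _ _ (\sum_(0 <= n < N) \sum_(0 <= k < K)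
    \int[P]_w win k n w * \int[P]_w hk k (X 0%N w))); first by apply: ler_sum => n _; exact: step.
(* Summed over [n] first, each window contributes at most 2 whatever its position, which removes the
   dependence on [t] and [N]. *)
rewrite exchange_big/=.
apply: (@le_trans _ _ (\sum_(0 <= k < K) 2 * \int[P]_w hk k (X 0%N w))).
  apply: ler_sum => k _; rewrite -mulr_suml ler_wpM2r//; last exact: renewal_interval.
  by apply: Rintegral_ge0 => w _; rewrite mulr_ge0.
rewrite -mulr_sumr ler_wpM2l//.
have [i1 <-] := Rintegral_sum_nat K ihk; apply: le_Rintegral => //.
  apply: (@le_integrable_EFin _ _ _ P _ (fun w => tau (X 0%N w) / eta + 1)).
  - apply: measurable_funM; last exact: measurableT_comp.
    by apply: measurable_funD => //; exact: measurable_funM.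
  - move=> w; have a0 : 0 <= tau (X 0%N w) / eta + 1.
      by rewrite addr_ge0// divr_ge0 ?(ltW eta0)// ltW.
    by rewrite ger0_norm ?mulr_ge0// ler_piMr//; have /andP[] := h01 (X 0%N w).
  - apply: integrableD_EFin.
      have := @integrableZ_EFin _ _ _ P eta^-1 _ itau.
      by under [in X in X -> _]eq_fun do rewrite mulrC.
    by apply: (bounded_integrable _ (M := 1)) => // w; rewrite normr1.
move=> w _; rewrite /hk/= -mulr_suml ler_wpM2r//.
by apply: sum_multiples_below => //; exact: ltW.
Qed.

End gap.
End renewal_measure.

(** * Replacing the random number of renewals *)

Lemma crossing (R : realDomainType) (s : nat -> R) (t : R) (m n : nat) : (m <= n)%N ->
  s m <= t -> t < s n -> exists2 k, (m <= k < n)%N & s k <= t < s k.+1.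
Proof.
move=> mn sm; elim: n mn => [|n IH].
  by rewrite leqn0 => /eqP <-; rewrite ltNge sm.
rewrite leq_eqVlt => /predU1P[<-|]; first by rewrite ltNge sm.
rewrite ltnS => mn tS; have [snt|tsn] := leP (s n) t; first by exists n; rewrite ?mn/= ?snt.
by have [k /andP[mk kn] h] := IH mn tsn; exists k; rewrite // mk ltnS ltnW.
Qed.

(** The inequality |cz| <= kappa / 2 + (cz)^2 / (2 kappa) trades an absolute value for a square,
    pointwise, so that afterwards only a second moment has to be integrated. *)
Lemma scaled_norm_le (R : realFieldType) (c x y z rho kappa : R) : 0 <= c -> 0 < kappa ->
  `|x - y| <= rho ->
  `|c * x - c * (y - z)| <= c * rho + (kappa / 2 + c ^+ 2 / (2 * kappa) * z ^+ 2).
Proof.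
move=> c0 k0 xy; have -> : c * x - c * (y - z) = c * (x - y) + c * z by ring.
rewrite (le_trans (ler_normD _ _))// lerD//.
  by rewrite normrM ger0_norm// ler_wpM2l.
have h := sqr_ge0 (`|c * z| - kappa).
have -> : c ^+ 2 / (2 * kappa) * z ^+ 2 = `|c * z| ^+ 2 / (2 * kappa).
  by rewrite real_normK ?num_real//; field; rewrite gt_eqF.
have -> : kappa / 2 + `|c * z| ^+ 2 / (2 * kappa) =
    `|c * z| + (`|c * z| - kappa) ^+ 2 / (2 * kappa) by field; rewrite gt_eqF.
by rewrite lerDl divr_ge0// mulr_ge0// ltW.
Qed.

Section frozen_time.
Context d (T : measurableType d) (R : realType) (P : probability T R).
Context d' (E : measurableType d').
Variable X : nat -> T -> E.
Hypothesis iidX : iid P X.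
Variables tau phi : E -> R.
Hypotheses (mtau : measurable_fun setT tau) (mphi : measurable_fun setT phi).
Hypothesis tau0 : forall n w, 0 < tau (X n w).
Hypothesis W2 : P.-integrable setT (EFin \o (fun w => phi (X 0 w) ^+ 2)).
Hypothesis EW0 : \int[P]_w phi (X 0 w) = 0.

Let S := partial_sum X tau.
Let U := partial_sum X phi.
Let sigma2 := \int[P]_w phi (X 0 w) ^+ 2.

Let mX n : measurable_fun setT (X n). Proof. by have [] := iidX. Qed.

Let mS n : measurable_fun setT (S n).
Proof. exact: (measurable_past_measurable mX (@measurable_partial_sum _ _ _ _ _ X tau mtau n)). Qed.

Let mU n : measurable_fun setT (U n).
Proof. exact: (measurable_past_measurable mX (@measurable_partial_sum _ _ _ _ _ X phi mphi n)). Qed.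

Let SS n w : S n.+1 w = S n w + tau (X n w).
Proof. by rewrite /S /partial_sum big_ord_recr. Qed.

Let S_mono w : {homo S^~ w : m n / (m <= n)%N >-> m <= n}.
Proof.
apply: homo_leq => [|y x z xy yz|n]; [exact: lexx|exact: le_trans yz|].
by rewrite SS lerDl ltW.
Qed.

Let H (t : R) (k : nat) (w : T) : R := (S k w <= t)%R%:R.

(* Replaces an increment over a random number of terms by a sum with predictable weights. *)
Let weighted_sum_straddle t m n k w : (m <= k < n)%N -> S k w <= t < S k.+1 w ->
  weighted_sum X phi (H t) m n w = U k.+1 w - U m w.
Proof.
move=> /andP[mk kn] /andP[Skt tSk]; rewrite /weighted_sum (big_cat_nat (n := k.+1))//=; last exact: leqW.
rewrite [X in _ + X]big1_seq ?addr0 => [|i /=]; last first.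
  rewrite mem_index_iota => /andP[ki _].
  by rewrite /H leNgt (lt_le_trans tSk (S_mono w ki)) mul0r.
rewrite /U /partial_sum -!(big_mkord xpredT (fun i => phi (X i w))).
rewrite (big_cat_nat (n := m) (m := 0%N) (p := k.+1))//=; last exact: leqW.
rewrite addrAC subrr add0r; apply: eq_big_seq => i.
rewrite mem_index_iota ltnS => /andP[_ ik].
by rewrite /H (le_trans (S_mono w ik) Skt) mul1r.
Qed.

Variables (f : R -> R) (M L : R).
Hypotheses (fM : forall x, `|f x| <= M) (fL : forall x y, `|f x - f y| <= L * `|x - y|).
Hypothesis L0 : 0 <= L.
Hypothesis mf : measurable_fun setT f.
Variables (bad : E -> bool) (Y : T -> R) (t rho : R).
Hypothesis mbad : measurable_fun setT (fun x => (bad x)%:R : R).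
Hypothesis mY : measurable_fun setT Y.
Hypothesis Y_near : forall n w, S n w <= t < S n.+1 w -> ~~ bad (X n w) ->
  `|Y w - U n.+1 w| <= rho.
Variables (m n : nat) (c kappa : R).
Hypotheses (mn : (m <= n)%N) (c0 : 0 <= c) (kappa0 : 0 < kappa) (rho0 : 0 <= rho).

Let straddle k w : R := (S k w <= t)%R%:R * (t < S k.+1 w)%R%:R * (bad (X k w))%:R.
Let V := weighted_sum X phi (H t) m n.

(** Three events are paid with the crude bound [2 * M]: the renewal [m] comes after [t], the renewal
    [n] does not, or the straddling cycle is bad. Otherwise that cycle has an index between [m] and
    [n], and the Lipschitz bound applies to the difference, up to [rho] equal to the weighted sum
    [V]. *)
Let pointwise w : `|f (c * Y w) - f (c * U m w)| <=
  2 * M * ((t < S m w)%R%:R + (S n w <= t)%R%:R + \sum_(0 <= k < n) straddle k w) +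
  L * (c * rho + (kappa / 2 + c ^+ 2 / (2 * kappa) * V w ^+ 2)).
Proof.
have M0 : 0 <= M by exact: le_trans (normr_ge0 _) (fM 0).
have s0 k : 0 <= straddle k w by rewrite !mulr_ge0.
have sum0 : 0 <= \sum_(0 <= k < n) straddle k w by exact: sumr_ge0.
have L1 : 0 <= L * (c * rho + (kappa / 2 + c ^+ 2 / (2 * kappa) * V w ^+ 2)).
  rewrite mulr_ge0// addr_ge0 ?mulr_ge0// addr_ge0 ?divr_ge0 ?(ltW kappa0)//.
  by rewrite mulr_ge0 ?sqr_ge0// divr_ge0 ?sqr_ge0// mulr_ge0// ltW.
have crude b : 1 <= b ->
    `|f (c * Y w) - f (c * U m w)| <= 2 * M * b +
      L * (c * rho + (kappa / 2 + c ^+ 2 / (2 * kappa) * V w ^+ 2)).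
  move=> b1; rewrite ler_wpDr// (le_trans (ler_normB _ _))//.
  apply: (@le_trans _ _ (2 * M)); first by rewrite mulr2n mulrDl !mul1r lerD.
  by rewrite ler_peMr// mulr_ge0.
have [tSm|Smt] := ltP t (S m w).
  by apply: crude; rewrite -addrA lerDl addr_ge0.
have [Snt|tSn] := leP (S n w) t.
  by apply: crude; rewrite add0r lerDl.
have [k kmn kt] := crossing (s := S^~ w) mn Smt tSn.
have [mk kn] := andP kmn.
case badk : (bad (X k w)).
  apply: crude; rewrite !add0r big_mkord (bigD1 (Ordinal kn))//= ler_wpDr//; first exact: sumr_ge0.
  by rewrite /straddle badk; have /andP[-> ->] := kt; rewrite !mul1r.
rewrite ler_wpDl//; first by rewrite !add0r !mulr_ge0.
apply: (le_trans (fL _ _)); rewrite ler_wpM2l//.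
have -> : U m w = U k.+1 w - V w.
  by rewrite /V (weighted_sum_straddle kmn kt) opprB addrCA subrr addr0.
by apply: scaled_norm_le => //; apply: Y_near kt _; rewrite badk.
Qed.

Lemma frozen_time_error : `|\int[P]_w f (c * Y w) - \int[P]_w f (c * U m w)| <=
  2 * M * (\int[P]_w (t < S m w)%R%:R + \int[P]_w (S n w <= t)%R%:R +
    \sum_(0 <= k < n) \int[P]_w straddle k w) +
  L * (c * rho + (kappa / 2 + c ^+ 2 / (2 * kappa) * ((n - m)%:R * sigma2))).
Proof.
have mH k : measurable_fun setT (H t k : past_type X k -> R).
  by apply: measurable_ler_indicator => //; exact: measurable_partial_sum.
have H1 k w : `|H t k w| <= 1 by rewrite ger0_norm// lern1 leq_b1.
have [mV iV EV] := weighted_sum_second_moment iidX mphi W2 EW0 mn mH H1.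
have bnd (g : T -> R) b : measurable_fun setT g -> (forall w, `|g w| <= b) ->
   P.-integrable setT (EFin \o g) by move=> mg gb; exact: (bounded_integrable P mg gb).
have i1 : P.-integrable setT (EFin \o (fun w => f (c * Y w))).
  apply: (bnd _ M) => [|w]; last exact: fM.
  by apply: measurableT_comp => //; exact: measurable_funM.
have i2 : P.-integrable setT (EFin \o (fun w => f (c * U m w))).
  apply: (bnd _ M) => [|w]; last exact: fM.
  by apply: measurableT_comp => //; exact: measurable_funM.
have mlt k : measurable_fun setT (fun w => (t < S k w)%R%:R : R).
  exact: measurable_ltr_indicator.
have mle k : measurable_fun setT (fun w => (S k w <= t)%R%:R : R).
  exact: measurable_ler_indicator.
have ind1 (b : bool) : `|b%:R : R| <= 1 by rewrite ger0_norm// lern1 leq_b1.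
have i3 : P.-integrable setT (EFin \o (fun w => (t < S m w)%R%:R : R)) by exact: (bnd _ 1).
have i4 : P.-integrable setT (EFin \o (fun w => (S n w <= t)%R%:R : R)) by exact: (bnd _ 1).
have i5 k : P.-integrable setT (EFin \o straddle k).
  apply: (bnd _ 1) => [|w]; last by rewrite !normrM !mulr_ile1// mulr_ge0.
  apply: measurable_funM; first exact: measurable_funM.
  exact: (measurableT_comp mbad (mX k)).
have [i6 E6] := Rintegral_sum_nat n i5.
have i34 := integrableD_EFin i3 i4.
have i346 := integrableD_EFin i34 i6.
have i7 := integrableZ_EFin (c ^+ 2 / (2 * kappa)) iV.
have ic (x : R) : P.-integrable setT (EFin \o (fun=> x)) by exact: (bnd _ `|x|).
have i8 := integrableD_EFin (ic (c * rho)) (integrableD_EFin (ic (kappa / 2)) i7).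
have i9 := integrableD_EFin (integrableZ_EFin (2 * M) i346) (integrableZ_EFin L i8).
rewrite -(RintegralB measurableT i1 i2).
apply: (le_trans (le_normr_Rintegral measurableT (integrableB_EFin i1 i2))).
apply: (@le_trans _ _ (\int[P]_w (2 * M *
    ((t < S m w)%R%:R + (S n w <= t)%R%:R + \sum_(0 <= k < n) straddle k w) +
  L * (c * rho + (kappa / 2 + c ^+ 2 / (2 * kappa) * V w ^+ 2))))).
  apply: le_Rintegral => //.
  by have := integrable_abse (integrableB_EFin i1 i2).
rewrite (RintegralD measurableT (integrableZ_EFin (2 * M) i346) (integrableZ_EFin L i8)).
rewrite (RintegralZl _ measurableT i346) (RintegralZl _ measurableT i8).
rewrite (RintegralD measurableT i34 i6) (RintegralD measurableT i3 i4) E6 lerD2l ler_wpM2l//.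
rewrite (RintegralD measurableT (ic _) (integrableD_EFin (ic _) i7)).
rewrite (RintegralD measurableT (ic _) i7) (RintegralZl _ measurableT iV).
rewrite !Rintegral_prob_cst !lerD2l ler_wpM2l//.
by rewrite divr_ge0 ?sqr_ge0// mulr_ge0// ltW.
Qed.

End frozen_time.

Lemma exists_small (R : realFieldType) (A e : R) : 0 <= A -> 0 < e ->
  exists2 s, 0 < s <= 2^-1 & A * s <= e.
Proof.
move=> A0 e0; exists (Num.min 2^-1 (e / (A + 1))).
  by rewrite lt_min invr_gt0 ltr0n ge_min lexx divr_gt0// ltr_wpDl.
apply: (@le_trans _ _ (A * (e / (A + 1)))); first by rewrite ler_wpM2l// ge_min lexx orbT.
rewrite mulrCA ler_piMr ?(ltW e0)// ler_pdivrMr ?ltr_wpDl// mul1r.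
by rewrite lerDl.
Qed.

(** Here [x] stands for the mean of the renewal time [s]. The deviation is at least [delta * x], and
    in the late case at least x delta / (1 + delta); the factor 1/4 leaves room in both. *)
Lemma early_deviation (R : realFieldType) (delta e t x s : R) : 0 < delta <= 2^-1 -> 0 <= x ->
  x <= (1 - delta) * t -> e <= delta / 4 * x -> t < s -> e < s - x.
Proof. by move=> /andP[d0 d1] x0 xt ex ts; nra. Qed.

Lemma late_deviation (R : realFieldType) (delta e t x s : R) : 0 < delta <= 2^-1 -> 0 <= t ->
  (1 + delta) * t < x -> e <= delta / 4 * x -> s <= t -> e < x - s.
Proof.
move=> /andP[d0 d1] t0 tx ex st.
have h1 : 0 <= (x - (1 + delta) * t) * (1 - delta / 4) by apply: mulr_ge0; lra.
have h2 : 0 <= delta * t * (3 - delta) by rewrite !mulr_ge0//; lra.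
have h3 : 0 < delta * (x - (1 + delta) * t) by rewrite mulr_gt0// subr_gt0.
nra.
Qed.

Section random_index.
Context d (T : measurableType d) (R : realType) (P : probability T R).
Context d' (E : measurableType d').
Variable X : nat -> T -> E.
Hypothesis iidX : iid P X.
Variables tau phi : E -> R.
Hypotheses (mtau : measurable_fun setT tau) (mphi : measurable_fun setT phi).
Hypothesis tau0 : forall n w, 0 < tau (X n w).
Hypothesis itau : P.-integrable setT (EFin \o (tau \o X 0)).
Hypothesis W2 : P.-integrable setT (EFin \o (fun w => phi (X 0 w) ^+ 2)).
Hypothesis EW0 : \int[P]_w phi (X 0 w) = 0.

Let S := partial_sum X tau.
Let U := partial_sum X phi.
Let mu := \int[P]_w tau (X 0 w).
Let sigma2 := \int[P]_w phi (X 0 w) ^+ 2.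

Let mX n : measurable_fun setT (X n). Proof. by have [] := iidX. Qed.

Let mS n : measurable_fun setT (S n).
Proof. exact: (measurable_past_measurable mX (@measurable_partial_sum _ _ _ _ _ X tau mtau n)). Qed.

Let mU n : measurable_fun setT (U n).
Proof. exact: (measurable_past_measurable mX (@measurable_partial_sum _ _ _ _ _ X phi mphi n)). Qed.

Let sigma20 : 0 <= sigma2.
Proof. by apply: Rintegral_ge0 => w _; exact: sqr_ge0. Qed.

Lemma mean_gap_gt0 : 0 < mu.
Proof.
have [eta eta0 gap] := renewal_gap iidX mtau tau0.
have mi : measurable_fun setT (fun w => (eta < tau (X 0 w))%R%:R : R).
  by apply: measurable_ltr_indicator => //; exact: measurableT_comp mtau (mX 0%N).
have ii : P.-integrable setT (EFin \o (fun w => (eta < tau (X 0 w))%R%:R : R)).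
  by apply: (bounded_integrable _ mi (M := 1)) => w; rewrite ger0_norm// lern1 leq_b1.
apply: (@lt_le_trans _ _ (eta * 2^-1)); first by rewrite mulr_gt0.
apply: (@le_trans _ _ (eta * \int[P]_w (eta < tau (X 0 w))%R%:R)); first by rewrite ler_pM2l.
rewrite -(RintegralZl _ measurableT ii); apply: le_Rintegral => //.
  exact: (integrableZ_EFin eta ii).
by move=> w _; case: ltP => [h|_]; rewrite ?mulr1 ?mulr0 ltW.
Qed.

Section straddling.
Variable bad : nat -> E -> bool.
Hypothesis mbad : forall r, measurable_fun setT (fun x => (bad r x)%:R : R).
Hypothesis ae_good : {ae P, forall w, \forall r \near \oo, ~~ bad r (X 0 w)}.

(** The density [tau / eta + 1] is integrable and the first cycle is almost surely not bad at high
    levels, so by dominated convergence one level serves all [t] and [N], with no rate of decay for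
    the bad events. *)
Lemma straddling_cycle_good (e : R) : 0 < e -> exists r, forall t N, 0 <= t ->
  \sum_(0 <= n < N) \int[P]_w
    ((S n w <= t)%R%:R * (t < S n.+1 w)%R%:R * (bad r (X n w))%:R) <= e.
Proof.
move=> e0; have [eta eta0 gap] := renewal_gap iidX mtau tau0.
have g0 w : 0 <= tau (X 0%N w) / eta + 1.
  by rewrite addr_ge0// divr_ge0 ?(ltW eta0)// ltW.
have [|||||r hr] := @dominated_small _ _ _ P
  (fun r w => (tau (X 0%N w) / eta + 1) * (bad r (X 0%N w))%:R)
  (fun w => tau (X 0%N w) / eta + 1) (e / 2) _ _ _ _ _.
- move=> r; apply: measurable_funM; last exact: (measurableT_comp (mbad r) (mX 0%N)).
  apply: measurable_funD => //; apply: measurable_funM => //.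
  exact: measurableT_comp mtau (mX 0%N).
- by move=> r w; rewrite mulr_ge0//= ler_piMr// lern1 leq_b1.
- apply: integrableD_EFin.
    have := @integrableZ_EFin _ _ _ P eta^-1 _ itau.
    by under [in X in X -> _]eq_fun do rewrite mulrC.
  by apply: (bounded_integrable _ (M := 1)) => // w; rewrite normr1.
- apply: filterS ae_good => w good; apply: cvg_near_cst.
  by apply: filterS good => r /negbTE ->; rewrite mulr0.
- by rewrite divr_gt0.
exists r => t N t0.
apply: (le_trans (straddling_cycle iidX mtau tau0 itau eta0 gap N (mbad r) _ t0)).
  by move=> x; rewrite ler0n lern1 leq_b1.
by rewrite mulrC -ler_pdivlMr.
Qed.

End straddling.

Lemma renewal_count_concentration (delta eta : R) : 0 < delta <= 2^-1 -> 0 < eta ->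
  exists2 t0, 0 < t0 & forall t, t0 <= t ->
    \int[P]_w (t < S (Num.truncn ((1 - delta) * (t / mu))) w)%R%:R <= eta /\
    \int[P]_w (S (Num.truncn ((1 + delta) * (t / mu))).+1 w <= t)%R%:R <= eta.
Proof.
move=> /[dup] d01 /andP[d0 d1] eta0; have mu0 := mean_gap_gt0.
(* The weak law uses one number both as deviation per summand and as bound on the probability. *)
pose e := Num.min eta (mu * (delta / 4)).
have e0 : 0 < e by rewrite lt_min eta0 !mulr_gt0.
have [n0 hn0] := weak_law iidX mtau tau0 itau e0.
(* Since 1 - delta is at least 1/2, this brings already the smaller index [m] to [n0] or beyond. *)
exists (2 * n0.+1%:R * mu); first by rewrite !mulr_gt0.
move=> t t0t; have n0t : 2 * n0.+1%:R <= t / mu by rewrite ler_pdivlMr.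
have t0 : 0 <= t by apply: le_trans t0t; rewrite !mulr_ge0// ltW.
have q0 : 0 <= t / mu by apply: le_trans n0t; rewrite mulr_ge0.
set m := Num.truncn _; set n := (Num.truncn _).+1.
have dm : 0 <= (1 - delta) * (t / mu) by rewrite mulr_ge0// subr_ge0 (le_trans d1)// invf_le1// ler1n.
have dn : 0 <= (1 + delta) * (t / mu) by rewrite mulr_ge0// addr_ge0// ltW.
have n0m : (n0 <= m)%N.
  rewrite truncn_ge_nat//; apply: (@le_trans _ _ (2^-1 * (t / mu))); last first.
    by rewrite ler_wpM2r// lerBrDr -lerBrDl [X in X - _](splitr 1) mul1r addrK.
  rewrite mulrC ler_pdivlMr// mulrC (le_trans _ n0t)// ler_wpM2l// ler_nat//.
have n0n : (n0 <= n)%N.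
  apply: (leq_trans n0m); rewrite /n leqW// truncn_ge_nat//.
  have /andP[h _] := truncn_itv dm; rewrite (le_trans h)// ler_wpM2r// lerD2l.
  by rewrite (@le_trans _ _ 0)// ?oppr_le0 ltW.
have ek (k : nat) : e * k%:R <= delta / 4 * (k%:R * mu).
  rewrite [leRHS](_ : _ = mu * (delta / 4) * k%:R); last by ring.
  by rewrite ler_wpM2r// ge_min lexx orbT.
have mdev k : measurable_fun setT (fun w => (e * k%:R < `|S k w - k%:R * mu|)%R%:R : R).
  by apply: measurable_ltr_indicator => //; apply: measurableT_comp => //; exact: measurable_funB.
have ind (b : T -> bool) : measurable_fun setT (fun w => (b w)%:R : R) ->
    P.-integrable setT (EFin \o (fun w => (b w)%:R : R)).
  by move=> mb; apply: (bounded_integrable _ mb (M := 1)) => w; rewrite ger0_norm// lern1 leq_b1.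
have ee : e <= eta by rewrite ge_min lexx.
split.
- apply: le_trans ee; apply: le_trans (hn0 m n0m); apply: le_Rintegral => //.
  + by apply: ind; exact: measurable_ltr_indicator.
  + exact: ind.
  move=> w _; case: (ltP t (S m w)) => // tS; rewrite (_ : _ < _)//.
  apply: lt_le_trans (ler_norm _); apply: early_deviation d01 _ _ (ek m) tS.
    by rewrite mulr_ge0// ltW.
  have /andP[h _] := truncn_itv dm.
  by rewrite -ler_pdivlMr// -mulrA.
- apply: le_trans ee; apply: le_trans (hn0 n n0n); apply: le_Rintegral => //.
  + by apply: ind; exact: measurable_ler_indicator.
  + exact: ind.
  move=> w _; case: (leP (S n w) t) => // St; rewrite (_ : _ < _)//.
  rewrite distrC; apply: lt_le_trans (ler_norm _); apply: late_deviation d01 t0 _ (ek n) St.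
  have /andP[_ h] := truncn_itv dn.
  by rewrite -ltr_pdivrMr// -mulrA.
Qed.

Section lipschitz_test.
Variables (f : R -> R) (M L : R).
Hypotheses (fM : forall x, `|f x| <= M) (fL : forall x y, `|f x - f y| <= L * `|x - y|).

Let cf : continuous f. Proof. exact: lipschitz_continuous_real fL. Qed.

Let mf : measurable_fun setT f. Proof. exact: continuous_measurable_fun. Qed.

(** Four quarters of [e]: passing from [f] to the smooth [g], the smooth limit theorem with variance
    m sigma2 / t, the change of this variance to sigma2 / mu, and the return from [g] to [f]. *)
Lemma clt_lipschitz (e : R) : 0 < e ->
  exists2 delta, 0 < delta & exists2 t0, 0 < t0 & forall t (m : nat), t0 <= t ->
    m%:R <= t / mu -> (1 - delta) * (t / mu) <= m.+1%:R ->
    `|\int[P]_w f ((Num.sqrt t)^-1 * U m w) - \int[normal_law 0 (sigma2 / mu)]_y f y| <= e.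
Proof.
move=> e0; have mu0 := mean_gap_gt0; have e40 : 0 < e / 4 by rewrite divr_gt0.
have e80 : 0 < e / 8 by rewrite divr_gt0.
have [K [g [g1 [g2 [gK cg fg]]]]] := smooth_test_dense fM fL e40.
have [[mg _ _] gb _] := gK.
have gbK x : `|g x| <= K by have [] := gb x.
have K0 : 0 <= K by exact: le_trans (normr_ge0 _) (gbK 0).
have C0 : 0 <= mu^-1 by rewrite invr_ge0 ltW.
have [t0 t00 ht0] := clt_smooth iidX mphi W2 EW0 gK cg C0 e40.
have A0 : 0 <= 2 * K * sigma2 by rewrite !mulr_ge0.
have [delta /andP[delta0 _] hdelta] := exists_small (mulr_ge0 A0 C0) e80.
have [s /andP[s0 _] hs] := exists_small A0 e80.
exists delta => //; exists (Num.max t0 s^-1); first by rewrite lt_max t00.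
move=> t m; rewrite ge_max => /andP[t0t st] mt tm.
have t_gt0 : 0 < t by exact: lt_le_trans t0t.
have ts : t^-1 <= s by rewrite -[s]invrK lef_pV2 ?posrE ?invr_gt0.
have := ht0 t m t0t; rewrite mulrC => /(_ mt) h1.
have vw : m%:R * sigma2 / t <= sigma2 / mu.
  rewrite mulrAC mulrC ler_wpM2l// ler_pdivrMr// mulrC//.
have v0 : 0 <= m%:R * sigma2 / t by rewrite divr_ge0 ?mulr_ge0// ltW.
have h2 := normal_law_perturbation gK cg v0 vw.
have h3 : 2 * K * (sigma2 / mu - m%:R * sigma2 / t) <= e / 4.
  (* The index falls short of t / mu by the fraction [delta] and by at most one more for rounding;
     the two defects get e / 8 each. *)
  have tm' : (1 - delta) / mu - t^-1 <= m%:R / t.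
    rewrite lerBlDr [leRHS](_ : _ = m.+1%:R / t); last by rewrite -natr1 mulrDl mul1r.
    by rewrite ler_pdivlMr// mulrAC -mulrA.
  have -> : e / 4 = e / 8 + e / 8 by field.
  apply: le_trans (lerD hdelta hs).
  have -> : 2 * K * sigma2 / mu * delta + 2 * K * sigma2 * s =
     2 * K * sigma2 * (delta / mu + s) by ring.
  have -> : 2 * K * (sigma2 / mu - m%:R * sigma2 / t) =
     2 * K * sigma2 * (mu^-1 - m%:R / t) by ring.
  rewrite ler_wpM2l// lerBlDr; apply: (@le_trans _ _ (delta / mu + t^-1 + ((1 - delta) / mu - t^-1))).
    by rewrite le_eqVlt; apply/orP; left; apply/eqP; field; rewrite !gt_eqF.
  by rewrite !lerD// lerD.
have mfU : measurable_fun setT (fun w => f ((Num.sqrt t)^-1 * U m w)).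
  by apply: measurableT_comp => //; exact: measurable_funM.
have mgU : measurable_fun setT (fun w => g ((Num.sqrt t)^-1 * U m w)).
  by apply: measurableT_comp => //; exact: measurable_funM.
have h4 : `|\int[P]_w f ((Num.sqrt t)^-1 * U m w) - \int[P]_w g ((Num.sqrt t)^-1 * U m w)| <= e / 4.
  rewrite -(RintegralB measurableT (bounded_integrable P mfU (fun w => fM _))
                                   (bounded_integrable P mgU (fun w => gbK _))).
  by apply: bounded_Rintegral => [|w]; [exact: measurable_funB|exact: fg].
move: h1 h2; move: (normal_law 0 _) (normal_law 0 _) => nu1 nu2 h1 h2.
have h5 : `|\int[nu1]_y g y - \int[nu1]_y f y| <= e / 4.
  rewrite -(RintegralB measurableT (bounded_integrable nu1 mg gbK) (bounded_integrable nu1 mf fM)).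
  by apply: bounded_Rintegral => [|w]; [exact: measurable_funB|rewrite distrC; exact: fg].
rewrite distrC in h2.
rewrite (_ : e = e / 4 + (e / 4 + (e / 4 + e / 4))); last by field.
apply: le_trans (ler_distD (\int[P]_w g ((Num.sqrt t)^-1 * U m w)) _ _) _; rewrite lerD//.
apply: le_trans (ler_distD (\int[nu2]_y g y) _ _) _; rewrite lerD//.
by apply: le_trans (ler_distD (\int[nu1]_y g y) _ _) _; rewrite lerD// (le_trans h2).
Qed.

End lipschitz_test.

End random_index.

(** * The limit theorem for Lipschitz test functions *)

Section cumulative_process.
Context d (T : measurableType d) (R : realType) (P : probability T R).
Context d' (E : measurableType d').
Variable X : nat -> T -> E.
Hypothesis iidX : iid P X.
Variables tau phi : E -> R.
Hypotheses (mtau : measurable_fun setT tau) (mphi : measurable_fun setT phi).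
Hypothesis tau0 : forall n w, 0 < tau (X n w).
Hypothesis itau : P.-integrable setT (EFin \o (tau \o X 0)).
Hypothesis W2 : P.-integrable setT (EFin \o (fun w => phi (X 0 w) ^+ 2)).
Hypothesis EW0 : \int[P]_w phi (X 0 w) = 0.

Let S := partial_sum X tau.
Let U := partial_sum X phi.
Let mu := \int[P]_w tau (X 0 w).
Let sigma2 := \int[P]_w phi (X 0 w) ^+ 2.

Variable bad : nat -> E -> bool.
Hypothesis mbad : forall r, measurable_fun setT (fun x => (bad r x)%:R : R).
Hypothesis ae_good : {ae P, forall w, \forall r \near \oo, ~~ bad r (X 0 w)}.
Variables (Y : R -> T -> R) (rho : nat -> R).
Hypothesis mY : forall t, 0 <= t -> measurable_fun setT (Y t).
Hypothesis rho0 : forall r, 0 <= rho r.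
Hypothesis Y_near : forall t r n w, 0 <= t -> S n w <= t < S n.+1 w -> ~~ bad r (X n w) ->
  `|Y t w - U n.+1 w| <= rho r.

Lemma cumulative_clt_lipschitz (f : R -> R) (M L e : R) : (forall x, `|f x| <= M) ->
  (forall x y, `|f x - f y| <= L * `|x - y|) -> 0 < e ->
  exists2 t0, 0 < t0 & forall t, t0 <= t ->
  `|\int[P]_w f ((Num.sqrt t)^-1 * Y t w) - \int[normal_law 0 (sigma2 / mu)]_y f y| <= e.
Proof.
move=> fM fL e0.
have M0 : 0 <= M by exact: le_trans (normr_ge0 _) (fM 0).
have L0 : 0 <= L.
  by have := fL 1 0; rewrite subr0 normr1 mulr1; exact: le_trans.
have mf : measurable_fun setT f.
  by apply: continuous_measurable_fun; exact: lipschitz_continuous_real fL.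
have mu0 : 0 < mu := mean_gap_gt0 iidX mtau tau0 itau.
have sigma20 : 0 <= sigma2 by apply: Rintegral_ge0 => w _; exact: sqr_ge0.
have e40 : 0 < e / 4 by rewrite divr_gt0.
have e160 : 0 < e / 16 by rewrite divr_gt0.
have [delta0 delta00 [t0 t00 clt]] :=
  clt_lipschitz iidX mtau mphi tau0 itau W2 EW0 fM fL (divr_gt0 e0 (ltr0Sn _ 7)).
(* Order of choices: [delta1] depends on [kappa], through the second moment divided by it; [eta]
   fixes the level [r]; only then is t taken large, as the oscillation bound [rho r] must be small
   against sqrt t. *)
have [kappa /andP[kappa0 _] hkappa] := exists_small L0 e40.
have A0 : 0 <= L * sigma2 / kappa by rewrite divr_ge0 ?mulr_ge0// ltW.
have [delta1 /andP[delta10 delta12] hdelta] :=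
  exists_small (divr_ge0 A0 (ltW mu0)) e160.
pose delta := Num.min delta0 delta1.
have delta01 : 0 < delta <= 2^-1.
  by rewrite lt_min delta00 delta10 ge_min delta12 orbT.
have [eta /andP[eta0 _] heta] : exists2 eta, 0 < eta <= 2^-1 & 2 * M * 3 * eta <= e / 4.
  by apply: exists_small => //; rewrite !mulr_ge0.
have [r hr] := straddling_cycle_good iidX mtau tau0 itau mbad ae_good eta0.
have [t1 t10 ht1] := renewal_count_concentration iidX mtau tau0 itau delta01 eta0.
have [s1 /andP[s10 _] hs1] := exists_small (mulr_ge0 L0 (rho0 r)) e40.
have [s2 /andP[s20 _] hs2] := exists_small A0 e160.
exists (Num.max (Num.max t0 t1) (Num.max ((s1^-1) ^+ 2) s2^-1)); first by rewrite !lt_max t00.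
move=> t; rewrite !ge_max => /andP[/andP[t0t t1t] /andP[s1t s2t]].
have t_gt0 : 0 < t by exact: lt_le_trans t0t.
pose c := (Num.sqrt t)^-1.
have c0 : 0 <= c by rewrite invr_ge0 sqrtr_ge0.
have c2 : c ^+ 2 = t^-1 by rewrite /c exprVn sqr_sqrtr// ltW.
have cs : c <= s1.
  rewrite -[s1]invrK lef_pV2 ?posrE ?sqrtr_gt0 ?invr_gt0//.
  by rewrite -(ger0_norm (x := s1^-1)) ?invr_ge0 ?(ltW s10)// -sqrtr_sqr ler_wsqrtr.
have ts : t^-1 <= s2 by rewrite -[s2]invrK lef_pV2 ?posrE ?invr_gt0.
have [p1 p2] := ht1 t t1t; move: p1 p2.
set m := Num.truncn _; set n := (Num.truncn _).+1 => p1 p2.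
have [d0 d1] := andP delta01.
have tmu0 : 0 <= t / mu by exact: divr_ge0 (ltW t_gt0) (ltW mu0).
have d11 : 0 <= 1 - delta by rewrite subr_ge0 (le_trans d1)// invf_le1// ler1n.
have /andP[m1 m2] := truncn_itv (mulr_ge0 d11 tmu0).
have /andP[n1 _] := truncn_itv (mulr_ge0 (addr_ge0 ler01 (ltW d0)) tmu0).
have mn : (m <= n)%N.
  rewrite /n leqW// truncn_ge_nat; last exact: mulr_ge0 (addr_ge0 ler01 (ltW d0)) tmu0.
  by rewrite (le_trans m1)// ler_wpM2r// lerD2l (@le_trans _ _ 0)// ?oppr_le0 ltW.
(* Rounding contributes one unit at either end, whence the summand 1 inside the factor 2. *)
have nm : (n - m)%:R <= 2 * (delta * (t / mu) + 1).
  rewrite natrB// lerBlDr.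
  have -> : 2 * (delta * (t / mu) + 1) + m%:R =
    (1 + delta) * (t / mu) + 1 + (m%:R + 1 - (1 - delta) * (t / mu)) by ring.
  by rewrite /n -natr1 ler_wpDr ?lerD2r// subr_ge0 natr1 ltW.
have mt : m%:R <= t / mu by rewrite (le_trans m1)// ler_piMl// gerBl ltW.
have tm : (1 - delta0) * (t / mu) <= m.+1%:R.
  rewrite (le_trans _ (ltW m2))// ler_wpM2r// lerD2l lerN2.
  by rewrite ge_min lexx.
have clt_t := clt t m t0t mt tm.
have frozen := frozen_time_error iidX mtau mphi tau0 W2 EW0 fM fL L0 mf (mbad r)
  (mY (ltW t_gt0)) (fun n w => @Y_near t r n w (ltW t_gt0)) mn c0 kappa0 (rho0 r).
apply: le_trans (ler_distD (\int[P]_w f (c * U m w)) _ _) _.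
(* In order: the exceptional events, the oscillation of the straddling cycle, [kappa], the second
   moment of the weighted sum; the last e / 8 is the limit theorem at the deterministic index
   [m]. *)
rewrite (_ : e = e / 4 + (e / 4 + (e / 4 + e / 8)) + e / 8); last by field.
apply: lerD => //; apply: (le_trans frozen); apply: lerD.
  apply: le_trans heta; rewrite -[leRHS]mulrA ler_wpM2l ?mulr_ge0//.
  rewrite (_ : 3 * eta = eta + eta + eta); last by ring.
  by apply: lerD; [exact: lerD|exact: hr (ltW t_gt0)].
rewrite mulrDr; apply: lerD.
  by apply: le_trans hs1; rewrite [c * _]mulrC mulrA ler_wpM2l// mulr_ge0.
rewrite mulrDr; apply: lerD.
  by apply: le_trans hkappa; rewrite ler_wpM2l// ler_pdivrMr// ler_peMr ?(ltW kappa0)// ler1n.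
apply: (@le_trans _ _ (L * sigma2 / kappa / mu * delta + L * sigma2 / kappa * t^-1)).
  rewrite c2 (_ : L * sigma2 / kappa / mu * delta + L * sigma2 / kappa / t =
    L * (t^-1 / (2 * kappa) * (2 * (delta * (t / mu) + 1) * sigma2))); last first.
    by field; rewrite !gt_eqF.
  rewrite ler_wpM2l// ler_wpM2l ?ler_wpM2r//.
  by rewrite divr_ge0 ?invr_ge0 ?mulr_ge0// ltW.
rewrite (_ : e / 8 = e / 16 + e / 16); last by field.
apply: lerD.
  apply: le_trans hdelta; rewrite ler_wpM2l ?ge_min ?lexx ?orbT//.
  exact: divr_ge0 A0 (ltW mu0).
by apply: le_trans hs2; rewrite ler_wpM2l.
Qed.

End cumulative_process.

(** * From Lipschitz to continuous test functions *)

Section inf_convolution.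
Context {R : realType}.
Variables (f : R -> R) (M : R).
Hypothesis fM : forall x, `|f x| <= M.

(** The Pasch-Hausdorff envelope, the largest [k]-Lipschitz minorant of the bounded function [f]. *)
Definition inf_convolution (k x : R) : R := inf [set f y + k * `|x - y| | y in setT].

Let values_lb k x : 0 <= k -> lbound [set f y + k * `|x - y| | y in setT] (- M).
Proof.
move=> k0 _ [y _ <-]; rewrite ler_wpDr ?mulr_ge0//.
by have := fM y; rewrite ler_norml => /andP[].
Qed.

Lemma inf_convolution_le (k x y : R) : 0 <= k -> inf_convolution k x <= f y + k * `|x - y|.
Proof. by move=> k0; apply: ge_inf; [exists (- M); exact: values_lb|exists y]. Qed.

Lemma le_inf_convolution (k x z : R) : (forall y, z <= f y + k * `|x - y|) -> z <= inf_convolution k x.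
Proof. by move=> h; apply: lb_le_inf; [exists (f 0 + k * `|x - 0|), 0|move=> _ [y _ <-]]. Qed.

Lemma inf_convolution_le_id (k x : R) : 0 <= k -> inf_convolution k x <= f x.
Proof. by move=> k0; have := inf_convolution_le x x k0; rewrite subrr normr0 mulr0 addr0. Qed.

Lemma inf_convolution_bounded (k x : R) : 0 <= k -> `|inf_convolution k x| <= M.
Proof.
move=> k0; rewrite ler_norml; apply/andP; split.
  by apply: le_inf_convolution => y; apply: (@values_lb k x k0); exists y.
by apply: (le_trans (inf_convolution_le_id x k0)); exact: le_trans (ler_norm _) (fM x).
Qed.

Lemma inf_convolution_lipschitz (k x y : R) : 0 <= k ->
  `|inf_convolution k x - inf_convolution k y| <= k * `|x - y|.
Proof.
move=> k0; suff H u v : inf_convolution k u - k * `|u - v| <= inf_convolution k v.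
  have := H x y; have := H y x; rewrite distrC ler_norml => ? ?; apply/andP; split; lra.
apply: le_inf_convolution => z; rewrite lerBlDr (le_trans (inf_convolution_le u z k0))//.
by rewrite -addrA lerD2l -mulrDr ler_wpM2l// [leRHS]addrC ler_distD.
Qed.

Lemma cvg_inf_convolution (x : R) : {for x, continuous f} ->
  inf_convolution n%:R x @[n --> \oo] --> f x.
Proof.
move=> cf; apply/cvgrPdist_le => e e0.
have M0 : 0 <= M by exact: le_trans (normr_ge0 _) (fM 0).
have /cvgrPdist_le/(_ e e0)/nbhs_ballP[delta /= delta0 hd] := cf.
near=> n; have n0 : 0 <= n%:R :> R by [].
rewrite ger0_norm ?subr_ge0 ?inf_convolution_le_id// lerBlDr -lerBlDl.
apply: le_inf_convolution => y; have [xy|xy] := ltP `|x - y| delta.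
  have := hd y xy; rewrite ler_norml => /andP[_ h].
  by rewrite ler_wpDr ?mulr_ge0//; lra.
(* Beyond distance [delta] the penalty then exceeds the total oscillation 2M of [f], so only nearby
   points compete for the infimum. *)
have nM : 2 * M / delta <= n%:R by near: n; exact: nbhs_infty_ger.
have : 2 * M <= n%:R * `|x - y|.
  by rewrite (le_trans _ (ler_wpM2l n0 xy))// -ler_pdivrMr.
have := fM x; have := fM y; rewrite !ler_norml => /andP[? ?] /andP[? ?] ?; lra.
Unshelve. all: by end_near. Qed.

End inf_convolution.

Lemma half_slack (R : realFieldType) (a b c e : R) :
  a - b <= e / 2 -> - (e / 2) <= c - b -> a - e <= c.
Proof. by move=> ? ?; lra. Qed.

Section lipschitz_determining.
Context d (T : measurableType d) (R : realType) (P : probability T R).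
Variables (V : R -> T -> R) (nu : probability (measurableTypeR R) R).
Hypothesis mV : forall t, 0 <= t -> measurable_fun setT (V t).
Hypothesis lipschitz_cvg : forall (f : R -> R) (M L e : R), (forall x, `|f x| <= M) ->
  (forall x y, `|f x - f y| <= L * `|x - y|) -> 0 < e ->
  exists2 t0, 0 < t0 & forall t, t0 <= t ->
    `|\int[P]_w f (V t w) - \int[nu]_y f y| <= e.

(** A minorant only has to be close to [f] in mean under the fixed limit law [nu], which dominated
    convergence gives; no tightness of the laws of [V t] is needed. The upper bound follows from
    [- f]. *)
Let lower_bound (f : R -> R) (M e : R) : (forall x, `|f x| <= M) -> continuous f -> 0 < e ->
  exists2 t0, 0 < t0 & forall t, t0 <= t -> \int[nu]_y f y - e <= \int[P]_w f (V t w).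
Proof.
move=> fM cf e0; have M0 : 0 <= M by exact: le_trans (normr_ge0 _) (fM 0).
pose g n := inf_convolution f n%:R.
have gM n x : `|g n x| <= M by exact: inf_convolution_bounded.
have gL n x y : `|g n x - g n y| <= n%:R * `|x - y| by exact: (inf_convolution_lipschitz fM).
have gf n x : g n x <= f x by exact: (inf_convolution_le_id fM).
have mf : measurable_fun setT f by exact: continuous_measurable_fun.
have mg n : measurable_fun setT (g n).
  by apply: continuous_measurable_fun; exact: lipschitz_continuous_real (gL n).
have [|||||n hn] := @dominated_small _ _ _ nu (fun n x => f x - g n x) (fun=> 2 * M) (e / 2).
- by move=> n; exact: (@measurable_funB _ _ R setT f (g n) mf (mg n)).
- move=> n x; rewrite subr_ge0 gf/= (le_trans (ler_norm _))// (le_trans (ler_normB _ _))//.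
  by rewrite mulr2n mulrDl !mul1r lerD.
- by apply: (@bounded_integrable _ _ _ nu _ `|2 * M|).
- apply: aeW => x; rewrite -[X in _ --> X](subrr (f x)); apply: cvgB; first exact: cvg_cst.
  by apply: cvg_inf_convolution; [exact: fM|exact: cf].
- by rewrite divr_gt0.
have e20 : 0 < e / 2 by rewrite divr_gt0.
have [t0 t00 ht0] := lipschitz_cvg (gM n) (gL n) e20.
exists t0 => // t t0t; have := ht0 t t0t.
have mVt := mV (le_trans (ltW t00) t0t).
have igV : P.-integrable setT (EFin \o (fun w => g n (V t w))).
  apply: (@bounded_integrable _ _ _ P _ M); first exact: measurableT_comp.
  by move=> w; exact: gM.
have ifV : P.-integrable setT (EFin \o (fun w => f (V t w))).
  apply: (@bounded_integrable _ _ _ P _ M); first exact: measurableT_comp.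
  by move=> w; exact: fM.
rewrite ler_norml => /andP[h _].
apply: (@le_trans _ _ (\int[P]_w g n (V t w))); last by apply: le_Rintegral.
move: hn; rewrite (RintegralB measurableT (@bounded_integrable _ _ _ nu _ _ mf fM)
  (@bounded_integrable _ _ _ nu _ _ (mg n) (gM n))) => hn.
exact: half_slack hn h.
Qed.

Lemma bounded_continuous_cvg (f : R -> R) (M e : R) : (forall x, `|f x| <= M) -> continuous f -> 0 < e ->
  exists2 t0, 0 < t0 & forall t, t0 <= t ->
    `|\int[P]_w f (V t w) - \int[nu]_y f y| <= e.
Proof.
move=> fM cf e0; have mf : measurable_fun setT f by exact: continuous_measurable_fun.
have [t0 t00 h0] := lower_bound fM cf e0.
have NfM x : `|- f x| <= M by rewrite normrN.
have cNf : continuous (fun x => - f x) by move=> x; apply: cvgN; exact: cf.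
have [t1 t10 h1] := lower_bound NfM cNf e0.
exists (Num.max t0 t1); first by rewrite lt_max t00.
move=> t; rewrite ge_max => /andP[t0t t1t].
have mVt := mV (le_trans (ltW t00) t0t).
have ifV : P.-integrable setT (EFin \o (fun w => f (V t w))).
  apply: (@bounded_integrable _ _ _ P _ M); first exact: measurableT_comp.
  by move=> w; exact: fM.
have inf := @bounded_integrable _ _ _ nu _ _ mf fM.
have RN d2 (T2 : measurableType d2) (Q : probability T2 R) (h : T2 -> R) :
    Q.-integrable setT (EFin \o h) -> \int[Q]_w (- h w) = - \int[Q]_w h w.
  move=> ih; rewrite -mulN1r -(RintegralZl _ measurableT ih).
  by apply: eq_Rintegral => w _; rewrite mulN1r.
have := h0 t t0t; have := h1 t t1t.
rewrite (RN _ _ P _ ifV) (RN _ _ nu _ inf) ler_norml => a b.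
apply/andP; split; first by rewrite lerBrDr addrC.
by rewrite lerBlDr -lerN2 opprD addrC.
Qed.

End lipschitz_determining.

(** * Regenerative cycles *)

Section path_functionals.
Variable R : realType.

Definition sample_time (x : R) : {nonneg R} := NngNum (normr_ge0 x).

Lemma measurable_path_eval (s : {nonneg R}) :
  measurable_fun setT (fun p : path_space R => p s).
Proof.
move=> _ B mB; rewrite setTI; apply: sub_sigma_algebra.
by exists s, B.
Qed.

(* For a path stopped at [e.1] this is its terminal value. *)
Definition path_total (e : R * path_space R) : R :=
  e.2 (sample_time (Num.truncn `|e.1|).+1%:R).

(** Evaluation at a random time is not directly available, so the space is cut by the integer part
    of the length; on each piece the evaluation time is constant. *)
Lemma measurable_path_total : measurable_fun setT path_total.
Proof.
move=> _ B mB; rewrite setTI.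
have -> : path_total @^-1` B = \bigcup_k
    ([set e | k%:R <= `|e.1|] `&` [set e | `|e.1| < k.+1%:R] `&`
     [set e | B (e.2 (sample_time k.+1%:R))]).
  apply/seteqP; split => [e Be|e [k _ [[/= h1 h2] h3]]].
    by have /andP[? ?] := truncn_itv (normr_ge0 e.1); exists (Num.truncn `|e.1|).
  by rewrite /path_total (truncn_def (n := k))// h1.
have m1 : measurable_fun setT (fun e : R * path_space R => `|e.1|).
  by apply: measurableT_comp => //; exact: measurable_fst.
apply: bigcup_measurable => k _; apply: measurableI.
  by apply: measurableI; [exact: measurable_set_le|exact: measurable_set_lt].
rewrite -[X in measurable X]setTI.
have := measurableT_comp (measurable_path_eval (sample_time k.+1%:R))
  (@measurable_snd _ _ R (path_space R)).
exact.
Qed.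

(* On càdlàg paths, boundedness by [r] over the whole cycle. *)
Definition tame_cycle (a : R) (r : nat) (e : R * path_space R) : Prop :=
  `|a| * e.1 <= r%:R /\ forall q : rat, `|e.2 (sample_time (ratr q))| <= r%:R.

Lemma measurable_tame_cycle a r : measurable (tame_cycle a r).
Proof.
have -> : tame_cycle a r = [set e | `|a| * e.1 <= r%:R] `&`
    ~` \bigcup_(q : rat) [set e | r%:R < `|e.2 (sample_time (ratr q))|].
  apply/seteqP; split => [e [h1 h2]|e [h1 h2]]; split => //.
    by move=> [q _ /=]; rewrite ltNge h2.
  by move=> q; rewrite leNgt; apply/negP => h; apply: h2; exists q.
apply: measurableI.
  apply: measurable_set_le => //; apply: measurable_funM => //; exact: measurable_fst.
apply: measurableC; apply: bigcupT_measurable_rat => q.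
apply: measurable_set_lt => //; apply: measurableT_comp => //.
exact: measurableT_comp (measurable_path_eval _) measurable_snd.
Qed.

End path_functionals.

Section cycles.
Context d (T : measurableType d) (R : realType).
Variables (xi : nat -> T -> R) (Z : R -> T -> R).
Hypothesis xi0 : forall n w, 0 < xi n w.
Hypothesis Z_cadlag : forall w, cadlag (fun t => Z t w).
Hypothesis Z0 : forall w, Z 0 w = 0.
Variable a : R.

Let X := increment xi Z.
Let S := renewal_time xi.

Definition centered_total (e : R * path_space R) : R := path_total e - a * e.1.

Lemma measurable_centered_total : measurable_fun setT centered_total.
Proof.
apply: measurable_funB; first exact: measurable_path_total.
by apply: measurable_funM => //; exact: measurable_fst.
Qed.

Lemma renewal_timeS n w : S n.+1 w = S n w + xi n w.
Proof. by rewrite /S /renewal_time big_ord_recr. Qed.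

Lemma renewal_time0 w : S 0 w = 0.
Proof. by rewrite /S /renewal_time big_ord0. Qed.

Lemma renewal_time_ge0 n w : 0 <= S n w.
Proof. by apply: sumr_ge0 => i _; exact: ltW. Qed.

Lemma path_total_increment n w : path_total (X n w) = Z (S n.+1 w) w - Z (S n w) w.
Proof.
rewrite /path_total /X /increment/= -/(S n w) min_r ?[_ + S n w]addrC -?renewal_timeS//.
rewrite (ger0_norm (x := _%:R))//; apply: ltW; apply: le_lt_trans (truncnS_gt _).
exact: ler_norm.
Qed.

Lemma partial_sum_centered n w :
  partial_sum X centered_total n w = Z (S n w) w - a * S n w.
Proof.
rewrite /partial_sum; elim: n => [|n IH].
  by rewrite big_ord0 renewal_time0 Z0 mulr0 subr0.
rewrite big_ord_recr/= IH /centered_total path_total_increment renewal_timeS /X/=; ring.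
Qed.

(** By right-continuity a value above [r] would persist just after [t], up to some rational sampling
    time. At the end of the cycle this fails, as the path beyond belongs to the next cycle; there a
    sampling time past the end returns the stopped value. *)
Lemma tame_cycle_bound r n w t : tame_cycle a r (X n w) -> S n w <= t <= S n.+1 w ->
  `|Z t w - Z (S n w) w| <= r%:R.
Proof.
move=> [_ tame] /andP[nt tn].
have sampled q : 0 <= q -> `|Z (Num.min (ratr q) (xi n w) + S n w) w - Z (S n w) w| <= r%:R.
  by move=> q0; have := tame q; rewrite /X/= (ger0_norm (x := ratr q))// ler0q.
move: tn; rewrite le_eqVlt => /predU1P[->|tn].
  have := sampled (Num.truncn (xi n w)).+1%:R (ler0n _ _).
  rewrite ratr_nat min_r; first by rewrite renewal_timeS [S n w + _]addrC.
  by apply: ltW; exact: truncnS_gt.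
rewrite leNgt; apply/negP => big.
have t0 : 0 <= t by exact: le_trans (renewal_time_ge0 n w) nt.
have [right _] := Z_cadlag w t0.
have cvgd : `|Z x w - Z (S n w) w| @[x --> t^'+] --> `|Z t w - Z (S n w) w|.
  by apply: cvg_norm; apply: cvgB right _; exact: cvg_cst.
have : \forall x \near t^'+, r%:R < `|Z x w - Z (S n w) w| by exact: (cvgr_gt _ cvgd).
rewrite /at_right near_withinE => /nbhs_ballP[e /= e0 he].
(* A rational in this interval is later than [t], still in the neighbourhood, and before the time at
   which the path is stopped. *)
have st : t - S n w < Num.min (t - S n w + e) (xi n w).
  by rewrite lt_min ltrDl e0 ltrBlDl -renewal_timeS.
have [q] := rat_in_itvoo st; rewrite in_itv/= lt_min => /and3P[tq qe qxi].
have q0 : 0 <= q by rewrite -(ler0q R) (le_trans _ (ltW tq))// subr_ge0.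
have := sampled q q0; rewrite min_l ?(ltW qxi)// leNgt => /negP; apply; apply: he.
  by rewrite /ball/= ltr_distlC; apply/andP; split; lra.
by rewrite -ltrBlDr.
Qed.

(** One [r] each for the oscillation up to [t], the total over the cycle, and the drift from [t] to
    its end; the length condition in [tame_cycle] serves the last. *)
Lemma tame_cycle_near r n w t : tame_cycle a r (X n w) -> S n w <= t < S n.+1 w ->
  `|Z t w - a * t - partial_sum X centered_total n.+1 w| <= 3 * r%:R.
Proof.
move=> tame /andP[nt tn]; have SS : S n w <= S n.+1 w by exact: le_trans nt (ltW tn).
have h1 : `|Z t w - Z (S n w) w| <= r%:R.
  by apply: tame_cycle_bound tame _; rewrite nt ltW.
have h2 : `|Z (S n.+1 w) w - Z (S n w) w| <= r%:R.
  by apply: tame_cycle_bound tame _; rewrite SS lexx.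
have h3 : `|a * (S n.+1 w - t)| <= r%:R.
  rewrite normrM (ger0_norm (x := _ - _)) ?subr_ge0 ?(ltW tn)//.
  have [h _] := tame; apply: le_trans h; rewrite ler_wpM2l//.
  by rewrite lerBlDl renewal_timeS lerD2r.
rewrite partial_sum_centered.
have -> : Z t w - a * t - (Z (S n.+1 w) w - a * S n.+1 w) = Z t w - Z (S n w) w -
   (Z (S n.+1 w) w - Z (S n w) w) + a * (S n.+1 w - t) by ring.
have -> : 3 * r%:R = r%:R + r%:R + r%:R :> R by ring.
apply: (le_trans (ler_normD _ _)); apply: lerD => //.
by apply: (le_trans (ler_normB _ _)); exact: lerD.
Qed.

Lemma eventually_tame (m : R) w : (forall t, 0 <= t <= S 1 w -> `|Z t w| <= m) ->
  \forall r \near \oo, tame_cycle a r (X 0 w).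
Proof.
move=> Zm; near=> r; split; first by near: r; exact: nbhs_infty_ger.
move=> q; rewrite /X/= -/(S 0 w) renewal_time0 Z0 subr0 addr0.
apply: (@le_trans _ _ m); last by near: r; exact: nbhs_infty_ger.
apply: Zm; rewrite renewal_timeS renewal_time0 add0r ge_min lexx orbT andbT.
by rewrite le_min normr_ge0 ltW.
Unshelve. all: by end_near. Qed.

End cycles.

Theorem theorem1p4 (d : measure_display) (T : measurableType d) (R : realType)
    (P : probability T R) (xi : nat -> T -> R) (Z : R -> T -> R)
    (xi_renewal : renewal_increments P xi)
    (Z_cadlag : cadlag_process Z)
    (Z_regenerative : regenerative_increments P xi Z) :
  let T1 := renewal_time xi 1 in
  let ZT1 := fun w => Z (T1 w) w in
  let mu := fine 'E_P[T1]%E in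
  let a := fine 'E_P[ZT1]%E / mu in
  let sigma2 := 'V_P[fun w => (ZT1 w - a * T1 w)%R]%E in
  let M1 := fun w => ereal_sup [set `|Z t w|%:E | t in `[0, T1 w]] in
  P.-integrable setT (EFin \o T1) ->
  P.-integrable setT (EFin \o ZT1) ->
  (sigma2 < +oo)%E ->
  {ae P, forall w, (M1 w < +oo)%E} ->
  cvg_in_distribution P (fun t w => (Z t w - a * t) / Num.sqrt t)
    (normal_law 0 (fine sigma2 / mu)).
Proof.
move=> T1 ZT1 mu a sigma2 M1 iT1 iZT1 fin_var M1_fin.
have [iid_xi xi0] := xi_renewal; have [mZ cZ] := Z_cadlag; have [Z0 iidX] := Z_regenerative.
pose X := increment xi Z; pose phi := @centered_total R a.
have S1 w : renewal_time xi 1 w = xi 0%N w.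
  by rewrite renewal_timeS renewal_time0 add0r.
have phiE w : phi (X 0%N w) = ZT1 w - a * T1 w.
  by rewrite /phi /centered_total path_total_increment renewal_time0 Z0 subr0 /ZT1 /T1 S1.
have mtau : measurable_fun setT (fst : R * path_space R -> R) by exact: measurable_fst.
have mphi : measurable_fun setT phi by exact: measurable_centered_total.
have tau0 n w : 0 < fst (X n w) by exact: xi0.
have itau : P.-integrable setT (EFin \o (fst \o X 0%N)).
  rewrite (_ : fst \o X 0%N = T1)//; apply/funext => w; by rewrite /T1 S1.
have muE : \int[P]_w fst (X 0%N w) = mu.
  rewrite /mu unlock /Rintegral; congr fine; apply: eq_integral => w _.
  by rewrite /T1 S1.
have mu0 : 0 < mu by rewrite -muE; have := @mean_gap_gt0 _ _ _ _ _ _ X iidX fst mtau tau0 itau.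
have iaT1 := integrableZ_EFin a iT1.
have phiX : (fun w => phi (X 0%N w)) = (fun w => ZT1 w - a * T1 w).
  by apply/funext.
have ET1 : \int[P]_w T1 w = mu by rewrite /mu unlock.
(* The choice of [a] centers the cycle totals; cancelling mu uses its positivity. *)
have EW0 : \int[P]_w phi (X 0%N w) = 0.
  rewrite phiX (RintegralB measurableT iZT1 iaT1) (RintegralZl _ measurableT iT1) ET1.
  by rewrite /a divfK ?gt_eqF// unlock /Rintegral subrr.
(* By centering, the variance is the second moment of [phi], so its finiteness becomes the square
   integrability required below. *)
have varE : sigma2 = (\int[P]_w (phi (X 0%N w) ^+ 2)%:E)%E.
  rewrite /sigma2 /variance unlock.
  have -> : fine 'E_P[fun w => (ZT1 w - a * T1 w)%R]%E = 0 by rewrite unlock -[RHS]EW0 phiX.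
  rewrite unlock; apply: eq_integral => w _ /=.
  by rewrite phiE -[in RHS](subr0 (_ - _)) expr2.
have mphiX : measurable_fun setT (fun w => phi (X 0%N w)).
  by have [mX _ _] := iidX; exact: measurableT_comp mphi (mX 0%N).
have W2 : P.-integrable setT (EFin \o (fun w => phi (X 0%N w) ^+ 2)).
  apply/integrableP; split; first exact/measurable_EFinP/measurable_funX.
  rewrite (le_lt_trans _ fin_var)// varE le_eqVlt; apply/orP; left; apply/eqP.
  by apply: eq_integral => w _ /=; rewrite ger0_norm ?sqr_ge0.
pose bad r e := ~~ `[< @tame_cycle R a r e >].
have mbad r : measurable_fun setT (fun e => (bad r e)%:R : R).
  rewrite (_ : (fun e => _) = \1_(~` @tame_cycle R a r)).
    by apply: measurable_indic; apply: measurableC; exact: measurable_tame_cycle.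
  apply/funext => e; rewrite indicE; congr (nat_of_bool _)%:R.
  by apply/idP/idP; rewrite inE/= => /asboolPn.
have ae_good : {ae P, forall w, \forall r \near \oo, ~~ bad r (X 0%N w)}.
  (* The only use of the finiteness of [M1]: the first cycle is tame at every level beyond it that
     also exceeds its drift. *)
  apply: filterS M1_fin => w M1w.
  have M10 : (0 <= M1 w)%E.
    apply: ereal_sup_ubound; exists 0 => /=; last by rewrite Z0 normr0.
    by rewrite in_itv/= lexx/= /T1 S1 ltW.
  have M1fin : M1 w \is a fin_num by rewrite ge0_fin_numE.
  have Zm t : 0 <= t <= renewal_time xi 1 w -> `|Z t w| <= fine (M1 w).
    move=> t01; rewrite -lee_fin fineK//; apply: ereal_sup_ubound.
    by exists t => //=; rewrite in_itv.
  have := eventually_tame xi0 Z0 a Zm; apply: filterS => r tame.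
  by rewrite /bad negbK; exact/asboolP.
pose Y t w := Z t w - a * t.
have mY t : 0 <= t -> measurable_fun setT (Y t) by move=> t0; apply: measurable_funB => //; exact: mZ.
have rho0 (r : nat) : 0 <= 3 * r%:R :> R by rewrite mulr_ge0.
have Y_near t r n w : 0 <= t -> partial_sum X fst n w <= t < partial_sum X fst n.+1 w ->
    ~~ bad r (X n w) -> `|Y t w - partial_sum X phi n.+1 w| <= 3 * r%:R.
  move=> _ h; rewrite /bad negbK => /asboolP tame.
  have := @tame_cycle_near _ _ _ xi Z xi0 cZ Z0 a r n w t tame h; exact.
have lip := cumulative_clt_lipschitz iidX mtau mphi tau0 itau W2 EW0 mbad ae_good mY rho0 Y_near.
have fine_var : fine sigma2 = \int[P]_w phi (X 0%N w) ^+ 2 by rewrite varE.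
rewrite -muE fine_var in lip *.
move: (normal_law 0 _) lip => nu lip.
pose V t w := (Num.sqrt t)^-1 * Y t w.
have mV t : 0 <= t -> measurable_fun setT (V t).
  by move=> t0; apply: measurable_funM => //; exact: mY.
have cvgV := @bounded_continuous_cvg _ _ _ P V nu mV lip.
move=> f cf [M fM].
have mf : measurable_fun setT f by exact: continuous_measurable_fun.
have ifV t : 0 <= t -> P.-integrable setT (EFin \o (fun w => f (V t w))).
  move=> t0; apply: (@bounded_integrable _ _ _ P _ M); last by move=> w; exact: fM.
  by apply: measurableT_comp => //; exact: mV.
have EV t : 'E_P[f \o (fun w => ((Z t w - a * t) / Num.sqrt t)%R)]%E = (\int[P]_w (f (V t w))%:E)%E.
  rewrite unlock; apply: eq_integral => w _ /=.
  by rewrite /V /Y mulrC.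
rewrite -(EFin_Rintegral nu (@bounded_integrable _ _ _ nu _ _ mf fM)).
apply: cvg_EFin.
  (* [Z t] is measurable for nonnegative times only, so finiteness of the expectation is claimed for
     large t. *)
  near=> t; rewrite EV; apply: integrable_fin_num => //; apply: ifV.
  by near: t; exact: nbhs_pinfty_ge.
apply/cvgrPdist_le => e e0; have [t0 _ ht0] := cvgV f M e fM cf e0.
near=> t; rewrite /= EV distrC; apply: ht0.
by near: t; apply: nbhs_pinfty_ge; exact: num_real.
Unshelve. all: by end_near. Qed.
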